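(* Let $V(\varphi)\subset L^2(\mathbb{R})$ be a sampling space and let $\{E_j\}_{j\in\mathbb{N}}$ be a partition of $E_\varphi$ into periodic measurable sets, i.e. $E_\varphi=\bigcup_j E_j$, $|E_j\cap E_l|=0$ for all $j\ne l$, and $E_j+k=E_j$ for every integer $k$. For $j\in\mathbb{N}$ define $\varphi_j$ by $\hat\varphi_j=\hat\varphi\,\chi_{E_j}$. Then $$V(\varphi)=\bigoplus_j V(\varphi_j),$$ where $V(\varphi_j)$ is a sampling space for each $j$. Furthermore, if $s$ is the sampling function of $V(\varphi)$, then the Fourier transform of the sampling function $s_j$ of $V(\varphi_j)$ is $\hat s_j=\hat s\,\chi_{E_j}$.
   Context: Fourier transform: $\hat f(\omega)=\int_{-\infty}^{+\infty} f(x)e^{-2\pi i x\omega}\,dx$ (extended to $L^2(\mathbb{R})$). For $f\in L^2(\mathbb{R})$, $S(f)$ is the closure in $L^2(\mathbb{R})$ of the linear span of $\{f(\cdot-k):k\in\mathbb{Z}\}$. One writes $V(\varphi)$ for $S(\varphi)$ when $\{\varphi(\cdot-k)\}_{k\in\mathbb{Z}}$ is a frame of $S(\varphi)$ (in particular writing $V(\varphi_j)$ asserts that the translates of $\varphi_j$ form a frame of $S(\varphi_j)$). Grammian: $G_\varphi(\omega)=\sum_{k\in\mathbb{Z}}|\hat\varphi(\omega+k)|^2$, and $E_\varphi=\{\omega\in\mathbb{R}: G_\varphi(\omega)>0\}$; $\chi_E$ is the characteristic function of $E$; $|E|$ is Lebesgue measure. Direct sum: $\bigoplus_j V(\varphi_j)$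 is meant in the Hilbert space sense: every $f\in V(\varphi)$ can be written in a unique way as $f=\sum_j f_j$ with $f_j\in V(\varphi_j)$ and convergence in $L^2(\mathbb{R})$, and conversely every such $L^2$-convergent sum lies in $V(\varphi)$. Sampling space: a closed subspace $V(\varphi)$ of $L^2(\mathbb{R})$ is a sampling space if there is a function $s$ such that (1) the translates $\{s(\cdot-k)\}_{k\in\mathbb{Z}}$ are a frame for $V(\varphi)$; (2) for every $\{c_k\}\in\ell^2(\mathbb{Z})$ the series $\sum_{k}c_k s(\cdot-k)$ converges pointwise to a continuous function; (3) for every $f\in V(\varphi)$, $f(x)=\sum_{k\in\mathbb{Z}}f(k)s(x-k)$, with convergence in $L^2(\mathbb{R})$ and uniformly on $\mathbb{R}$ (elements of a sampling space are identified with their continuous representatives). The function $s$ is the sampling function of $V(\varphi)$; it is the only function in $V(\varphi)$ satisfying (3). *)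

(* Defs.v *)
(* MathComp-Analysis world; complex numbers are R[i] from mathcomp-real-closed. *)
From HB Require Import structures.
From mathcomp Require Import all_boot all_order all_algebra.
From mathcomp Require Import all_classical all_reals all_analysis.
From mathcomp Require Import measurable_realfun.
From mathcomp Require Import complex.

Set Implicit Arguments.
Unset Strict Implicit.
Unset Printing Implicit Defensive.

Import Order.TTheory GRing.Theory Num.Theory.
Import numFieldNormedType.Exports.

Local Open Scope classical_set_scope.
Local Open Scope ring_scope.
Local Open Scope complex_scope.

Section ComplexValuedFunctions.
Context {R : realType}.
Local Notation mu := (@lebesgue_measure R).
Implicit Types f g : R -> R[i].

Definition modulus (z : R[i]) : R := Normc.normc z.

(* R[i] carries no topology in the libraries, so continuity is componentwise. *)
Definition ccontinuous f : Prop :=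
  continuous (fun x => complex.Re (f x)) /\
  continuous (fun x => complex.Im (f x)).

Definition cLfun (p : \bar R) f : Prop :=
  (fun x => complex.Re (f x)) \in Lfun mu p /\
  (fun x => complex.Im (f x)) \in Lfun mu p.

(* Elements of L^1 and L^2 are represented by Borel functions; almost everywhere
   equal functions represent the same element. *)
Definition L1 f : Prop := cLfun 1%:E f.
Definition L2 f : Prop := cLfun 2%:E f.

Definition cintegral f : R[i] :=
  Rintegral mu setT (fun x => complex.Re (f x)) +i*
  Rintegral mu setT (fun x => complex.Im (f x)).

Definition L2norm f : \bar R := Lnorm mu 2%:E (fun x => (modulus (f x))%:E).

Definition L2dist f g : \bar R := L2norm (fun x => f x - g x).

Definition L2inner f g : R[i] := cintegral (fun x => f x * conjc (g x)).

Definition expi (t : R) : R[i] := cos t +i* sin t.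

Definition fourierL1 f : R -> R[i] :=
  fun w => cintegral (fun x => f x * expi (- (2 * pi * x * w))).

(* g is a representative of the Fourier transform of f in L^2: the closure in
   L^2 x L^2 of the graph of the integral transform on L^1 `&` L^2.  The
   representative g is only required to agree almost everywhere with a Borel one,
   i.e., to be Lebesgue measurable. *)
Definition fourierL2 f g : Prop :=
  L2 f /\
  exists g0, [/\ L2 g0, {ae mu, forall w, g w = g0 w} &
    exists u : nat -> R -> R[i],
      [/\ forall n, L1 (u n) /\ L2 (u n),
          (fun n => L2dist (u n) f) @ \oo --> 0%E &
          (fun n => L2dist (fourierL1 (u n)) g0) @ \oo --> 0%E]].

Definition cutoff f (A : set R) : R -> R[i] := fun x => f x * (\1_A x)%:C.

End ComplexValuedFunctions.

Section SamplingSpaces.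
Context {R : realType}.
Local Notation mu := (@lebesgue_measure R).
Implicit Types (f g s : R -> R[i]) (V : set (R -> R[i])).

Definition translate f (k : int) : R -> R[i] := fun x => f (x - k%:~R).

Definition translate_span f : set (R -> R[i]) :=
  [set g | exists (r : seq int) (c : int -> R[i]),
     g = fun x => \sum_(k <- r) c k * translate f k x].

(* The space S(f). *)
Definition shift_space f : set (R -> R[i]) :=
  [set g | L2 g /\ forall e : R, 0 < e ->
     exists2 h, translate_span f h & (L2dist g h < e%:E)%E].

Definition frame V (e : int -> R -> R[i]) : Prop :=
  (forall k, V (e k)) /\
  exists A B : R, [/\ 0 < A, 0 < B & forall f, V f ->
    (A%:E * L2norm f ^+ 2 <=
       \esum_(k in [set: int]) (modulus (L2inner f (e k)) ^+ 2)%:E)%E /\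
    (\esum_(k in [set: int]) (modulus (L2inner f (e k)) ^+ 2)%:E <=
       B%:E * L2norm f ^+ 2)%E].

(* The standing assumption made when V(f) is written for S(f). *)
Definition frame_generator f : Prop := L2 f /\ frame (shift_space f) (translate f).

Definition ell2 (c : int -> R[i]) : Prop :=
  (\esum_(k in [set: int]) (modulus (c k) ^+ 2)%:E < +oo)%E.

(* The sum of the u k with - p.2 <= k < p.1; series over the integers converge
   when these converge as p.1 and p.2 tend to infinity independently. *)
Definition bilateral_sum (u : int -> R[i]) (p : nat * nat) : R[i] :=
  \sum_(k < p.1) u (Posz k) + \sum_(k < p.2) u (Negz k).

Definition sampling_function V s : Prop :=
  [/\ frame V (translate s),
      forall c, ell2 c -> exists2 g, ccontinuous g &
        forall x, (fun p => modulus (bilateral_sum (fun k => c k * translate s k x) p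
                                     - g x)) @ (\oo, \oo) --> (0 : R) &
      forall f, V f -> exists f0,
        let expansion p x :=
          bilateral_sum (fun k => f0 k%:~R * translate s k x) p in
        [/\ ccontinuous f0, {ae mu, forall x, f0 x = f x},
            (fun p => L2dist (expansion p) f0) @ (\oo, \oo) --> 0%E &
            forall e : R, 0 < e -> \forall p \near (\oo, \oo),
              forall x, modulus (expansion p x - f0 x) < e]].

(* V(f) is a sampling space. *)
Definition sampling_space f : Prop :=
  frame_generator f /\ exists s, sampling_function (shift_space f) s.

(* The functions G_f and the set E_f, in terms of a representative fhat of the
   Fourier transform of f. *)
Definition grammian (fhat : R -> R[i]) (w : R) : \bar R :=
  (\esum_(k in [set: int]) (modulus (fhat (w + k%:~R)) ^+ 2)%:E)%E.

Definition grammian_support (fhat : R -> R[i]) : set R :=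
  [set w | (0 < grammian fhat w)%E].

Definition L2sums (g : nat -> R -> R[i]) f : Prop :=
  (fun n => L2dist (fun x => \sum_(j < n) g j x) f) @ \oo --> 0%E.

Definition hilbert_direct_sum V (W : nat -> set (R -> R[i])) : Prop :=
  [/\ forall f, V f ->
        exists2 g : nat -> R -> R[i], forall j, W j (g j) & L2sums g f,
      forall f (g h : nat -> R -> R[i]), V f ->
        (forall j, W j (g j)) -> L2sums g f ->
        (forall j, W j (h j)) -> L2sums h f ->
        forall j, {ae mu, forall x, g j x = h j x} &
      forall f (g : nat -> R -> R[i]), L2 f ->
        (forall j, W j (g j)) -> L2sums g f -> V f].

(* The measurable sets of lebesgue_measure are the Borel sets; these are the sets
   of the completed sigma-algebra. *)
Definition lebesgue_measurable (A : set R) : Prop :=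
  (completed_algebra_gen mu).-sigma.-measurable A.

End SamplingSpaces.

(* Main.v *)
Require Import Defs.
From HB Require Import structures.
From mathcomp Require Import all_boot all_order all_algebra.
From mathcomp Require Import all_classical all_reals all_analysis.
From mathcomp Require Import measurable_realfun ring lra zify.
From mathcomp Require Import complex.

Set Implicit Arguments.
Unset Strict Implicit.
Unset Printing Implicit Defensive.

Import Order.TTheory GRing.Theory Num.Theory.
Import numFieldNormedType.Exports.

Local Open Scope classical_set_scope.
Local Open Scope ring_scope.
Local Open Scope complex_scope.

(** For a Borel set B invariant under integer translations let P_B f denote the
    function whose Fourier transform is that of f multiplied by the indicator of B.
    The theorem describes what the projections P_B do to the space S(phi).

    - P_B maps every S(f) into itself ([multiplier_periodic]).  On the Fourier side
      the elements of S(f) are the L^2 limits of trigonometric polynomials times the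
      transform of f, so the indicator of B has to be reached from trigonometric
      polynomials by bounded pointwise limits.  For the periodic extension of an
      interval this is done with polynomials in a cosine ([multiplier_ray]), and the sets
      that can be reached form a sigma-algebra.
    - Hence S(P_B phi) consists of the f in S(phi) with P_B f = f
      ([filter_mem], [shift_space_fixed], [filter_shift_space]).  For such f the inner
      products of f with P_B g and with g agree, so a frame of translates of g for
      S(phi) gives the frame of translates of P_B g for S(P_B phi), with the same
      bounds ([filter_frame]).
    - Let s be the sampling function of S(phi) and s' the continuous representative of
      P_B s.  Applying P_B to the expansion of f in S(P_B phi) replaces s by s' and
      leaves f and its samples alone, so the new expansion converges in L^2.  Uniform
      convergence is another matter, as P_B is not bounded for the supremum norm; it
      comes from a constant K such that |f(x)| <= K ||f|| for all x and all continuous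
      representatives of elements of S(phi) ([evaluation_bounded]).  This is the closed
      graph argument: by Baire one of the sets where |f| <= n on ]-1, 1[ has interior.
      So S(P_B phi) is a sampling space with sampling function s' ([filter_sampling]).
    - A sampling function is determined by its space ([sampling_unique]), which
      identifies the transform of the sampling function of S(P_B phi).
    - The Lebesgue measurable sets E_j agree up to null sets with disjoint periodic
      Borel sets D_j ([periodic_partition]).  The transform of phi vanishes almost
      everywhere outside their union, because a point where it does not vanish has a
      positive Grammian.  Dominated convergence on the Fourier side then gives
      f = sum_j P_{D_j} f on S(phi), and P_{D_j} kills S(phi_l) for l <> j, which makes
      the decomposition unique ([filter_direct_sum]).

    The Fourier transform enters through its graph on L^2, which is linear, isometric,
    closed and total.  All of this follows from the completeness of L^2 ([L2_complete])
    and from Plancherel's identity on the intersection of L^1 and L^2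
    ([plancherelL1L2]), obtained by inserting the factor e^(- eps |w|), whose transform
    is the Poisson kernel, and letting eps tend to 0. *)

Notation Re := complex.Re.
Notation Im := complex.Im.

Arguments modulus : simpl never.
Arguments L2inner : simpl never.
Arguments conjc : simpl never.
Arguments expi : simpl never.

(** * Complex numbers *)

Section Modulus.
Context {R : realType}.
Implicit Types z w : R[i].

Lemma ReD z w : Re (z + w) = Re z + Re w. Proof. by case: z w => [a b] [c d]. Qed.
Lemma ImD z w : Im (z + w) = Im z + Im w. Proof. by case: z w => [a b] [c d]. Qed.
Lemma ReN z : Re (- z) = - Re z. Proof. by case: z. Qed.
Lemma ImN z : Im (- z) = - Im z. Proof. by case: z. Qed.
Lemma ReM z w : Re (z * w) = Re z * Re w - Im z * Im w.
Proof. by case: z w => [a b] [c d]. Qed.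
Lemma ImM z w : Im (z * w) = Re z * Im w + Im z * Re w.
Proof. by case: z w => [a b] [c d]. Qed.
Lemma ReJ z : Re (conjc z) = Re z. Proof. by case: z. Qed.
Lemma ImJ z : Im (conjc z) = - Im z. Proof. by case: z. Qed.

Lemma complex_eq z w : Re z = Re w -> Im z = Im w -> z = w.
Proof. by case: z w => [a b] [c d] /= -> ->. Qed.

Lemma modulus_ge0 z : 0 <= modulus z.
Proof. by case: z => a b; rewrite /modulus /= sqrtr_ge0. Qed.

Lemma sqr_modulus z : modulus z ^+ 2 = Re z ^+ 2 + Im z ^+ 2.
Proof. by case: z => a b; rewrite /modulus /= sqr_sqrtr// addr_ge0// sqr_ge0. Qed.

Lemma modulus0 : modulus (0 : R[i]) = 0.
Proof. exact: Normc.normc0. Qed.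

Lemma modulusD z w : modulus (z + w) <= modulus z + modulus w.
Proof. exact: le_normcD. Qed.

Lemma modulusN z : modulus (- z) = modulus z.
Proof. exact: normcN. Qed.

Lemma modulusB z w : modulus (z - w) <= modulus z + modulus w.
Proof. by rewrite (le_trans (modulusD _ _))// modulusN. Qed.

Lemma modulusM z w : modulus (z * w) = modulus z * modulus w.
Proof. exact: Normc.normcM. Qed.

Lemma modulusJ z : modulus (conjc z) = modulus z.
Proof. by case: z => a b; rewrite /modulus /= sqrrN. Qed.

Lemma modulus_real (a : R) : modulus (a%:C) = `|a|.
Proof. by rewrite /modulus /= expr0n /= addr0 sqrtr_sqr. Qed.

Lemma modulus_eq0 z : modulus z = 0 -> z = 0.
Proof. exact: Normc.eq0_normc. Qed.

Lemma modulus_distC z w : modulus (z - w) = modulus (w - z).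
Proof. by rewrite -modulusN opprB. Qed.

Lemma modulus_expi (t : R) : modulus (expi t) = 1.
Proof. by rewrite /modulus /= cos2Dsin2 sqrtr1. Qed.

Lemma Re_le_modulus z : `|Re z| <= modulus z.
Proof.
by rewrite -ler_sqr ?nnegrE ?modulus_ge0 // sqr_modulus real_normK ?num_real // lerDl sqr_ge0.
Qed.

Lemma Im_le_modulus z : `|Im z| <= modulus z.
Proof.
by rewrite -ler_sqr ?nnegrE ?modulus_ge0 // sqr_modulus real_normK ?num_real // lerDr sqr_ge0.
Qed.

Lemma modulus_le z : modulus z <= `|Re z| + `|Im z|.
Proof.
rewrite -ler_sqr ?nnegrE ?modulus_ge0 ?addr_ge0 // sqr_modulus.
rewrite sqrrD !real_normK ?num_real // -addrA lerD2l lerDr.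
by rewrite mulrn_wge0 // mulr_ge0.
Qed.

Lemma modulus_sum I (r : seq I) (P : pred I) (F : I -> R[i]) :
  modulus (\sum_(i <- r | P i) F i) <= \sum_(i <- r | P i) modulus (F i).
Proof.
elim/big_rec2: _ => [|i y z _ h]; first by rewrite modulus0.
by rewrite (le_trans (modulusD _ _)) // lerD2l.
Qed.

Lemma mulJ_modulus z : z * conjc z = (modulus z ^+ 2)%:C.
Proof.
apply: complex_eq; rewrite ?ReM ?ImM ReJ ImJ /= ?sqr_modulus; ring.
Qed.

Lemma conjcD z w : conjc (z + w) = conjc z + conjc w.
Proof. exact: rmorphD. Qed.

Lemma conjcN z : conjc (- z) = - conjc z.
Proof. exact: rmorphN. Qed.

Lemma conjcM z w : conjc (z * w) = conjc z * conjc w.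
Proof. exact: rmorphM. Qed.

Lemma expiD (s t : R) : expi (s + t) = expi s * expi t :> R[i].
Proof. by apply: complex_eq; rewrite ?ReM ?ImM /= ?cosD ?sinD //; ring. Qed.

End Modulus.

(** * Square-integrable functions *)

Section Energy.
Context {R : realType}.
Local Notation mu := (@lebesgue_measure R).
Implicit Types f g h : R -> R[i].

(** The filter lemmas for almost-everywhere statements over Lebesgue measure, with the
    filter instance fixed once and for all. *)
Lemma aeS (P Q : R -> Prop) : (forall x, P x -> Q x) ->
  {ae mu, forall x, P x} -> {ae mu, forall x, Q x}.
Proof. by move=> h; apply: (@filterS _ _ (ae_filter_ringOfSetsType mu)). Qed.

Lemma aeS2 (P Q S : R -> Prop) : (forall x, P x -> Q x -> S x) ->
  {ae mu, forall x, P x} -> {ae mu, forall x, Q x} -> {ae mu, forall x, S x}.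
Proof. by move=> h; apply: (@filterS2 _ _ (ae_filter_ringOfSetsType mu)). Qed.

Lemma aeT (P : R -> Prop) : (forall x, P x) -> {ae mu, forall x, P x}.
Proof. by move=> h; apply: (@nearW _ _ _ (ae_filter_ringOfSetsType mu)). Qed.

(** Componentwise, like [ccontinuous]. *)
Definition cmeas f : Prop :=
  measurable_fun setT (fun x => Re (f x)) /\ measurable_fun setT (fun x => Im (f x)).

Lemma cmeasD f g : cmeas f -> cmeas g -> cmeas (fun x => f x + g x).
Proof.
move=> [f1 f2] [g1 g2]; split.
- by under eq_fun do rewrite ReD; apply: measurable_funD.
- by under eq_fun do rewrite ImD; apply: measurable_funD.
Qed.

Lemma cmeasN f : cmeas f -> cmeas (fun x => - f x).
Proof.
move=> [f1 f2]; split.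
- by under eq_fun do rewrite ReN; apply: measurableT_comp.
- by under eq_fun do rewrite ImN; apply: measurableT_comp.
Qed.

Lemma cmeasB f g : cmeas f -> cmeas g -> cmeas (fun x => f x - g x).
Proof. by move=> mf mg; apply: cmeasD => //; exact: cmeasN. Qed.

Lemma cmeasM f g : cmeas f -> cmeas g -> cmeas (fun x => f x * g x).
Proof.
move=> [f1 f2] [g1 g2]; split.
- by under eq_fun do rewrite ReM; apply: measurable_funB; apply: measurable_funM.
- by under eq_fun do rewrite ImM; apply: measurable_funD; apply: measurable_funM.
Qed.

Lemma cmeas_cst c : cmeas (fun=> c).
Proof. by split; exact: measurable_cst. Qed.

Lemma cmeas_real (u : R -> R) : measurable_fun setT u -> cmeas (fun x => (u x)%:C).
Proof. by move=> mu0; split => //=; exact: measurable_cst. Qed.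

Lemma measurable_modulus f : cmeas f -> measurable_fun setT (fun x => modulus (f x)).
Proof.
move=> [f1 f2].
have -> : (fun x => modulus (f x)) = (fun x => Num.sqrt (Re (f x) ^+ 2 + Im (f x) ^+ 2)).
  by apply/funext => x; case: (f x).
apply: (measurableT_comp (f := @Num.sqrt R)).
  apply: continuous_measurable_fun; exact: sqrt_continuous.
by apply: measurable_funD; apply: measurable_funX.
Qed.

(** The square of the L^2 norm as an integral of real squares, which the integration
    lemmas handle more easily than powers with a real exponent. *)
Definition energy f : \bar R := (\int[mu]_x (modulus (f x) ^+ 2)%:E)%E.

Lemma measurable_energy f : cmeas f ->
  measurable_fun setT (fun x => (modulus (f x) ^+ 2)%:E).
Proof.
by move=> mf; apply/measurable_EFinP/measurable_funX; exact: measurable_modulus.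
Qed.

Lemma energy_ge0 f : (0 <= energy f)%E.
Proof. by apply: integral_ge0 => x _; rewrite lee_fin sqr_ge0. Qed.

Lemma L2norm_energy f : L2norm f = sqrte (energy f).
Proof.
rewrite /L2norm unlock /Lnorm -poweR12_sqrt; last exact: energy_ge0.
congr (_ `^ _)%E; apply: eq_integral => x _ /=.
by rewrite powR_mulrn // real_normK // num_real.
Qed.

Lemma L2norm_ge0 f : (0 <= L2norm f)%E.
Proof. exact: Lnorm_ge0. Qed.

Lemma real_Lfun2 (u : R -> R) : u \in Lfun mu 2%:E <->
  measurable_fun setT u /\ (\int[mu]_x (u x ^+ 2)%:E < +oo)%E.
Proof.
rewrite inE; split.
  move=> h; have h' : u \in Lfun mu 2%:E by rewrite inE.
  move: h => /andP[/[!inE] mu' _]; split => //.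
  have /integrableP[_] := Lfun2_integrable_sqr h'.
  apply: le_lt_trans; apply: ge0_le_integral => //.
  - by move=> x _; rewrite lee_fin sqr_ge0.
  - by apply/measurable_EFinP/measurable_funX.
  - by apply: measurableT_comp => //; apply/measurable_EFinP/measurable_funX.
  - by move=> x _; rewrite /= lee_fin ler_norm.
move=> [mu' h]; apply/andP; split; rewrite inE //=.
rewrite /finite_norm unlock /Lnorm poweR_lty //; apply: le_lt_trans h.
rewrite le_eqVlt; apply/orP; left; apply/eqP; apply: eq_integral => x _ /=.
by rewrite powR_mulrn // real_normK // num_real.
Qed.

Lemma L2P f : L2 f <-> cmeas f /\ (energy f < +oo)%E.
Proof.
have E : cmeas f -> energy f = (\int[mu]_x (Re (f x) ^+ 2)%:E + \int[mu]_x (Im (f x) ^+ 2)%:E)%E.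
  move=> [f1 f2]; rewrite -ge0_integralD //.
  - by apply: eq_integral => x _; rewrite sqr_modulus EFinD.
  - by move=> x _; rewrite lee_fin sqr_ge0.
  - by apply/measurable_EFinP/measurable_funX.
  - by move=> x _; rewrite lee_fin sqr_ge0.
  - by apply/measurable_EFinP/measurable_funX.
split.
  by move=> [/real_Lfun2[f1 l1] /real_Lfun2[f2 l2]]; split => //; rewrite E // lte_add_pinfty.
move=> [[f1 f2]]; rewrite E // => h.
have p1 : (0 <= \int[mu]_x (Re (f x) ^+ 2)%:E)%E.
  by apply: integral_ge0 => x _; rewrite lee_fin sqr_ge0.
have p2 : (0 <= \int[mu]_x (Im (f x) ^+ 2)%:E)%E.
  by apply: integral_ge0 => x _; rewrite lee_fin sqr_ge0.
split; apply/real_Lfun2; split => //.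
- by apply: le_lt_trans h; rewrite leeDl.
- by apply: le_lt_trans h; rewrite leeDr.
Qed.

Lemma L2_cmeas f : L2 f -> cmeas f. Proof. by move/L2P => []. Qed.

(** Functions of infinite norm get the value 0, so that real arithmetic applies throughout. *)
Definition nrm f : R := fine (L2norm f).

Lemma nrm_ge0 f : 0 <= nrm f.
Proof. by rewrite fine_ge0 // L2norm_ge0. Qed.

Lemma L2norm_nrm f : L2 f -> L2norm f = (nrm f)%:E.
Proof.
move=> /L2P[_ h]; rewrite /nrm fineK // L2norm_energy.
by move: h (energy_ge0 f); case: (energy f).
Qed.

Lemma energy_nrm f : L2 f -> energy f = (nrm f ^+ 2)%:E.
Proof.
move=> /L2P[_]; rewrite /nrm L2norm_energy; move: (energy_ge0 f).
by case: (energy f) => //= r r0 _; rewrite sqr_sqrtr.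
Qed.

Lemma L2norm_triangle f g : cmeas f -> cmeas g ->
  (L2norm (fun x => (f x + g x)%R) <= L2norm f + L2norm g)%E.
Proof.
move=> mf mg.
have := @eminkowski _ _ _ mu (fun x => modulus (f x)) (fun x => modulus (g x)) 2%:E.
move=> /(_ (measurable_modulus mf) (measurable_modulus mg)) h.
apply: le_trans (h _); last by rewrite lee_fin ler1n.
have key : forall e1 e2 : R -> R, (forall x, 0 <= e1 x <= e2 x) ->
  measurable_fun setT e1 -> measurable_fun setT e2 ->
  (Lnorm mu 2%:E (EFin \o e1) <= Lnorm mu 2%:E (EFin \o e2))%E.
  move=> e1 e2 h12 m1 m2; rewrite unlock /Lnorm gt0_ler_poweR //.
  - by rewrite in_itv /= leey integral_ge0.
  - by rewrite in_itv /= leey integral_ge0.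
  have mm (e : R -> R) : measurable_fun setT e -> measurable_fun setT (fun x => (`|(EFin \o e) x| `^ 2)%E).
    move=> me; apply/measurable_EFinP.
    apply/(@measurableT_comp _ _ _ _ _ _ (fun x : R => x `^ 2)%R) => //.
    exact/measurableT_comp.
  apply: ge0_le_integral => //; try exact: mm.
  - by move=> x _ /=; rewrite lee_fin powR_ge0.
  move=> x _ /=; rewrite lee_fin !powR_mulrn // ler_sqr ?nnegrE //.
  by have /andP[? ?] := h12 x; rewrite !ger0_norm // (le_trans _ (y := e1 x)).
apply: key.
- by move=> x; rewrite modulus_ge0 modulusD.
- by apply: measurable_modulus; exact: cmeasD.
- by apply: measurable_funD; exact: measurable_modulus.
Qed.

Lemma le_energy f g : (forall x, modulus (f x) <= modulus (g x)) -> cmeas f -> cmeas g ->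
  (energy f <= energy g)%E.
Proof.
move=> h mf mg; apply: ge0_le_integral => //.
- by move=> x _; rewrite lee_fin sqr_ge0.
- exact: measurable_energy.
- exact: measurable_energy.
- by move=> x _; rewrite lee_fin ler_sqr ?nnegrE ?modulus_ge0.
Qed.

Lemma L2_le f g : cmeas f -> L2 g -> (forall x, modulus (f x) <= modulus (g x)) ->
  L2 f /\ nrm f <= nrm g.
Proof.
move=> mf Lg h; have [mg fg] := (L2P g).1 Lg.
have hfg := le_energy h mf mg.
have Lf : L2 f by apply/L2P; split => //; exact: le_lt_trans fg.
split => //; rewrite -ler_sqr ?nnegrE ?nrm_ge0 // -lee_fin -!energy_nrm //.
Qed.

Lemma L2D f g : L2 f -> L2 g -> L2 (fun x => f x + g x).
Proof.
move=> Lf Lg; apply/L2P; have mfg := cmeasD (L2_cmeas Lf) (L2_cmeas Lg); split => //.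
have := L2norm_triangle (L2_cmeas Lf) (L2_cmeas Lg).
rewrite (L2norm_nrm Lf) (L2norm_nrm Lg) L2norm_energy.
by case: (energy _) => [r| |] //=; rewrite ?ltry ?ltNyr.
Qed.

Lemma nrmD f g : L2 f -> L2 g -> nrm (fun x => f x + g x) <= nrm f + nrm g.
Proof.
move=> Lf Lg; rewrite -lee_fin EFinD -!L2norm_nrm //; last exact: L2D.
by apply: L2norm_triangle; exact: L2_cmeas.
Qed.

Lemma eq_nrm f g : (forall x, modulus (f x) = modulus (g x)) -> nrm f = nrm g.
Proof.
move=> h; rewrite /nrm !L2norm_energy; congr (fine (sqrte _)).
by apply: eq_integral => x _; rewrite h.
Qed.

Lemma L2_cst0 : L2 (fun=> 0 : R[i]).
Proof.
apply/L2P; split; first exact: cmeas_cst.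
by rewrite /energy; under eq_integral do rewrite modulus0 expr0n /=; rewrite integral0.
Qed.

Lemma nrm0 : nrm (fun=> 0 : R[i]) = 0.
Proof.
rewrite /nrm L2norm_energy /energy; under eq_integral do rewrite modulus0 expr0n /=.
by rewrite integral0 /= sqrtr0.
Qed.

(** The contraction principle behind every Fourier multiplier below. *)
Lemma L2_mulb m f K : cmeas m -> (forall x, modulus (m x) <= K) -> L2 f ->
  L2 (fun x => m x * f x) /\ nrm (fun x => m x * f x) <= K * nrm f.
Proof.
move=> mm hK Lf; have K0 : 0 <= K by exact: le_trans (modulus_ge0 _) (hK 0).
have [mf ef] := (L2P f).1 Lf.
have E : (energy (fun x => (m x * f x)%R) <= (K ^+ 2)%:E * energy f)%E.
  rewrite -ge0_integralZl_EFin //; last 3 first.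
  - by move=> x _; rewrite lee_fin sqr_ge0.
  - exact: measurable_energy.
  - exact: sqr_ge0.
  apply: ge0_le_integral => //.
  - by move=> x _; rewrite lee_fin sqr_ge0.
  - by apply: measurable_energy; exact: cmeasM.
  - by apply: measurable_funeM; exact: measurable_energy.
  - move=> x _; rewrite -EFinM lee_fin modulusM exprMn ler_wpM2r ?sqr_ge0 //.
    by rewrite ler_sqr ?nnegrE ?modulus_ge0.
have L : L2 (fun x => m x * f x).
  apply/L2P; split; first exact: cmeasM.
  by apply: (le_lt_trans E); rewrite energy_nrm // -EFinM ltry.
split => //; rewrite -ler_sqr ?nnegrE ?mulr_ge0 ?nrm_ge0 //.
by move: E; rewrite !energy_nrm // -EFinM lee_fin exprMn.
Qed.

Lemma L2Z (c : R[i]) f : L2 f -> L2 (fun x => c * f x).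
Proof. by move=> Lf; have [] := @L2_mulb (fun=> c) f (modulus c) (cmeas_cst c) (fun=> lexx _) Lf. Qed.

Lemma nrmZ (c : R[i]) f : L2 f -> nrm (fun x => c * f x) = modulus c * nrm f.
Proof.
move=> Lf; have [_ le1] := @L2_mulb (fun=> c) f (modulus c) (cmeas_cst c) (fun=> lexx _) Lf.
have [/eqP->|c0] := boolP (c == 0).
  rewrite modulus0 mul0r -nrm0; apply: eq_nrm => x; by rewrite mul0r.
have [_] := @L2_mulb (fun=> c^-1) _ (modulus c^-1) (cmeas_cst _) (fun=> lexx _) (L2Z c Lf).
have -> : (fun x => c^-1 * (c * f x)) = f by apply/funext => x; rewrite mulrA mulVf // mul1r.
move=> le2; apply/eqP; rewrite eq_le le1 /=.
have c0' : 0 < modulus c.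
  by rewrite lt_neqAle modulus_ge0 andbT; apply: contra c0 => /eqP/esym/modulus_eq0 ->.
rewrite mulrC -ler_pdivlMr // mulrC; apply: (le_trans le2).
by rewrite /modulus Normc.normcV.
Qed.

Lemma L2N f : L2 f -> L2 (fun x => - f x).
Proof. by move=> Lf; under eq_fun do rewrite -mulN1r; exact: L2Z. Qed.

Lemma nrmN f : nrm (fun x => - f x) = nrm f.
Proof. by apply: eq_nrm => x; rewrite modulusN. Qed.

Lemma L2B f g : L2 f -> L2 g -> L2 (fun x => f x - g x).
Proof. by move=> Lf Lg; apply: L2D => //; exact: L2N. Qed.

Lemma nrmB f g : L2 f -> L2 g -> nrm (fun x => f x - g x) <= nrm f + nrm g.
Proof. by move=> Lf Lg; rewrite -(nrmN g); apply: nrmD => //; exact: L2N. Qed.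

Lemma nrm_distC f g : nrm (fun x => f x - g x) = nrm (fun x => g x - f x).
Proof. by apply: eq_nrm => x; rewrite modulus_distC. Qed.

Lemma nrm_dist_triangle f g h : L2 f -> L2 g -> L2 h ->
  nrm (fun x => f x - h x) <= nrm (fun x => f x - g x) + nrm (fun x => g x - h x).
Proof.
move=> Lf Lg Lh; apply: le_trans (nrmD (L2B Lf Lg) (L2B Lg Lh)).
by rewrite le_eqVlt; apply/orP; left; apply/eqP/eq_nrm => x; rewrite addrA subrK.
Qed.

Lemma L2_sum I (r : seq I) (F : I -> R -> R[i]) :
  (forall i, L2 (F i)) -> L2 (fun x => \sum_(i <- r) F i x).
Proof.
move=> h; elim: r => [|i r ih].
  by under eq_fun do rewrite big_nil; exact: L2_cst0.
by under eq_fun do rewrite big_cons; exact: L2D.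
Qed.

Lemma L2dist_nrm f g : L2 f -> L2 g -> L2dist f g = (nrm (fun x => f x - g x))%:E.
Proof. by move=> Lf Lg; rewrite /L2dist L2norm_nrm //; exact: L2B. Qed.

Lemma nrm_eq0 f : L2 f -> nrm f = 0 -> {ae mu, forall x, f x = 0}.
Proof.
move=> Lf n0; have := energy_nrm Lf; rewrite n0 expr0n /= => e0.
have mf := measurable_energy (L2_cmeas Lf).
have := (@ae_eq_integral_abs _ _ _ mu setT measurableT _ mf).1.
have -> : (\int[mu]_x `|(modulus (f x) ^+ 2)%:E| = energy f)%E.
  by apply: eq_integral => x _; rewrite gee0_abs // lee_fin sqr_ge0.
move=> /(_ e0); apply: aeS => x /(_ I) /= [].
by move=> /eqP; rewrite sqrf_eq0 => /eqP/modulus_eq0.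
Qed.

Lemma ae_eq_energy f g : cmeas f -> cmeas g -> {ae mu, forall x, f x = g x} ->
  energy f = energy g.
Proof.
move=> mf mg fg; apply: ae_eq_integral => //; try exact: measurable_energy.
by move: fg; apply: aeS => x -> _.
Qed.

Lemma ae_eq_nrm f g : cmeas f -> cmeas g -> {ae mu, forall x, f x = g x} -> nrm f = nrm g.
Proof. by move=> mf mg fg; rewrite /nrm !L2norm_energy (ae_eq_energy mf mg fg). Qed.

Lemma ae_eq_L2 f g : L2 f -> cmeas g -> {ae mu, forall x, f x = g x} -> L2 g.
Proof.
move=> Lf mg fg; apply/L2P; split => //.
by rewrite -(ae_eq_energy (L2_cmeas Lf) mg fg); exact: ((L2P f).1 Lf).2.
Qed.

Lemma ae_eq_dist f g : L2 f -> L2 g -> {ae mu, forall x, f x = g x} ->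
  nrm (fun x => f x - g x) = 0.
Proof.
move=> Lf Lg fg; rewrite -nrm0; apply: ae_eq_nrm.
- by apply: L2_cmeas; exact: L2B.
- exact: cmeas_cst.
- by move: fg; apply: aeS => x ->; rewrite subrr.
Qed.

Lemma dist_eq0_ae f g : L2 f -> L2 g -> nrm (fun x => f x - g x) = 0 ->
  {ae mu, forall x, f x = g x}.
Proof.
move=> Lf Lg /(nrm_eq0 (L2B Lf Lg)); apply: aeS => x /eqP.
by rewrite subr_eq0 => /eqP.
Qed.

End Energy.

(** * The inner product *)

Section InnerProduct.
Context {R : realType}.
Local Notation mu := (@lebesgue_measure R).
Implicit Types f g h : R -> R[i].

Lemma L1P f : L1 f <-> mu.-integrable setT (EFin \o (fun x => Re (f x))) /\
                       mu.-integrable setT (EFin \o (fun x => Im (f x))).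
Proof. by split=> -[/Lfun1_integrable ? /Lfun1_integrable ?]; split. Qed.

Lemma L1D f g : L1 f -> L1 g -> L1 (fun x => f x + g x).
Proof.
move=> /L1P[f1 f2] /L1P[g1 g2]; apply/L1P; split.
- by have := integrableD measurableT f1 g1; apply: eq_integrable => // x _ /=; rewrite ReD EFinD.
- by have := integrableD measurableT f2 g2; apply: eq_integrable => // x _ /=; rewrite ImD EFinD.
Qed.

Lemma L1Z (c : R[i]) f : L1 f -> L1 (fun x => c * f x).
Proof.
move=> /L1P[f1 f2]; apply/L1P; split.
- have := integrableB measurableT (integrableZl measurableT (Re c) f1)
    (integrableZl measurableT (Im c) f2).
  by apply: eq_integrable => // x _ /=; rewrite ReM EFinB !EFinM.
- have := integrableD measurableT (integrableZl measurableT (Re c) f2)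
    (integrableZl measurableT (Im c) f1).
  by apply: eq_integrable => // x _ /=; rewrite ImM EFinD !EFinM.
Qed.

Lemma cintegralD f g : L1 f -> L1 g ->
  cintegral (fun x => f x + g x) = cintegral f + cintegral g.
Proof.
move=> /L1P[f1 f2] /L1P[g1 g2]; rewrite /cintegral.
apply: complex_eq; rewrite ?ReD ?ImD /= -RintegralD //.
- by apply: eq_Rintegral => x _; rewrite ReD.
- by apply: eq_Rintegral => x _; rewrite ImD.
Qed.

Lemma cintegralZ (c : R[i]) f : L1 f -> cintegral (fun x => c * f x) = c * cintegral f.
Proof.
move=> /L1P[f1 f2]; rewrite /cintegral.
apply: complex_eq; rewrite ?ReM ?ImM /= -!RintegralZl //.
- rewrite -RintegralB //; first by apply: eq_Rintegral => x _; rewrite ReM.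
  + by have := integrableZl measurableT (Re c) f1; apply: eq_integrable.
  + by have := integrableZl measurableT (Im c) f2; apply: eq_integrable.
- rewrite -RintegralD //; first by apply: eq_Rintegral => x _; rewrite ImM.
  + by have := integrableZl measurableT (Re c) f2; apply: eq_integrable.
  + by have := integrableZl measurableT (Im c) f1; apply: eq_integrable.
Qed.

Lemma cintegralJ f : L1 f -> cintegral (fun x => conjc (f x)) = conjc (cintegral f).
Proof.
move=> /L1P[f1 f2]; rewrite /cintegral; apply: complex_eq => /=.
- by apply: eq_Rintegral => x _; rewrite ReJ.
- rewrite -mulN1r -RintegralZl //; apply: eq_Rintegral => x _; rewrite ImJ mulN1r //.
Qed.

Lemma L2_mul_L1 f g : L2 f -> L2 g -> L1 (fun x => f x * conjc (g x)).
Proof.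
move=> [f1 f2] [g1 g2]; apply/L1P.
have I (u v : R -> R) : u \in Lfun mu 2%:E -> v \in Lfun mu 2%:E ->
    mu.-integrable setT (EFin \o (fun x => u x * v x)).
  by move=> hu hv; apply/Lfun1_integrable; exact: Lfun2_mul_Lfun1.
split.
- have := integrableD measurableT (I _ _ f1 g1) (I _ _ f2 g2).
  by apply: eq_integrable => // x _ /=; rewrite ReM ReJ ImJ mulrN opprK EFinD.
- have := integrableB measurableT (I _ _ f2 g1) (I _ _ f1 g2).
  by apply: eq_integrable => // x _ /=; rewrite ImM ReJ ImJ mulrN [in RHS]addrC EFinB.
Qed.

Lemma ipDl f g h : L2 f -> L2 g -> L2 h ->
  L2inner (fun x => f x + g x) h = L2inner f h + L2inner g h.
Proof.
move=> Lf Lg Lh; rewrite /L2inner -cintegralD; [|exact: L2_mul_L1..].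
by congr cintegral; apply/funext => x; rewrite mulrDl.
Qed.

Lemma ipZl c f h : L2 f -> L2 h -> L2inner (fun x => c * f x) h = c * L2inner f h.
Proof.
move=> Lf Lh; rewrite /L2inner -cintegralZ; last exact: L2_mul_L1.
by congr cintegral; apply/funext => x; rewrite mulrA.
Qed.

Lemma ip_conj f g : L2 f -> L2 g -> L2inner g f = conjc (L2inner f g).
Proof.
move=> Lf Lg; rewrite /L2inner -cintegralJ; last exact: L2_mul_L1.
congr cintegral; apply/funext => x.
by rewrite conjcM conjcK mulrC.
Qed.

Lemma ipDr f g h : L2 f -> L2 g -> L2 h ->
  L2inner h (fun x => f x + g x) = L2inner h f + L2inner h g.
Proof.
move=> Lf Lg Lh; rewrite (ip_conj (L2D Lf Lg) Lh) ipDl // conjcD.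
by rewrite -!ip_conj.
Qed.

Lemma ipZr c f h : L2 f -> L2 h -> L2inner h (fun x => c * f x) = conjc c * L2inner h f.
Proof.
by move=> Lf Lh; rewrite (ip_conj (L2Z c Lf) Lh) ipZl // conjcM -ip_conj.
Qed.

Lemma ipBl f g h : L2 f -> L2 g -> L2 h ->
  L2inner (fun x => f x - g x) h = L2inner f h - L2inner g h.
Proof.
move=> Lf Lg Lh; rewrite ipDl //; last exact: L2N.
congr (_ + _); under [fun x : R => - g x]eq_fun do rewrite -mulN1r.
by rewrite ipZl // mulN1r.
Qed.

Lemma ipBr f g h : L2 f -> L2 g -> L2 h ->
  L2inner h (fun x => f x - g x) = L2inner h f - L2inner h g.
Proof.
by move=> Lf Lg Lh; rewrite (ip_conj (L2B Lf Lg) Lh) ipBl // conjcD conjcN -!ip_conj.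
Qed.

Lemma ip_self f : L2 f -> L2inner f f = (nrm f ^+ 2)%:C.
Proof.
move=> Lf; rewrite /L2inner /cintegral; apply: complex_eq => /=.
- rewrite -[RHS]/(fine (nrm f ^+ 2)%:E) -energy_nrm // /energy /Rintegral; congr fine.
  by apply: eq_integral => x _; rewrite mulJ_modulus.
- rewrite [X in Rintegral _ _ X](_ : _ = fun=> 0).
    by rewrite /Rintegral integral0.
  by apply/funext => x; rewrite mulJ_modulus.
Qed.

Lemma ip_suml I (r : seq I) (c : I -> R[i]) (F : I -> R -> R[i]) h :
  (forall i, L2 (F i)) -> L2 h ->
  L2inner (fun x => \sum_(i <- r) c i * F i x) h = \sum_(i <- r) c i * L2inner (F i) h.
Proof.
move=> LF Lh; elim: r => [|i r ih].
  rewrite big_nil; under eq_fun do rewrite big_nil.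
  have e := ipZl 0 (@L2_cst0 R) Lh; rewrite !mul0r in e; exact: e.
rewrite big_cons; under eq_fun do rewrite big_cons.
rewrite ipDl ?ipZl ?ih //; first exact: L2Z.
by apply: L2_sum => j; exact: L2Z.
Qed.

Lemma nrmD_sqr f g : L2 f -> L2 g ->
  nrm (fun x => f x + g x) ^+ 2 = nrm f ^+ 2 + nrm g ^+ 2 + 2 * Re (L2inner f g).
Proof.
move=> Lf Lg; have := ip_self (L2D Lf Lg).
rewrite ipDl ?ipDr //; try exact: L2D.
rewrite !ip_self // [L2inner g f]ip_conj // => /(congr1 (@complex.Re R)).
rewrite !ReD ReJ /= => <-; ring.
Qed.

(** The square norm of f - t <f, g> g is a nonnegative quadratic polynomial in the real
    number t. *)
Lemma cauchy_schwarz f g : L2 f -> L2 g -> modulus (L2inner f g) <= nrm f * nrm g.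
Proof.
move=> Lf Lg; set z := L2inner f g.
have key (t : R) : 0 <= nrm f ^+ 2 - 2 * t * modulus z ^+ 2
    + t ^+ 2 * modulus z ^+ 2 * nrm g ^+ 2.
  have := sqr_ge0 (nrm (fun x => f x + ((- t)%:C * z) * g x)).
  rewrite nrmD_sqr //; last exact: L2Z.
  rewrite ipZr // -/z nrmZ // modulusM modulus_real normrN !exprMn real_normK ?num_real //.
  rewrite conjcM conjc_real -[_ * conjc z * z]mulrA [conjc z * z]mulrC mulJ_modulus ReM /= ?mul0r ?mulr0 subr0.
  by congr (0 <= _); ring.
rewrite -ler_sqr ?nnegrE ?mulr_ge0 ?nrm_ge0 ?modulus_ge0 // exprMn.
have [g0|g0] := eqVneq (nrm g) 0; last first.
  have := key (nrm g ^+ 2)^-1.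
  have gp : 0 < nrm g ^+ 2 by rewrite exprn_gt0 // lt_neqAle eq_sym g0 nrm_ge0.
  move=> k; rewrite -ler_pdivrMr // -subr_ge0.
  by apply: le_trans k _; rewrite le_eqVlt; apply/orP; left; apply/eqP; field.
(* If g has norm 0 the polynomial is affine, and this t makes it equal to -1. *)
have := key ((nrm f ^+ 2 + 1) / (2 * modulus z ^+ 2)).
rewrite g0 expr0n /= !mulr0 addr0.
have [->|z0] := eqVneq (modulus z) 0; first by rewrite expr0n.
suff -> : nrm f ^+ 2 - 2 * ((nrm f ^+ 2 + 1) / (2 * modulus z ^+ 2)) * modulus z ^+ 2 = -1.
  by rewrite ler0N1.
by field.
Qed.

(** The norms of f + c g for c = 1 and c = i determine the real and the imaginary part
    of <f, g>.  Used to turn isometries into maps preserving inner products. *)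
Lemma polarization f g f' g' : L2 f -> L2 g -> L2 f' -> L2 g' ->
  nrm f = nrm f' -> nrm g = nrm g' ->
  (forall c : R[i], nrm (fun x => f x + c * g x) = nrm (fun x => f' x + c * g' x)) ->
  L2inner f g = L2inner f' g'.
Proof.
move=> Lf Lg Lf' Lg' nf ng h.
have key (c : R[i]) : Re (conjc c * L2inner f g) = Re (conjc c * L2inner f' g').
  rewrite -!ipZr //; have := h c; move=> /(congr1 (fun x => x ^+ 2)).
  rewrite !nrmD_sqr ?nrmZ ?nf ?ng //; try exact: L2Z.
  by lra.
apply: complex_eq.
- by have := key 1; rewrite rmorph1 !mul1r.
- have := key ('i%C); rewrite !ReM /= !mul0r !sub0r !mulN1r !opprK //.
Qed.

End InnerProduct.

Notation cvgL2 u f := ((fun n => nrm (fun x => u n x - f x)) @ \oo --> (0 : _)).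

(** * Convergence and completeness in L^2 *)

Section Fatou.
Context {R : realType}.
Local Notation mu := (@lebesgue_measure R).
Implicit Types f g h : R -> R[i].

Lemma cvgL2_L2dist (u : nat -> R -> R[i]) f : (forall n, L2 (u n)) -> L2 f ->
  (fun n => L2dist (u n) f) @ \oo --> 0%E <-> cvgL2 u f.
Proof.
move=> Lu Lf.
have -> : (fun n => L2dist (u n) f) = (fun n => (nrm (fun x => u n x - f x))%:E).
  by apply/funext => n; rewrite L2dist_nrm.
split => [/fine_cvg //|h]; apply/fine_cvgP; split; [exact: nearW|exact: h].
Qed.

Lemma cvgL2P (u : nat -> R -> R[i]) f :
  cvgL2 u f <-> forall e, 0 < e -> \forall n \near \oo, nrm (fun x => u n x - f x) < e.
Proof.
split.
- move=> /cvgrPdist_lt h e e0; have := h e e0; apply: filterS => n.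
  by rewrite sub0r normrN ger0_norm // nrm_ge0.
- move=> h; apply/cvgrPdist_lt => e e0; have := h e e0; apply: filterS => n.
  by rewrite sub0r normrN ger0_norm // nrm_ge0.
Qed.

Lemma le_limn_einf (u : (\bar R)^nat) (c : \bar R) :
  (forall n, (u n <= c)%E) -> (limn_einf u <= c)%E.
Proof.
move=> h; rewrite limn_einf_lim; apply: lime_le; first exact: is_cvg_einfs.
apply: nearW => n; rewrite /einfs; apply: le_trans (h n).
by apply: ereal_inf_lbound; exists n => //=.
Qed.

(** Pointwise limits of a sequence that stays within e of h stay within e of h, by
    Fatou's lemma.  Taking h in the sequence itself turns a Cauchy estimate into a rate
    of convergence. *)
Lemma L2_fatou (v : nat -> R -> R[i]) g h e : (forall n, L2 (v n)) -> L2 h -> cmeas g ->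
  (forall x, (fun n => modulus (v n x - g x)) @ \oo --> (0 : R)) ->
  (\forall n \near \oo, nrm (fun x => h x - v n x) <= e) ->
  L2 g /\ nrm (fun x => h x - g x) <= e.
Proof.
move=> Lv Lh mg vg [N _ hN].
have e0 : 0 <= e by apply: le_trans (hN N (leqnn N)); exact: nrm_ge0.
pose w n := fun x => h x - v (n + N)%N x.
have Lw n : L2 (w n) by exact: L2B.
have mhg : cmeas (fun x => h x - g x) by apply: cmeasB => //; exact: L2_cmeas.
have cv x : (fun n => modulus (w n x)) @ \oo --> modulus (h x - g x).
  apply/cvgrPdist_le => d d0.
  have := vg x; rewrite -(cvg_shiftn N) => /cvgrPdist_le/(_ d d0) H; near=> n.
  have : `|0 - modulus (v (n + N)%N x - g x)| <= d by near: n.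
  rewrite sub0r normrN (ger0_norm (modulus_ge0 _)); apply: le_trans.
  have t1 : modulus (h x - g x) <= modulus (w n x) + modulus (v (n + N)%N x - g x).
    by rewrite (_ : h x - g x = w n x + (v (n + N)%N x - g x)) ?modulusD // /w; ring.
  have t2 : modulus (w n x) <= modulus (h x - g x) + modulus (v (n + N)%N x - g x).
    rewrite (_ : w n x = h x - g x - (v (n + N)%N x - g x)) ?modulusB // /w; ring.
  by rewrite ler_norml; apply/andP; split; lra.
have le2 : (energy (fun x => (h x - g x)%R) <= (e ^+ 2)%:E)%E.
  have -> : energy (fun x => h x - g x) =
      (\int[mu]_x limn_einf (fun n => (modulus (w n x) ^+ 2)%:E))%E.
    apply: eq_integral => x _; apply/esym.
    have c : (fun n => (modulus (w n x) ^+ 2)%:E) @ \oo --> (modulus (h x - g x) ^+ 2)%:E.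
      apply/fine_cvgP; split; first exact: nearW.
      by rewrite expr2; under eq_cvg do rewrite /= expr2; exact: cvgM.
    by rewrite is_cvg_limn_einfE; [exact: cvg_lim c|exact: cvgP c].
  apply: le_trans (fatou _ _ _ _) _ => //.
  - by move=> n; apply: measurable_energy; exact: L2_cmeas.
  - by move=> n x _; rewrite lee_fin sqr_ge0.
  - apply: le_limn_einf => n; rewrite -[X in (X <= _)%E]/(energy (w n)) energy_nrm //.
    rewrite lee_fin ler_sqr ?nnegrE ?nrm_ge0 //.
    by apply: hN => /=; rewrite leq_addl.
have L : L2 (fun x => h x - g x) by apply/L2P; split => //; exact: le_lt_trans le2 (ltry _).
split.
  have := L2B Lh L; congr L2; apply/funext => x; ring.
rewrite -ler_sqr ?nnegrE ?nrm_ge0 // -lee_fin -energy_nrm //.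
Unshelve. all: by end_near. Qed.

End Fatou.

Section RieszFischer.
Context {R : realType}.
Local Notation mu := (@lebesgue_measure R).
Implicit Types f g h : R -> R[i].

Definition L2cauchy (u : nat -> R -> R[i]) : Prop :=
  forall e : R, 0 < e -> exists N, forall m n, (N <= m)%N -> (N <= n)%N ->
    nrm (fun x => u m x - u n x) < e.

(** The function T = sum_k 4^k |v (k+1) - v k|^2 has integral at most sum_k 4^-k, hence is
    finite almost everywhere, and |v (k+1) - v k| <= sqrt(T) 2^-k wherever it is finite. *)
Lemma L2_fast_cvg_ae (v : nat -> R -> R[i]) : (forall n, L2 (v n)) ->
  (forall n, nrm (fun x => v n.+1 x - v n x) <= 4^-1 ^+ n) ->
  exists D : set R, [/\ measurable D, {ae mu, forall x, D x} &
    forall x, D x -> exists M : R, forall n, modulus (v n.+1 x - v n x) <= M * 2^-1 ^+ n].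
Proof.
move=> Lv hv.
pose d k := fun x => v k.+1 x - v k x.
have Ld k : L2 (d k) by exact: L2B.
pose t k := fun x => (4 ^+ k * modulus (d k x) ^+ 2)%:E.
have mt k : measurable_fun setT (t k).
  apply/measurable_EFinP; apply: measurable_funM; first exact: measurable_cst.
  by apply: measurable_funX; apply: measurable_modulus; exact: L2_cmeas.
have t0 k x : (0 <= t k x)%E by rewrite lee_fin mulr_ge0 ?sqr_ge0 ?exprn_ge0.
pose T := fun x => (\sum_(k <oo) t k x)%E.
have T0 x : (0 <= T x)%E by apply: nneseries_ge0 => n _ _; exact: t0.
have mT : measurable_fun setT T by exact: ge0_emeasurable_sum.
have tT k x : (t k x <= T x)%E.
  apply: le_trans (nneseries_lim_ge k.+1 _); last by move=> n _ _; exact: t0.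
  by rewrite big_nat_recr //= leeDr // sume_ge0.
have IT : (\int[mu]_x T x < +oo)%E.
  rewrite integral_nneseries //.
  have : (\sum_(k <oo) (4^-1 ^+ k)%:E < +oo :> \bar R)%E.
    have c : cvgn (series (geometric (1:R) 4^-1)).
      by apply: is_cvg_geometric_series; rewrite ger0_norm // invf_lt1 // ltr1n.
    have -> : (\sum_(k <oo) (4^-1 ^+ k)%:E)%E = (limn (series (geometric (1:R) 4^-1)))%:E.
      rewrite -EFin_lim //; congr (limn _); apply/funext => n /=.
      rewrite /series /= sumEFin; congr EFin; apply: eq_bigr => i _.
      by rewrite mul1r.
    exact: ltry.
  apply: le_lt_trans; apply: lee_nneseries.
    by move=> i _ _; apply: integral_ge0 => x _; exact: t0.
  move=> k _; rewrite /t; under eq_integral do rewrite EFinM.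
  rewrite ge0_integralZl_EFin //; last 2 first.
  - by move=> x _; rewrite lee_fin sqr_ge0.
  - by apply: measurable_energy; exact: L2_cmeas.
  rewrite -[X in (_ * X)%E]/(energy (d k)) energy_nrm // -EFinM lee_fin.
  have h1 : nrm (d k) ^+ 2 <= (4^-1 ^+ k) ^+ 2.
    by rewrite ler_sqr ?nnegrE ?nrm_ge0 ?exprn_ge0 ?invr_ge0 //; exact: hv.
  apply: (le_trans (ler_wpM2l _ h1)); first exact: exprn_ge0.
  rewrite expr2 mulrA -exprMn mulfV ?pnatr_eq0 // expr1n mul1r //.
exists [set x | (T x < +oo)%E]; split.
- by rewrite -[X in measurable X]setTI; exact: emeasurable_fun_infty_o.
- have iT : mu.-integrable setT T.
    apply/integrableP; split => //; apply: le_lt_trans IT.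
    by rewrite le_eqVlt; apply/orP; left; apply/eqP; apply: eq_integral => x _; rewrite gee0_abs.
  move: (integrable_ae measurableT iT); apply: aeS => x /(_ I).
  by rewrite ge0_fin_numE.
- move=> x /= Tx.
  set M := fine (T x); have EM : T x = M%:E by rewrite /M fineK // ge0_fin_numE.
  have M0 : 0 <= M by rewrite -lee_fin -EM.
  exists (Num.sqrt M) => n.
  rewrite -ler_sqr ?nnegrE ?modulus_ge0 ?mulr_ge0 ?sqrtr_ge0 ?exprn_ge0 ?invr_ge0 //.
  rewrite exprMn sqr_sqrtr //.
  have := tT n x; rewrite EM lee_fin => h.
  have -> : (2^-1 ^+ n) ^+ 2 = (4 ^+ n)^-1 :> R.
    by rewrite -exprM mulnC exprM exprVn exprVn; congr (_ ^- _); rewrite expr2; ring.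
  by rewrite ler_pdivlMr ?exprn_gt0 // mulrC.
Qed.

Lemma fast_cvg (u : nat -> R) (M : R) :
  (forall n, `|u n.+1 - u n| <= M * 2^-1 ^+ n) -> cvgn u.
Proof.
move=> h.
have c : cvgn (series (fun n => u n.+1 - u n)).
  apply: (@normed_cvg R R^o).
  apply: (@series_le_cvg R _ (geometric M 2^-1)) => //.
  - by move=> n; exact: normr_ge0.
  - move=> n; rewrite /geometric /=; apply: le_trans (h n); exact: normr_ge0.
  - by apply: is_cvg_geometric_series; rewrite ger0_norm // invf_lt1 // ltr1n.
have e : series (fun n => u n.+1 - u n) = (fun n => u n - u 0%N).
  by apply/funext => n; rewrite /series /= telescope_sumr.
have -> : u = (fun n => series (fun n => u n.+1 - u n) n + u 0%N).
  by apply/funext => n; rewrite e subrK.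
by apply: is_cvgD => //; exact: is_cvg_cst.
Qed.

(** Off the null set where the increments are not summable the sequence is replaced by 0;
    it then converges everywhere, so that the limit is measurable. *)
Lemma L2_fast_complete (v : nat -> R -> R[i]) : (forall n, L2 (v n)) ->
  (forall n m, (n <= m)%N -> nrm (fun x => v m x - v n x) <= 4^-1 ^+ n) ->
  exists2 g, L2 g & forall n, nrm (fun x => v n x - g x) <= 4^-1 ^+ n.
Proof.
move=> Lv hv.
have [D [mD aD hD]] := L2_fast_cvg_ae Lv (fun n => hv n n.+1 (leqnSn n)).
have mone : cmeas (fun x => (\1_D x)%:C : R[i]).
  by apply: cmeas_real; exact: measurable_indic.
pose w n := fun x => (\1_D x)%:C * v n x.
have Lw n : L2 (w n).
  apply: (@L2_mulb R _ _ 1 _ _ _).1 => // x; rewrite modulus_real.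
  by rewrite indicE; case: (_ \in _); rewrite ?normr1 ?normr0.
have wv n : {ae mu, forall x, v n x = w n x}.
  by move: aD; apply: aeS => x Dx; rewrite /w indicE mem_set // mul1r.
have cw x : exists M, forall n, modulus (w n.+1 x - w n x) <= M * 2^-1 ^+ n.
  have [Dx|nDx] := pselect (D x).
    have [M hM] := hD x Dx; exists M => n.
    by rewrite /w indicE mem_set // !mul1r; exact: hM.
  by exists 0 => n; rewrite /w indicE memNset // (_ : (false%:R)%:C = 0 :> R[i]) // !mul0r subrr modulus0 lexx.
have cRe x : cvgn (fun n => Re (w n x)).
  have [M hM] := cw x; apply: (@fast_cvg _ M) => n; apply: le_trans (hM n).
  by rewrite -ReN -ReD Re_le_modulus.
have cIm x : cvgn (fun n => Im (w n x)).
  have [M hM] := cw x; apply: (@fast_cvg _ M) => n; apply: le_trans (hM n).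
  by rewrite -ImN -ImD Im_le_modulus.
pose g := fun x => limn (fun n => Re (w n x)) +i* limn (fun n => Im (w n x)).
have mlim (F : nat -> R -> R) : (forall n, measurable_fun setT (F n)) ->
    (forall x, cvgn (fun n => F n x)) -> measurable_fun setT (fun x => limn (fun n => F n x)).
  move=> mF cF; apply/measurable_EFinP.
  apply: (emeasurable_fun_cvg (fun n x => (F n x)%:E)).
    by move=> n; exact/measurable_EFinP.
  by move=> x _; apply/fine_cvgP; split; [exact: nearW|exact: cF].
have mg : cmeas g.
  by split; apply: mlim => // n; have [] := L2_cmeas (Lw n).
have wg x : (fun n => modulus (w n x - g x)) @ \oo --> (0 : R).
  have r0 : (fun n => `|Re (w n x) - Re (g x)| + `|Im (w n x) - Im (g x)|) @ \oo --> (0 : R).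
    rewrite -[X in _ --> X](addr0 (0:R)); apply: cvgD.
    - by rewrite -(normr0 R); apply: cvg_norm; apply/subr_cvg0; exact: cRe.
    - by rewrite -(normr0 R); apply: cvg_norm; apply/subr_cvg0; exact: cIm.
  apply: (@squeeze_cvgr _ _ _ _ (fun=> 0) _ _ _ _ (cvg_cst _) r0); apply: nearW => n.
  rewrite modulus_ge0 /= (le_trans (modulus_le _)) // ReD ImD ReN ImN //.
have key n : L2 g /\ nrm (fun x => w n x - g x) <= 4^-1 ^+ n.
  apply: (L2_fatou Lw (Lw n) mg wg); exists n => // m /= nm.
  rewrite nrm_distC; apply: le_trans (hv n m nm); rewrite le_eqVlt; apply/orP; left.
  apply/eqP; apply: ae_eq_nrm; try by apply: L2_cmeas; exact: L2B.
  by move: (wv n) (wv m); apply: aeS2 => x -> ->.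
exists g => [|n]; first exact: (key 0%N).1.
have [Lg le] := key n; apply: le_trans le; rewrite le_eqVlt; apply/orP; left.
apply/eqP; apply: ae_eq_nrm; try by apply: L2_cmeas; exact: L2B.
by move: (wv n); apply: aeS => x ->.
Qed.

(** A Cauchy sequence has a subsequence to which [L2_fast_complete] applies. *)
Theorem L2_complete (u : nat -> R -> R[i]) : (forall n, L2 (u n)) -> L2cauchy u ->
  exists2 g, L2 g & cvgL2 u g.
Proof.
move=> Lu cu.
have p4 n : 0 < 4^-1 ^+ n :> R by rewrite exprn_gt0 // invr_gt0.
have /choice[N hN] : forall n : nat, exists N, forall m k, (N <= m)%N -> (N <= k)%N ->
    nrm (fun x => u m x - u k x) < 4^-1 ^+ n by move=> n; exact: cu.
pose s n := (\sum_(k < n.+1) N k)%N.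
have Ns n : (N n <= s n)%N by rewrite /s big_ord_recr /= leq_addl.
have smono n m : (n <= m)%N -> (s n <= s m)%N.
  move=> /subnK <-; elim: (m - n)%N => [//|k ih].
  by rewrite addSn (leq_trans ih) // [X in (_ <= X)%N]/s big_ord_recr leq_addr.
have [n m nm|g Lg hg] := @L2_fast_complete (fun n => u (s n)) (fun n => Lu (s n)).
  by apply/ltW/hN; rewrite (leq_trans (Ns n)) // smono.
exists g => //; apply/cvgL2P => e e0.
have : (fun n => 2 * 4^-1 ^+ n) @ \oo --> (0 : R).
  apply: (@cvg_geometric R 2 4^-1); by rewrite ger0_norm // invf_lt1 // ltr1n.
move=> /cvgrPdist_lt/(_ e e0)[n _ /(_ n (leqnn n))].
rewrite sub0r normrN ger0_norm ?mulr_ge0 ?(ltW (p4 n)) // => he.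
exists (N n) => // m /= nm; apply: le_lt_trans he.
apply: (le_trans (nrm_dist_triangle (Lu m) (Lu (s n)) Lg)).
by rewrite mulr_natl mulr2n lerD //; apply/ltW/hN.
Qed.

End RieszFischer.

(** * Reflections, translations and multiplications *)

Section ChangeOfVariables.
Context {R : realType}.
Local Notation mu := (@lebesgue_measure R).

Lemma measurable_reflect (a : R) : measurable_fun setT (fun y : R => a - y).
Proof. by apply: measurable_funB => //; exact: measurable_cst. Qed.

(** The image measure agrees with Lebesgue measure on half-open intervals.  Translations
    are then products of two reflections, which is how [integral_shift] is obtained. *)
Lemma lebesgue_measure_reflect (a : R) (A : set R) : measurable A ->
  mu ((fun y => a - y) @^-1` A) = mu A.
Proof.
pose phi : measurableTypeR R -> measurableTypeR R := fun y : R => a - y.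
have mphi : measurable_fun setT phi by exact: measurable_reflect.
pose f := HB.pack_for {mfun measurableTypeR R >-> measurableTypeR R} phi
  (isMeasurableFun.Build _ _ _ _ _ mphi).
move=> mA; have := @lebesgue_measure_unique R (pushforward mu f) _ A mA; move=> -> //.
move=> X [[b c] _ <-] /=; rewrite /pushforward.
have -> : f @^-1` [set` `]b, c]] = [set` `[a - c, a - b[].
  apply/seteqP; split => y /=; rewrite !in_itv /= /phi => /andP[h1 h2]; apply/andP; lra.
rewrite !lebesgue_measure_itv /= !lte_fin; congr (if _ then _ else _).
- by apply/idP/idP => h; lra.
- by rewrite -!EFinB; congr EFin; ring.
Qed.

Lemma ge0_integral_reflect (a : R) (f : R -> \bar R) : measurable_fun setT f ->
  (forall x, 0 <= f x)%E ->
  (\int[mu]_x f (a - x)%R = \int[mu]_x f x)%E.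
Proof.
move=> mf f0.
pose phi : measurableTypeR R -> measurableTypeR R := fun y : R => a - y.
have mphi : measurable_fun setT phi by exact: measurable_reflect.
have := @ge0_integral_pushforward _ _ _ _ R phi mphi mu setT f measurableT mf.
rewrite preimage_setT => /(_ (fun x _ => f0 x)) <-.
by apply: eq_measure_integral => A mA _; exact: lebesgue_measure_reflect.
Qed.

Lemma integral_reflect (a : R) (f : R -> \bar R) : measurable_fun setT f ->
  (\int[mu]_x f (a - x)%R = \int[mu]_x f x)%E.
Proof.
move=> mf; rewrite [LHS]integralE [RHS]integralE; congr (_ - _)%E.
- transitivity (\int[mu]_x maxe (f (a - x)%R) 0)%E.
    by apply: eq_integral => x _; rewrite funeposE.
  rewrite (@ge0_integral_reflect a (fun x => maxe (f x) 0)).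
  + by apply: eq_integral => x _; rewrite funeposE.
  + exact: measurable_maxe.
  + by move=> x; rewrite le_max lexx orbT.
- transitivity (\int[mu]_x maxe (- f (a - x)%R) 0)%E.
    by apply: eq_integral => x _; rewrite funenegE.
  rewrite (@ge0_integral_reflect a (fun x => maxe (- f x)%E 0)).
  + by apply: eq_integral => x _; rewrite funenegE.
  + by apply: measurable_maxe => //; exact: measurableT_comp.
  + by move=> x; rewrite le_max lexx orbT.
Qed.

Lemma integral_shift (a : R) (f : R -> \bar R) : measurable_fun setT f ->
  (\int[mu]_x f (x + a)%R = \int[mu]_x f x)%E.
Proof.
move=> mf; rewrite -[RHS](integral_reflect a mf).
rewrite -[RHS](@integral_reflect 0 (fun x => f (a - x)%R)).
  by apply: eq_integral => x _; congr f; ring.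
by apply: measurableT_comp => //; exact: measurable_reflect.
Qed.

Lemma integrable_reflect (a : R) (f : R -> \bar R) :
  mu.-integrable setT f -> mu.-integrable setT (fun x => f (a - x)).
Proof.
move=> /integrableP[mf If]; apply/integrableP; split.
  by apply: measurableT_comp => //; exact: measurable_reflect.
rewrite (@integral_reflect a (fun x => `|f x|%E)) //.
exact: measurableT_comp.
Qed.

Lemma integrable_shift (a : R) (f : R -> \bar R) :
  mu.-integrable setT f -> mu.-integrable setT (fun x => f (x + a)).
Proof.
move=> /(integrable_reflect a)/(integrable_reflect 0).
by apply: eq_integrable => // x _; congr f; ring.
Qed.

Lemma Rintegral_reflect (a : R) (f : R -> R) : measurable_fun setT f ->
  \int[mu]_x f (a - x) = \int[mu]_x f x.
Proof.
move=> mf; rewrite /Rintegral (@integral_reflect a (EFin \o f)) //.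
exact/measurable_EFinP.
Qed.

Lemma Rintegral_shift (a : R) (f : R -> R) : measurable_fun setT f ->
  \int[mu]_x f (x + a) = \int[mu]_x f x.
Proof.
move=> mf; rewrite /Rintegral (@integral_shift a (EFin \o f)) //.
exact/measurable_EFinP.
Qed.

Lemma measurable_shift (a : R) : measurable_fun setT (fun y : R => y + a).
Proof. by apply: measurable_funD => //; exact: measurable_cst. Qed.

Lemma cmeas_comp (f : R -> R[i]) (phi : R -> R) : cmeas f -> measurable_fun setT phi ->
  cmeas (fun x => f (phi x)).
Proof.
move=> [f1 f2] mp; split.
- by apply: (measurableT_comp f1).
- by apply: (measurableT_comp f2).
Qed.

Definition shift (t : R) (f : R -> R[i]) : R -> R[i] := fun x => f (x - t).

Lemma cmeas_shift t f : cmeas f -> cmeas (shift t f).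
Proof. by move=> mf; apply: cmeas_comp => //; exact: measurable_shift. Qed.

Lemma energy_shift t f : cmeas f -> energy (shift t f) = energy f.
Proof. by move=> mf; apply: integral_shift; exact: measurable_energy. Qed.

Lemma L2_shift t f : L2 f -> L2 (shift t f).
Proof.
move=> Lf; apply/L2P; split; first by apply: cmeas_shift; exact: L2_cmeas.
by rewrite energy_shift; [exact: ((L2P f).1 Lf).2|exact: L2_cmeas].
Qed.

Lemma nrm_shift t f : cmeas f -> nrm (shift t f) = nrm f.
Proof. by move=> mf; rewrite /nrm !L2norm_energy energy_shift. Qed.

Lemma L1_shift t f : L1 f -> L1 (shift t f).
Proof.
move=> /L1P[f1 f2]; apply/L1P; split.
- exact: (integrable_shift (- t) f1).
- exact: (integrable_shift (- t) f2).
Qed.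

Lemma cintegral_shift t f : cmeas f -> cintegral (shift t f) = cintegral f.
Proof.
move=> [f1 f2]; rewrite /cintegral; congr Complex.
- exact: (Rintegral_shift (- t) f1).
- exact: (Rintegral_shift (- t) f2).
Qed.

End ChangeOfVariables.

Section DominatedConvergence.
Context {R : realType}.
Local Notation mu := (@lebesgue_measure R).
Implicit Types f g h : R -> R[i].

(** Dominated convergence, with |2 K h|^2 as the dominating function. *)
Lemma L2_multiplier_cvg (m : nat -> R -> R[i]) (m0 : R -> R[i]) (K : R) h :
  (forall n, cmeas (m n)) -> cmeas m0 -> L2 h ->
  (forall n x, modulus (m n x) <= K) ->
  (forall x, (fun n => modulus (m n x - m0 x)) @ \oo --> (0 : R)) ->
  cvgL2 (fun n x => m n x * h x) (fun x => m0 x * h x).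
Proof.
move=> mm mm0 Lh mK cm.
have K0 : 0 <= K by exact: le_trans (modulus_ge0 (m 0%N 0)) (mK _ _).
have m0K x : modulus (m0 x) <= K.
  have c : (fun n => K + modulus (m n x - m0 x)) @ \oo --> (K + 0 : R).
    by apply: cvgD (cm x); exact: cvg_cst.
  rewrite -(addr0 K) -(cvg_lim _ c) //; apply: limr_ge; first exact: cvgP c.
  apply: nearW => n.
  rewrite -lerBlDr; apply: le_trans (mK n x).
  rewrite lerBlDr modulus_distC; apply: le_trans (modulusD _ _).
  by rewrite addrC subrK.
have d2K n x : modulus (m n x - m0 x) <= 2 * K.
  by rewrite (le_trans (modulusB _ _)) // mulr_natl mulr2n lerD.
have [mh eh] := (L2P h).1 Lh.
have c0 : (fun n => energy (fun x => (m n x - m0 x) * h x)) @ \oo --> 0%E.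
  have := @dominated_convergence _ _ _ mu setT measurableT
    (fun n x => (modulus ((m n x - m0 x) * h x) ^+ 2)%:E) (fun=> 0%E)
    (fun x => ((2 * K) ^+ 2)%:E * (modulus (h x) ^+ 2)%:E)%E.
  case.
  - by move=> n; apply: measurable_energy; apply: cmeasM => //; exact: cmeasB.
  - exact: measurable_cst.
  - apply: aeT => x _; apply/fine_cvgP; split; first exact: nearW.
    have c : (fun n => modulus (m n x - m0 x) * modulus (h x)) @ \oo --> (0 : R).
      rewrite -(mul0r (modulus (h x))); apply: cvgM; [exact: cm|exact: cvg_cst].
    have -> : fine \o (fun n => (modulus ((m n x - m0 x) * h x) ^+ 2)%:E) =
        (fun n => (modulus (m n x - m0 x) * modulus (h x)) *
                  (modulus (m n x - m0 x) * modulus (h x))).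
      by apply/funext => n /=; rewrite modulusM expr2.
    by rewrite -[X in _ --> X](mul0r (0:R)); exact: (cvgM c c).
  - apply: integrableZl => //; apply/integrableP; split; first exact: measurable_energy.
    apply: le_lt_trans eh; rewrite le_eqVlt; apply/orP; left; apply/eqP.
    by apply: eq_integral => x _; rewrite gee0_abs // lee_fin sqr_ge0.
  - apply: aeT => x n _; rewrite gee0_abs ?lee_fin ?sqr_ge0 //.
    rewrite modulusM exprMn ler_wpM2r ?sqr_ge0 // ler_sqr ?nnegrE ?modulus_ge0 //.
    by rewrite mulr_ge0.
  by move=> _ _; rewrite integral0.
have Lm n : L2 (fun x => (m n x - m0 x) * h x).
  by apply: (L2_mulb _ (d2K n) Lh).1; exact: cmeasB.
apply/cvgL2P => e e0.
have : (fun n => (nrm (fun x => (m n x - m0 x) * h x) ^+ 2)%:E) @ \oo --> (0 : R)%:E.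
  rewrite (_ : (fun n => _) = fun n => energy (fun x => (m n x - m0 x) * h x)) //.
  by apply/funext => n; rewrite energy_nrm.
move=> /fine_cvg /cvgrPdist_lt /(_ (e ^+ 2)); rewrite exprn_gt0 // => /(_ isT).
apply: filterS => n /=; rewrite sub0r normrN ger0_norm ?sqr_ge0 //.
rewrite ltr_sqr ?nnegrE ?nrm_ge0 ?ltW //; apply: le_lt_trans.
rewrite le_eqVlt; apply/orP; left; apply/eqP; apply: eq_nrm => x.
by rewrite mulrBl.
Qed.

End DominatedConvergence.

(** * Continuity of translation in L^2 *)

Section TranslationContinuity.
Context {R : realType}.
Local Notation mu := (@lebesgue_measure R).
Implicit Types f g h : R -> R[i].

Definition shift_continuous f := forall t : nat -> R, t @ \oo --> (0 : R) ->
  cvgL2 (fun k => shift (t k) f) f.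

(** Translations are isometries, so the functions along which they act continuously form
    a closed set. *)
Lemma shift_continuous_closed f : L2 f ->
  (forall e, 0 < e -> exists g, [/\ L2 g, shift_continuous g & nrm (fun x => f x - g x) < e]) ->
  shift_continuous f.
Proof.
move=> Lf H t t0; apply/cvgL2P => e e0.
have e3 : 0 < e / 3 by rewrite divr_gt0.
have [g [Lg cg fg]] := H _ e3.
have /cvgL2P/(_ _ e3) := cg t t0; apply: filterS => n hn.
have L1 := L2_shift (t n) Lf; have L2' := L2_shift (t n) Lg.
apply: (le_lt_trans (nrm_dist_triangle L1 L2' Lf)).
have a1 : nrm (fun x => shift (t n) f x - shift (t n) g x) < e / 3.
  by rewrite (nrm_shift (t n) (f := fun x => f x - g x)) //; exact: L2_cmeas (L2B Lf Lg).
have a2 := nrm_dist_triangle L2' Lg Lf.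
have a3 : nrm (fun x => g x - f x) < e / 3 by rewrite nrm_distC.
lra.
Qed.

Lemma L2_indic_itv (a b : R) : L2 (fun x => (\1_(`[a, b]%classic) x)%:C : R[i]).
Proof.
apply/L2P; split; first by apply: cmeas_real; exact: measurable_indic.
have -> : energy (fun x => (\1_(`[a, b]%classic) x)%:C : R[i]) =
    (\int[mu]_x (\1_(`[a, b]%classic) x)%:E)%E.
  apply: eq_integral => x _; rewrite modulus_real real_normK ?num_real // indicE.
  by case: (_ \in _); rewrite ?expr1n ?expr0n.
by rewrite integral_indic // setIT /= lebesgue_measure_itv /=; case: ifP => _; rewrite ?ltry.
Qed.

Lemma cvg_modulus_real (u : nat -> R) (l : R) : u @ \oo --> l ->
  (fun n => modulus ((u n)%:C - l%:C)) @ \oo --> (0 : R).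
Proof.
move=> ul; rewrite (_ : (fun n => _) = (fun n => `|u n - l|)).
  by rewrite -(normr0 R); apply: cvg_norm; apply/subr_cvg0.
by apply/funext => n; rewrite -rmorphB modulus_real.
Qed.

(** For shifts by at most 1 all supports lie in [- (n + 1), n + 1], so multiplying by the
    indicator h of that interval changes nothing and supplies the square-integrable
    factor required by [L2_multiplier_cvg]. *)
Lemma shift_continuous_compact (w : R -> R) (n M : R) : continuous w ->
  (forall x, `|w x| <= M) -> (forall x, n < `|x| -> w x = 0) ->
  L2 (fun x => (w x)%:C) /\ shift_continuous (fun x => (w x)%:C).
Proof.
move=> cw wM wn.
have mw : measurable_fun setT w by exact: continuous_measurable_fun.
pose h : R -> R[i] := fun x => (\1_(`[- (n + 1), n + 1]%classic) x)%:C.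
have Lh : L2 h by exact: L2_indic_itv.
have hE x : `|x| <= n + 1 -> h x = 1.
  by move=> xn; rewrite /h indicE mem_set //= in_itv /= -ler_norml.
have wh s x : `|s| <= 1 -> (w (x - s))%:C * h x = (w (x - s))%:C.
  move=> s1; have [xn|xn] := leP (`|x|) (n + 1); first by rewrite hE // mulr1.
  rewrite wn ?mul0r //; have := ler_normD (x - s) s.
  by rewrite subrK => ?; lra.
have wh0 x : (w x)%:C * h x = (w x)%:C.
  by have := wh 0 x; rewrite subr0; apply; rewrite normr0.
have Lw : L2 (fun x => (w x)%:C).
  rewrite (_ : (fun x => (w x)%:C) = (fun x => (w x)%:C * h x)).
    apply: (@L2_mulb R _ _ M _ _ Lh).1; first exact: cmeas_real.
    by move=> x; rewrite modulus_real.
  by apply/funext => x; rewrite wh0.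
split => // t t0.
have s1 : cvgL2 (fun k x => (w (x - t k))%:C * h x) (fun x => (w x)%:C * h x).
  apply: (@L2_multiplier_cvg R (fun k x => (w (x - t k))%:C) (fun x => (w x)%:C) M h) => //.
  - by move=> k; apply: cmeas_real; apply: (measurableT_comp mw); exact: measurable_shift.
  - by move=> k x; rewrite modulus_real.
  - move=> x; apply: (@cvg_modulus_real (fun k => w (x - t k))).
    have c : (fun k => x - t k) @ \oo --> (x - 0 : R).
      by apply: cvgB => //; exact: cvg_cst.
    by rewrite subr0 in c; exact: (cvg_comp _ _ c (cw x)).
apply: cvg_trans s1; apply: near_eq_cvg.
have /cvgrPdist_le/(_ 1 ltr01) := t0; apply: filterS => k.
rewrite sub0r normrN => tk; apply: eq_nrm => x; rewrite wh0 wh //.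
Qed.

(** A continuous L^1 approximation g of v is truncated in height, by clamp, and in support,
    by theta.  The result w satisfies |v - w|^2 <= 2 M |v - g|, so L^1 closeness becomes L^2
    closeness. *)
Lemma shift_continuous_bounded (v : R -> R) (n M : R) : measurable_fun setT v -> 0 < M -> 0 < n ->
  (forall x, `|v x| <= M) -> (forall x, n < `|x| -> v x = 0) ->
  L2 (fun x => (v x)%:C) /\ shift_continuous (fun x => (v x)%:C).
Proof.
move=> mv M0 n0 vM vn.
pose E := `[- (n + 1), n + 1]%classic : set R.
have mE : measurable E by exact: measurable_itv.
have muE : (mu E < +oo)%E by rewrite /E lebesgue_measure_itv /=; case: ifP => _; rewrite ?ltry.
have hE (x : R) : `|x| <= n + 1 -> E x by move=> xn; rewrite /E /= in_itv /= -ler_norml.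
have Lv : L2 (fun x => (v x)%:C).
  rewrite (_ : (fun x => (v x)%:C) = (fun x => (v x)%:C * (\1_E x)%:C)).
    apply: (@L2_mulb R _ _ M _ _ (L2_indic_itv _ _)).1; first exact: cmeas_real.
    by move=> x; rewrite modulus_real.
  apply/funext => x; have [xn|xn] := leP (`|x|) (n + 1).
    by rewrite indicE mem_set ?mulr1 //; exact: hE.
  by rewrite vn ?mul0r //; lra.
split => //; apply: shift_continuous_closed => // e e0.
have iv : mu.-integrable E (EFin \o v).
  apply: measurable_bounded_integrable => //; first exact: measurable_funTS.
  by exists M; split; rewrite ?num_real // => y My x _; exact: le_trans (vM x) (ltW My).
have [g_ [cg ig gv]] := approximation_continuous_integrable mE muE iv.
pose clamp (y : R) := Num.max (- M) (Num.min M y).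
have clampM y : `|clamp y| <= M.
  rewrite /clamp ler_norml; apply/andP; split; first by rewrite le_max lexx.
  by rewrite ge_max ge_min lexx /= andbT; lra.
have clampv y x : `|v x - clamp y| <= `|v x - y|.
  have := vM x; rewrite ler_norml => /andP[h1 h2]; rewrite /clamp.
  have [h3|h3] := leP M y; last first.
    have [h4|h4] := leP (- M) y; first by rewrite lexx.
    by rewrite !ger0_norm; lra.
  have -> : Num.max (- M) M = M by apply/max_idPr; lra.
  by rewrite !ler0_norm; lra.
pose theta (x : R) := Num.max 0 (Num.min 1 (n + 1 - `|x|)).
have th0 x : 0 <= theta x by rewrite le_max lexx.
have th1 x : theta x <= 1 by rewrite ge_max ler01 /= ge_min lexx.
have thn x : n + 1 < `|x| -> theta x = 0.
  move=> xn; apply/max_idPl; rewrite ge_min; apply/orP; right; lra.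
have th_in x : `|x| <= n -> theta x = 1.
  move=> xn; rewrite /theta; have /min_idPl -> : 1 <= n + 1 - `|x| by lra.
  by apply/max_idPr.
pose w k x := clamp (g_ k x) * theta x.
have cw k : continuous (w k).
  move=> x; apply: cvgM; last first.
    apply: (@continuous_max R R (fun=> 0) _ x); first exact: cvg_cst.
    apply: (@continuous_min R R (fun=> 1) _ x); first exact: cvg_cst.
    apply: cvgB; first exact: cvg_cst.
    exact: norm_continuous.
  apply: (@continuous_max R R (fun=> - M) _ x); first exact: cvg_cst.
  apply: (@continuous_min R R (fun=> M) _ x); first exact: cvg_cst.
  exact: cg.
have wk k := @shift_continuous_compact (w k) (n + 1) M (cw k).
have {}wk k : L2 (fun x => (w k x)%:C) /\ shift_continuous (fun x => (w k x)%:C).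
  apply: wk => x; last by move=> xn; rewrite /w thn // mulr0.
  rewrite /w normrM (ger0_norm (th0 x)) -[leRHS]mulr1.
  by rewrite ler_pM.
have mw k : measurable_fun setT (w k) by exact: continuous_measurable_fun.
have mg k : measurable_fun setT (g_ k) by exact: continuous_measurable_fun.
have vw k : (energy (fun x => ((v x)%:C - (w k x)%:C)%R) <=
    (2 * M)%:E * \int[mu]_(z in E) `|(v z - g_ k z)%:E|)%E.
  rewrite -ge0_integralZl_EFin //; last 2 first.
  - apply: measurableT_comp => //; apply/measurable_EFinP; apply: measurable_funTS.
    by apply: measurable_funB; [exact: mv|exact: mg].
  - by rewrite mulr_ge0 // ltW.
  rewrite [leRHS]integral_mkcond; apply: ge0_le_integral => //.
  - by move=> x _; rewrite lee_fin sqr_ge0.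
  - by apply: measurable_energy; apply: cmeasB; exact: cmeas_real.
  - apply/(measurable_restrictT _ mE); apply: measurable_funeM.
    apply: measurableT_comp => //; apply/measurable_EFinP; apply: measurable_funTS.
    by apply: measurable_funB; [exact: mv|exact: mg].
  move=> x _; rewrite -rmorphB modulus_real patchE.
  case: ifPn => xE; last first.
    have xn : n + 1 < `|x|.
      by rewrite ltNge; apply: contra xE => /hE; exact: mem_set.
    by rewrite /w thn // mulr0 vn ?subr0 ?normr0 ?expr0n //; lra.
  rewrite lee_fin expr2.
  have -> : v x - w k x = (v x - clamp (g_ k x)) * theta x.
    rewrite /w; have [xn|xn] := leP (`|x|) n; first by rewrite th_in // !mulr1.
    by rewrite vn // !sub0r mulNr.
  rewrite normrM (ger0_norm (th0 x)); set c := `|_ - _|.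
  have c0 : 0 <= c by exact: normr_ge0.
  have c2 : c <= 2 * M.
    by rewrite (le_trans (ler_normB _ _)) // mulr_natl mulr2n lerD.
  have ct : c * theta x <= c by rewrite -[leRHS]mulr1 ler_wpM2l.
  have ct0 : 0 <= c * theta x by rewrite mulr_ge0.
  by apply: ler_pM => //; [exact: le_trans ct c2|exact: le_trans ct (clampv _ _)].
pose d := e ^+ 2 / (2 * M).
have d0 : 0 < d by rewrite divr_gt0 ?exprn_gt0 ?mulr_gt0.
have hfin k : (\int[mu]_(z in E) `|(v z - g_ k z)%:E| \is a fin_num)%E.
  rewrite integrable_fin_num // integrable_abse //.
  by under eq_fun do rewrite EFinB; apply: integrableB => //; exact: ig.
have [k hk] : exists k, (\int[mu]_(z in E) `|(v z - g_ k z)%:E| < d%:E)%E.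
  move/fine_cvgP : gv => [_ /cvgrPdist_lt/(_ _ d0)[k _ /(_ k (leqnn k))]].
  rewrite /= sub0r normrN => h; exists k; rewrite -(fineK (hfin k)) lte_fin.
  exact: le_lt_trans (ler_norm _) h.
exists (fun x => (w k x)%:C); have [Lw Sw] := wk k; split => //.
rewrite -ltr_sqr ?nnegrE ?nrm_ge0 ?ltW // -lte_fin -energy_nrm; last exact: L2B.
apply: le_lt_trans (vw k) _.
have -> : (e ^+ 2)%:E = ((2 * M)%:E * d%:E)%E.
  by rewrite -EFinM; congr EFin; rewrite /d; field; rewrite gt_eqF.
by rewrite lte_pmul2l // lte_fin mulr_gt0.
Qed.

(** Restricting u to the set where |x| and |u x| are at most n + 1 gives bounded functions
    of bounded support that converge to u in L^2. *)
Lemma shift_continuous_real (u : R -> R) : L2 (fun x => (u x)%:C) ->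
  shift_continuous (fun x => (u x)%:C).
Proof.
move=> Lu; have mu' : measurable_fun setT u by have [] := L2_cmeas Lu.
pose A (n : nat) := [set x : R | `|x| <= n.+1%:R] `&` [set x | `|u x| <= n.+1%:R].
have mA n : measurable (A n).
  apply: measurableI.
  - rewrite (_ : [set x | _] = [set` `[- n.+1%:R, n.+1%:R]]); first exact: measurable_itv.
    by apply/seteqP; split => x /=; rewrite in_itv /= ler_norml.
  - have mnu : measurable_fun setT (fun x => `|u x|) by exact: measurableT_comp.
    rewrite (_ : [set x | _] = setT `&` (fun x => `|u x|) @^-1` [set` `]-oo, n.+1%:R]]).
      by apply: mnu => //; exact: measurable_itv.
    by apply/seteqP; split => x /=; rewrite in_itv /= => h //; case: h.
pose v n x := \1_(A n) x * u x.
have AE n x : \1_(A n) x = 0 \/ \1_(A n) x = 1 :> R.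
  by rewrite !indicE; have [xA|xA] := pselect (A n x); [right; rewrite mem_set|left; rewrite memNset].
have vc : cvgL2 (fun n x => (\1_(A n) x)%:C * (u x)%:C) (fun x => 1 * (u x)%:C).
  apply: (@L2_multiplier_cvg R _ (fun=> 1) 1) => //.
  - by move=> n; apply: cmeas_real; exact: measurable_indic.
  - by move=> n x; rewrite modulus_real; case: (AE R n x) => ->; rewrite ?normr0 ?normr1.
  - move=> x; apply: (@cvg_modulus_real (fun n => \1_(A n) x) 1).
    have [N hN] : exists N : nat, Num.max `|x| `|u x| <= N%:R.
      exists (Num.truncn (Num.max `|x| `|u x|)).+1; apply/ltW.
      by rewrite truncnS_gt.
    apply: cvg_near_cst; exists N => // m /= Nm; rewrite indicE mem_set //.
    move: hN; rewrite ge_max => /andP[h1 h2].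
    have NmR : N%:R <= m.+1%:R :> R by rewrite ler_nat (leq_trans Nm).
    by split => /=; [exact: le_trans h1 NmR|exact: le_trans h2 NmR].
apply: shift_continuous_closed => // e e0.
move/cvgL2P/(_ _ e0) : vc => [n _ /(_ n (leqnn n)) /= hn].
exists (fun x => (v n x)%:C).
have [Lv Sv] : L2 (fun x => (v n x)%:C) /\ shift_continuous (fun x => (v n x)%:C).
  apply: (@shift_continuous_bounded _ n.+1%:R n.+1%:R) => //.
  - by apply: measurable_funM => //; exact: measurable_indic.
  - move=> x; rewrite /v indicE; case: (boolP (x \in A n)) => [/set_mem[_ h]|_].
      by rewrite mul1r.
    by rewrite mul0r normr0.
  - move=> x xn; rewrite /v indicE memNset ?mul0r //= => -[/=].
    by rewrite leNgt xn.
split => //; rewrite nrm_distC; apply: le_lt_trans hn.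
by rewrite le_eqVlt; apply/orP; left; apply/eqP/eq_nrm => x; rewrite mul1r /v rmorphM.
Qed.

End TranslationContinuity.

(** * The Poisson kernel *)

Section Poisson.
Context {R : realType}.
Local Notation mu := (@lebesgue_measure R).

(** The transform of w |-> e^(- e |w|); see [Rintegral_expcos]. *)
Definition poisson (e t : R) : R := 2 * e / (e ^+ 2 + (2 * pi * t) ^+ 2).

Lemma cvg_expRN (e : R) : 0 < e -> expR (- (e * w)) @[w --> +oo] --> (0 : R).
Proof.
move=> e0; apply: (cvg_comp (fun w => e * w) (fun x => expR (- x))).
  by apply: gt0_cvgMry => //; exact: cvg_id.
exact: cvgr_expR.
Qed.

(** A primitive of e^(- e w) (1 + cos (b w)).  The summand 1 keeps the integrand
    nonnegative, as the improper form of the fundamental theorem of calculus requires; it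
    is subtracted again in [Rintegral_expcos]. *)
Let expcos_primitive (e b : R) (w : R) : R := expR (- (e * w)) *
  ((b * sin (b * w) - e * cos (b * w)) / (e ^+ 2 + b ^+ 2) - e^-1).

Lemma is_derive_expcos_primitive (e b w : R) : 0 < e ->
  is_derive w 1 (expcos_primitive e b) (expR (- (e * w)) * (1 + cos (b * w))).
Proof.
move=> e0.
have D0 : e ^+ 2 + b ^+ 2 != 0.
  by rewrite gt_eqF // ltr_pwDl ?exprn_gt0 // sqr_ge0.
rewrite /expcos_primitive; apply: is_derive_eq.
rewrite /GRing.scale /= !mulr1 ?mul0r ?add0r ?addr0.
by field; rewrite gt_eqF.
Qed.

Lemma cvg_mul_bounded0 (f g : R -> R) (M : R) : f w @[w --> +oo] --> (0 : R) ->
  (forall w, `|g w| <= M) -> f w * g w @[w --> +oo] --> (0 : R).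
Proof.
move=> f0 gM.
have M0 : 0 <= M := le_trans (normr_ge0 _) (gM 0).
have h : `|f w| * M @[w --> +oo] --> (0 : R).
  rewrite -[X in _ --> X](mul0r M); apply: cvgMr_tmp.
  by rewrite -(normr0 R); apply: cvg_norm.
have h' : - (`|f w| * M) @[w --> +oo] --> (0 : R) by rewrite -[X in _ --> X]oppr0; exact: cvgN.
apply: (@squeeze_cvgr _ _ _ _ (fun w => - (`|f w| * M)) _ _ _ _ h' h); apply: nearW => w.
by rewrite -ler_norml normrM ler_wpM2l.
Qed.

Lemma cvg_expcos_primitive (e b : R) : 0 < e -> expcos_primitive e b w @[w --> +oo] --> (0 : R).
Proof.
move=> e0.
have D0 : 0 < e ^+ 2 + b ^+ 2 by rewrite ltr_pwDl ?exprn_gt0 // sqr_ge0.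
apply: (@cvg_mul_bounded0 _ _ ((`|b| + e) / (e ^+ 2 + b ^+ 2) + e^-1)); first exact: cvg_expRN.
move=> w; rewrite (le_trans (ler_normB _ _)) // lerD //; last first.
  by rewrite ger0_norm // invr_ge0 ltW.
rewrite normrM normfV (gtr0_norm D0) ler_wpM2r ?invr_ge0 ?(ltW D0) //.
rewrite (le_trans (ler_normB _ _)) // !normrM (gtr0_norm e0) lerD //.
- by rewrite -[leRHS]mulr1 ler_wpM2l // sin_max.
- by rewrite -[leRHS]mulr1 ler_wpM2l ?(ltW e0) // cos_max.
Qed.

Lemma expcos_primitive0 (e b : R) : expcos_primitive e b 0 = - (e / (e ^+ 2 + b ^+ 2)) - e^-1.
Proof. by rewrite /expcos_primitive !mulr0 oppr0 expR0 sin0 cos0 !mulr0 sub0r mul1r mulr1 mulNr. Qed.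

Lemma continuous_expcos (e b : R) : continuous (fun w => expR (- (e * w)) * (1 + cos (b * w))).
Proof.
move=> w; apply: cvgM.
  apply: (continuous_comp (f := fun w => - (e * w)) (g := @expR R)); last exact: continuous_expR.
  by apply: cvgN; apply: cvgMl_tmp; exact: cvg_id.
apply: cvgD; first exact: cvg_cst.
apply: (continuous_comp (f := fun w => b * w) (g := @cos R)); last exact: continuous_cos.
by apply: cvgMl_tmp; exact: cvg_id.
Qed.

Lemma integral0y_expcos (e b : R) : 0 < e ->
  (\int[mu]_(w in `[0%R, +oo[) (expR (- (e * w)) * (1 + cos (b * w)))%:E =
   (e / (e ^+ 2 + b ^+ 2) + e^-1)%:E)%E.
Proof.
move=> e0; rewrite (@ge0_continuous_FTC2y R _ (expcos_primitive e b) 0 0).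
- by rewrite -EFinB expcos_primitive0 sub0r opprB opprK addrC.
- move=> x x0; rewrite mulr_ge0 ?expR_ge0 // addrC -lerBlDr sub0r cos_geN1 //.
- by apply: continuous_subspaceT; exact: continuous_expcos.
- exact: cvg_expcos_primitive.
- by move=> x x0; have [] := @is_derive_expcos_primitive e b x e0.
- apply: cvg_at_right_filter; apply: differentiable_continuous; apply/derivable1_diffP.
  by have [] := @is_derive_expcos_primitive e b 0 e0.
- by move=> x _; rewrite derive1E; have [_] := @is_derive_expcos_primitive e b x e0.
Qed.

Lemma continuous_abs_comp (f : R -> R) : continuous f -> continuous (fun x : R => f `|x|).
Proof.
move=> cf x; apply: (@continuous_comp R^o R^o R^o (@Num.norm R R^o) f x); last exact: cf.
exact: norm_continuous.
Qed.

Lemma integral_abs_even (f : R -> R) : continuous f -> (forall x, 0 <= x -> 0 <= f x) ->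
  (\int[mu]_x (f `|x|)%:E = 2%:E * \int[mu]_(x in `[0%R, +oo[) (f x)%:E)%E.
Proof.
move=> cf f0; rewrite (@ge0_symfun_integralT R (fun x => f `|x|)).
- congr (_ * _)%E; rewrite (_ : [set x | _] = `[0, +oo[%classic); last first.
    by apply/seteqP; split => x /=; rewrite in_itv /= andbT.
  by apply: eq_integral => x; rewrite inE /= in_itv /= andbT => x0; rewrite ger0_norm.
- by move=> x; exact: f0.
- exact: continuous_abs_comp.
- by move=> x /=; rewrite normrN.
Qed.

Lemma integral_expcos (e b : R) : 0 < e ->
  (\int[mu]_w (expR (- (e * `|w|)) * (1 + cos (b * w)))%:E =
   (2 * (e / (e ^+ 2 + b ^+ 2) + e^-1))%:E)%E.
Proof.
move=> e0; rewrite EFinM -integral0y_expcos //.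
rewrite -(@integral_abs_even (fun w => expR (- (e * w)) * (1 + cos (b * w)))).
- apply: eq_integral => w _; congr (EFin (_ * (_ + _))).
  have [w0|w0] := leP 0 w; first by rewrite ger0_norm.
  by rewrite ltr0_norm // mulrN cosN.
- exact: continuous_expcos.
- by move=> x x0; rewrite mulr_ge0 ?expR_ge0 // addrC -lerBlDr sub0r cos_geN1.
Qed.

Lemma measurable_expabs (e : R) : measurable_fun setT (fun w : R => expR (- (e * `|w|))).
Proof.
apply: continuous_measurable_fun.
apply: (@continuous_abs_comp (fun w => expR (- (e * w)))) => w.
apply: (continuous_comp (f := fun w => - (e * w)) (g := @expR R)); last exact: continuous_expR.
by apply: cvgN; apply: cvgMl_tmp; exact: cvg_id.
Qed.

Lemma integrable_expabs (e : R) : 0 < e ->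
  mu.-integrable setT (fun w : R => (expR (- (e * `|w|)))%:E).
Proof.
have mE : measurable_fun setT (fun w : R => (expR (- (e * `|w|)))%:E).
  by apply/measurable_EFinP; exact: measurable_expabs.
move=> e0; apply/integrableP; split => //.
apply: le_lt_trans (ltry (2 * (e / (e ^+ 2 + 0 ^+ 2) + e^-1))).
rewrite -integral_expcos //; apply: ge0_le_integral => //.
- exact: measurableT_comp mE.
- apply/measurable_EFinP; apply: measurable_funM; first exact: measurable_expabs.
  by under eq_fun do rewrite mul0r cos0; exact: measurable_cst.
- move=> w _; rewrite gee0_abs ?lee_fin ?expR_ge0 // mul0r cos0.
  by rewrite ler_peMr ?expR_ge0 // lerDl.
Qed.

Lemma integrable_expcos (e b : R) : 0 < e ->
  mu.-integrable setT (fun w : R => (expR (- (e * `|w|)) * cos (b * w))%:E).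
Proof.
move=> e0; have ie := integrable_expabs e0; apply: le_integrable ie => //.
- apply/measurable_EFinP; apply: measurable_funM; first exact: measurable_expabs.
  apply: continuous_measurable_fun => w.
  apply: (continuous_comp (f := fun w => b * w) (g := @cos R)); last exact: continuous_cos.
  by apply: cvgMl_tmp; exact: cvg_id.
- by move=> w _ /=; rewrite lee_fin normrM -[leRHS]mulr1 ler_wpM2l // cos_max.
Qed.

Lemma Rintegral_expcos (e t : R) : 0 < e ->
  \int[mu]_w (expR (- (e * `|w|)) * cos (2 * pi * t * w)) = poisson e t.
Proof.
move=> e0; pose E (w : R) := expR (- (e * `|w|)).
have ie : mu.-integrable setT (EFin \o E) by exact: integrable_expabs.
have D b : \int[mu]_w (E w * cos (b * w)) + \int[mu]_w E w =
    2 * (e / (e ^+ 2 + b ^+ 2) + e^-1).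
  rewrite -RintegralD //; last exact: integrable_expcos.
  rewrite /Rintegral -[RHS]/(fine (2 * (e / (e ^+ 2 + b ^+ 2) + e^-1))%:E).
  rewrite -integral_expcos //; congr fine; apply: eq_integral => w _; congr EFin.
  by rewrite /E; ring.
have := D 0; under eq_Rintegral do rewrite mul0r cos0 mulr1; move=> D0.
have := D (2 * pi * t); rewrite /E => /(canRL (addrK _)) ->; rewrite /poisson.
have -> : \int[mu]_w expR (- (e * `|w|)) = 2 / e.
  apply: (@mulfI _ 2) => //; rewrite mulr_natl mulr2n D0 expr0n /= addr0.
  by field; rewrite gt_eqF.
have P0 : e ^+ 2 + (2 * pi * t) ^+ 2 != 0.
  by rewrite gt_eqF // ltr_pwDl ?exprn_gt0 // sqr_ge0.
by move: (pi : R) P0 => p P0; field; rewrite P0 gt_eqF.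
Qed.

Lemma poisson_ge0 (e t : R) : 0 < e -> 0 <= poisson e t.
Proof. by move=> e0; rewrite divr_ge0 ?addr_ge0 ?sqr_ge0 // mulr_ge0 // ltW. Qed.

Lemma continuous_poisson (e : R) : 0 < e -> continuous (poisson e).
Proof.
move=> e0 t; rewrite /poisson; apply: cvgM; first exact: cvg_cst.
apply: cvgV.
  by rewrite gt_eqF // ltr_pwDl ?exprn_gt0 // sqr_ge0.
apply: cvgD; first exact: cvg_cst.
have c : 2 * pi * x @[x --> t] --> 2 * pi * t by apply: cvgMl_tmp; exact: cvg_id.
by rewrite expr2; under eq_cvg do rewrite expr2; exact: cvgM.
Qed.

Lemma is_derive_poisson_primitive (e t : R) : 0 < e ->
  is_derive t 1 (fun x : R => pi^-1 * atan (2 * pi / e * x)) (poisson e t).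
Proof.
move=> e0; have pp : 0 < pi :> R := pi_gt0 R.
have P0 : e ^+ 2 + (2 * pi * t) ^+ 2 != 0.
  by rewrite gt_eqF // ltr_pwDl ?exprn_gt0 // sqr_ge0.
apply: is_derive_eq.
rewrite /GRing.scale /= !mulr1 ?mul0r ?add0r ?addr0 /poisson.
move: (pi : R) pp P0 => p pp P0; field.
by rewrite P0 !gt_eqF.
Qed.

Lemma integral_poisson (e : R) : 0 < e -> (\int[mu]_t (poisson e t)%:E = 1)%E.
Proof.
move=> e0.
have PA t : poisson e `|t| = poisson e t.
  by rewrite /poisson !exprMn real_normK // num_real.
transitivity (\int[mu]_t (poisson e `|t|)%:E)%E.
  by apply: eq_integral => t _; rewrite PA.
rewrite integral_abs_even; [|exact: continuous_poisson|by move=> *; exact: poisson_ge0].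
have pp : 0 < pi :> R := pi_gt0 R.
have dF t := is_derive_poisson_primitive t e0; set F := (fun x => _) in dF.
rewrite (@ge0_continuous_FTC2y R _ F 0 2^-1).
- rewrite /F mulr0 atan0 mulr0 sube0 -EFinM divff //.
- by move=> x _; exact: poisson_ge0.
- by apply: continuous_subspaceT; exact: continuous_poisson.
- have -> : 2^-1 = pi^-1 * (pi / 2) :> R by rewrite mulrA mulVf ?mul1r // gt_eqF.
  apply: cvgMl_tmp; apply: (cvg_comp (fun t => 2 * pi / e * t) (@atan R)); last exact: cvgy_atan.
  by apply: gt0_cvgMry; [rewrite divr_gt0 ?mulr_gt0|exact: cvg_id].
- by move=> x _; have [] := dF x.
- apply: cvg_at_right_filter; apply: differentiable_continuous; apply/derivable1_diffP.
  by have [] := dF 0.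
- by move=> x _; rewrite derive1E; have [_] := dF x.
Qed.

End Poisson.

Section ApproximateIdentity.
Context {R : realType}.
Local Notation mu := (@lebesgue_measure R).

Lemma measurable_poisson (e : R) : 0 < e -> measurable_fun setT (poisson e).
Proof. by move=> e0; apply: continuous_measurable_fun; exact: continuous_poisson. Qed.

Lemma integrable_poisson (e : R) : 0 < e -> mu.-integrable setT (EFin \o poisson e).
Proof.
move=> e0; apply/integrableP; split; first by apply/measurable_EFinP; exact: measurable_poisson.
apply: le_lt_trans (ltry 1); rewrite -(integral_poisson e0) le_eqVlt; apply/orP; left; apply/eqP.
by apply: eq_integral => t _; rewrite /= ger0_norm // poisson_ge0.
Qed.

Lemma Rintegral_poisson (e : R) : 0 < e -> \int[mu]_t poisson e t = 1.
Proof. by move=> e0; rewrite /Rintegral integral_poisson. Qed.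

(** Away from 0 the kernel of width e is dominated by e times a constant times the kernel
    of width 1. *)
Lemma poisson_tail (e d t : R) : 0 < e -> 0 < d -> d <= `|t| ->
  poisson e t <= e * ((2 * pi * d) ^- 2 + 1) * poisson 1 t.
Proof.
move=> e0 d0 dt; rewrite /poisson.
have dd : (2 * pi * d) ^+ 2 <= (2 * pi * t) ^+ 2.
  have pp : 0 <= 2 * pi :> R by rewrite mulr_ge0 // pi_ge0.
  rewrite -[leRHS]real_normK ?num_real // normrM (ger0_norm pp).
  have h : 2 * pi * d <= 2 * pi * `|t| by exact: ler_wpM2l.
  have h0 : 0 <= 2 * pi * d by apply: mulr_ge0 => //; exact: ltW.
  by rewrite ler_sqr ?nnegrE // (le_trans h0).
have D0 : 0 < (2 * pi * d) ^+ 2 by rewrite exprn_gt0 // !mulr_gt0 // pi_gt0.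
move: ((2 * pi * d) ^+ 2) ((2 * pi * t) ^+ 2) dd D0 => D T DT D0.
have T0 : 0 < T by exact: lt_le_trans DT.
have e2 : 0 < e ^+ 2 by rewrite exprn_gt0.
rewrite expr1n ler_pdivrMr; last by lra.
rewrite mulr1 [leRHS](_ : _ = 2 * e * (((D^-1 + 1) / (1 + T)) * (e ^+ 2 + T))); last first.
  by ring.
rewrite ler_peMr ?mulr_ge0 ?(ltW e0) // mulrAC ler_pdivlMr; last by lra.
rewrite mul1r mulrDl mul1r.
have h : 1 <= D^-1 * (e ^+ 2 + T).
  by rewrite ler_pdivlMl // mulr1; lra.
lra.
Qed.

(** Near 0 the continuity of A is used, and elsewhere [poisson_tail].  The bound eta is
    written as the integral of eta/2 times the two kernels of widths e and 1, so that
    both contributions are estimated pointwise. *)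
Lemma poisson_approx (A : R -> R) (M : R) : measurable_fun setT A ->
  (forall t, `|A t| <= M) -> {for 0, continuous A} ->
  forall eta, 0 < eta -> exists2 d, 0 < d & forall e, 0 < e -> e < d ->
    `|\int[mu]_t (A t * poisson e t) - A 0| <= eta.
Proof.
move=> mA AM cA eta eta0.
have M0 : 0 <= M by exact: le_trans (normr_ge0 _) (AM 0).
have eta2 : 0 < eta / 2 by rewrite divr_gt0.
move/cvgrPdist_le/(_ _ eta2) : cA => /nbhs_ballP[d /= d0 hd].
pose K := (2 * pi * d) ^- 2 + 1 : R.
have K0 : 0 < K by rewrite ltr_pwDr // invr_ge0 sqr_ge0.
have MK : 0 < 2 * M * K + 1 by rewrite ltr_pwDr // !mulr_ge0 // ltW.
exists (eta / 2 / (2 * M * K + 1)); first by rewrite divr_gt0.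
move=> e e0 ed.
have ip := integrable_poisson e0.
have iAp : mu.-integrable setT (EFin \o (fun t => A t * poisson e t)).
  have /integrableP[mp _] := ip.
  apply: le_integrable (integrableZl measurableT M ip) => //.
    by apply/measurable_EFinP; apply: measurable_funM => //; exact: measurable_poisson.
  move=> t _; rewrite /= lee_fin !normrM ler_wpM2r //; rewrite (ger0_norm M0); exact: AM.
have -> : \int[mu]_t (A t * poisson e t) - A 0 = \int[mu]_t ((A t - A 0) * poisson e t).
  rewrite -[X in _ - X]mulr1 -(Rintegral_poisson e0) -RintegralZl // -RintegralB //.
    by apply: eq_Rintegral => t _; rewrite mulrBl.
  by have := integrableZl measurableT (A 0) ip; apply: eq_integrable.
have iD : mu.-integrable setT (EFin \o (fun t => (A t - A 0) * poisson e t)).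
  have := integrableB measurableT iAp (integrableZl measurableT (A 0) ip).
  by apply: eq_integrable => // t _ /=; rewrite mulrBl EFinB.
apply: (le_trans (le_normr_Rintegral _ iD)) => //.
have ip1 := @integrable_poisson 1 ltr01.
have -> : eta = \int[mu]_t (eta / 2 * poisson e t) + \int[mu]_t (eta / 2 * poisson 1 t).
  rewrite (RintegralZl _ measurableT ip) (RintegralZl _ measurableT ip1) !Rintegral_poisson // !mulr1; lra.
have i1 : mu.-integrable setT (EFin \o (fun t => eta / 2 * poisson e t)).
  have := integrableZl measurableT (eta / 2) ip; exact: eq_integrable.
have i2 : mu.-integrable setT (EFin \o (fun t => eta / 2 * poisson 1 t)).
  have := integrableZl measurableT (eta / 2) ip1; exact: eq_integrable.
rewrite -RintegralD //; apply: le_Rintegral => //.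
- exact: integrable_norm iD.
- have := integrableD measurableT i1 i2; exact: eq_integrable.
move=> t _; rewrite normrM (ger0_norm (poisson_ge0 t e0)).
have [td|td] := ltP `|t| d.
  have h : `|A t - A 0| <= eta / 2.
    by rewrite distrC; apply: hd; rewrite /ball /= sub0r normrN.
  rewrite (le_trans (ler_wpM2r (poisson_ge0 t e0) h)) // lerDl.
  by rewrite mulr_ge0 ?(ltW eta2) ?poisson_ge0.
have h : `|A t - A 0| <= 2 * M.
  by rewrite (le_trans (ler_normB _ _)) // mulr_natl mulr2n lerD.
have p1 := poisson_ge0 t (@ltr01 R).
rewrite (le_trans (ler_pM _ (poisson_ge0 t e0) h (poisson_tail e0 d0 td))) //.
have pe : 0 <= eta / 2 * poisson e t by apply: mulr_ge0; [exact: ltW|exact: poisson_ge0].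
rewrite -/K -[leLHS]add0r lerD //.
rewrite mulrA ler_wpM2r //.
have : e * (2 * M * K + 1) < eta / 2 by rewrite -ltr_pdivlMr.
nra.
Qed.

End ApproximateIdentity.

(** * Fubini for real-valued integrals *)

Section RealFubini.
Context {R : realType}.
Local Notation mu := (@lebesgue_measure R).

(** An iterated integral of real-valued integrals involves the finite parts of the inner
    integrals; these may be dropped almost everywhere. *)
Lemma integral_fine (f : R -> \bar R) : mu.-integrable setT f ->
  (\int[mu]_x (fine (f x))%:E = \int[mu]_x f x)%E.
Proof.
move=> /[dup] fi /integrableP[mf _]; apply: ae_eq_integral => //.
  by apply/measurable_EFinP; apply: measurableT_comp.
move: (integrable_ae measurableT fi); apply: aeS => x /(_ I) h _.
by rewrite fineK.
Qed.

Lemma integrable_fine (f : R -> \bar R) : mu.-integrable setT f ->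
  mu.-integrable setT (EFin \o (fun x => fine (f x))).
Proof.
move=> /[dup] fi /integrableP[mf lf]; apply/integrableP; split.
  by apply/measurable_EFinP; apply: measurableT_comp.
apply: le_lt_trans lf; apply: ge0_le_integral => //.
- by apply: measurableT_comp => //; apply/measurable_EFinP; apply: measurableT_comp.
- exact: measurableT_comp.
- by move=> x _; rewrite /=; case: (f x) => //= *; rewrite ?normr0 ?leey.
Qed.

Lemma measurable_swap_comp (F : R -> R -> R) :
  measurable_fun setT (fun z : R * R => F z.1 z.2) ->
  measurable_fun setT (fun z : R * R => F z.2 z.1).
Proof.
move=> mF.
have ms : measurable_fun setT (fun z : R * R => (z.2, z.1)).
  exact: measurable_swap.
exact: (measurableT_comp mF ms).
Qed.

Lemma integrable_Fubini1 (F : R -> R -> R) :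
  measurable_fun setT (fun z : R * R => F z.1 z.2) ->
  (\int[mu]_x \int[mu]_y `|F x y|%:E < +oo)%E ->
  mu.-integrable setT (fun x => (\int[mu]_y (F x y)%:E)%E).
Proof.
move=> mF FF; pose G := fun z : R * R => (F z.1 z.2)%:E.
have iG : (mu \x mu)%E.-integrable setT G.
  by apply/integrable12ltyP => //; exact/measurable_EFinP.
exact: (integrable_fubini_F iG).
Qed.

Lemma swap_Fubini_lty (F : R -> R -> R) :
  measurable_fun setT (fun z : R * R => F z.1 z.2) ->
  (\int[mu]_x \int[mu]_y `|F x y|%:E < +oo)%E ->
  (\int[mu]_y \int[mu]_x `|F x y|%:E < +oo)%E.
Proof.
move=> mF; rewrite (@fubini_tonelli _ _ _ _ _ mu mu (fun z : R * R => `|F z.1 z.2|%:E)) //.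
by apply/measurable_EFinP; apply: measurableT_comp.
Qed.

Lemma integrable_Fubini2 (F : R -> R -> R) :
  measurable_fun setT (fun z : R * R => F z.1 z.2) ->
  (\int[mu]_x \int[mu]_y `|F x y|%:E < +oo)%E ->
  mu.-integrable setT (fun y => (\int[mu]_x (F x y)%:E)%E).
Proof.
move=> mF FF; apply: (@integrable_Fubini1 (fun y x => F x y)).
- exact: measurable_swap_comp.
- exact: swap_Fubini_lty.
Qed.

Lemma Rintegral_Fubini (F : R -> R -> R) :
  measurable_fun setT (fun z : R * R => F z.1 z.2) ->
  (\int[mu]_x \int[mu]_y `|F x y|%:E < +oo)%E ->
  \int[mu]_x \int[mu]_y F x y = \int[mu]_y \int[mu]_x F x y.
Proof.
move=> mF FF; pose G := fun z : R * R => (F z.1 z.2)%:E.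
have iG : (mu \x mu)%E.-integrable setT G.
  by apply/integrable12ltyP => //; exact/measurable_EFinP.
rewrite /Rintegral (integral_fine (integrable_Fubini1 mF FF)).
by rewrite (integral_fine (integrable_Fubini2 mF FF)) (Fubini iG).
Qed.

Lemma measurable_fst_comp (f : R -> R) : measurable_fun setT f ->
  measurable_fun setT (fun z : R * R => f z.1).
Proof. by move=> mf; apply: measurableT_comp. Qed.

Lemma measurable_snd_comp (f : R -> R) : measurable_fun setT f ->
  measurable_fun setT (fun z : R * R => f z.2).
Proof. by move=> mf; apply: measurableT_comp. Qed.

Lemma measurable_diff_comp (f : R -> R) : measurable_fun setT f ->
  measurable_fun setT (fun z : R * R => f (z.1 - z.2)).
Proof.
move=> mf; apply: (measurableT_comp mf); apply: measurable_funB.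
- exact: (measurable_fst_comp (f := id)).
- exact: (measurable_snd_comp (f := id)).
Qed.

Lemma measurable_cos_prod (c : R) :
  measurable_fun setT (fun z : R * R => cos (2 * pi * z.1 * z.2 * c)).
Proof.
have mc : measurable_fun setT (@cos R).
  by apply: continuous_measurable_fun; exact: continuous_cos.
apply: (measurableT_comp mc); apply: measurable_funM; last exact: measurable_cst.
apply: measurable_funM; last exact: (measurable_snd_comp (f := id)).
apply: measurable_funM; first exact: measurable_cst.
exact: (measurable_fst_comp (f := id)).
Qed.

End RealFubini.

(** * Plancherel's identity *)

Section RealPlancherel.
Context {R : realType}.
Local Notation mu := (@lebesgue_measure R).

(** The cosine and sine transforms: for real u the Fourier transform is fcos u - i fsin u. *)
Definition fcos (u : R -> R) (w : R) : R := \int[mu]_x (u x * cos (2 * pi * x * w)).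
Definition fsin (u : R -> R) (w : R) : R := \int[mu]_x (u x * sin (2 * pi * x * w)).
Definition autocorr (u : R -> R) (t : R) : R := \int[mu]_x (u x * u (x - t)).

Lemma continuous_scale_comp (f : R -> R) (c : R) : continuous f -> continuous (fun w => f (c * w)).
Proof.
move=> cf w; apply: (@continuous_comp R^o R^o R^o (fun w => c * w) f w); last exact: cf.
by apply: cvgMl_tmp; exact: cvg_id.
Qed.

Lemma measurable_scale_comp (f : R -> R) (c w : R) : continuous f ->
  measurable_fun setT (fun x => f (c * x * w)).
Proof.
move=> cf; rewrite (_ : (fun x => _) = (fun x => f (c * w * x))).
  by apply: continuous_measurable_fun; exact: continuous_scale_comp.
by apply/funext => x; rewrite mulrAC.
Qed.

Lemma integrable_bounded_mul (u f : R -> R) : mu.-integrable setT (EFin \o u) ->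
  measurable_fun setT f -> (forall x, `|f x| <= 1) ->
  mu.-integrable setT (EFin \o (fun x => u x * f x)).
Proof.
move=> iu mf f1; have /integrableP[/measurable_EFinP mu' _] := iu.
apply: le_integrable iu => //.
  by apply/measurable_EFinP; apply: measurable_funM.
by move=> x _ /=; rewrite lee_fin normrM -[leRHS]mulr1 ler_wpM2l.
Qed.

(** If continuity failed, bad points at distance less than 1 / (n + 1) from 0 would form a
    sequence tending to 0. *)
Lemma continuous0_seq (f : R -> R) :
  (forall t : nat -> R, t @ \oo --> (0 : R) -> (fun n => f (t n)) @ \oo --> f 0) ->
  {for 0, continuous f}.
Proof.
move=> H; apply/cvgrPdist_le => e e0.
apply: contrapT => nH.
have bad (n : nat) : exists t, `|t| < n.+1%:R^-1 /\ e < `|f 0 - f t|.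
  apply: contrapT => h; apply: nH; apply/nbhs_ballP; exists n.+1%:R^-1.
    by rewrite /= invr_gt0.
  move=> t; rewrite /ball /= sub0r normrN => tn.
  by rewrite leNgt; apply/negP => lt; apply: h; exists t.
have /choice[t ht] := bad.
have t0 : t @ \oo --> (0 : R).
  apply/cvgrPdist_lt => d d0; have /cvgrPdist_lt/(_ d d0) := @cvg_harmonic R.
  apply: filterS => n; rewrite !sub0r !normrN /= [X in X < d -> _]ger0_norm ?invr_ge0 //.
  by apply: lt_trans; have [] := ht n.
have /cvgrPdist_le/(_ e e0)[N _ /(_ N (leqnn N))] := H t t0.
by rewrite leNgt; have [_ ->] := ht N.
Qed.

Section Transform.
Variable u : R -> R.
Hypothesis iu : mu.-integrable setT (EFin \o u).

Let mu' : measurable_fun setT u.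
Proof. by have /integrableP[/measurable_EFinP] := iu. Qed.

Lemma integrable_mul_cos w : mu.-integrable setT (EFin \o (fun x => u x * cos (2 * pi * x * w))).
Proof.
apply: integrable_bounded_mul => //; last by move=> x; exact: cos_max.
by apply: measurable_scale_comp; exact: continuous_cos.
Qed.

Lemma integrable_mul_sin w : mu.-integrable setT (EFin \o (fun x => u x * sin (2 * pi * x * w))).
Proof.
apply: integrable_bounded_mul => //; last by move=> x; exact: sin_max.
by apply: measurable_scale_comp; exact: continuous_sin.
Qed.

Lemma continuous_osc (f : R -> R) : continuous f -> (forall x, `|f x| <= 1) ->
  continuous (fun w => \int[mu]_x (u x * f (2 * pi * x * w))).
Proof.
move=> cf f1 w.
have H := @continuity_under_integral R _ _ mu (fun w x => u x * f (2 * pi * x * w)) setT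
  measurableT (w - 1) (w + 1) _ _ (fun x => `|u x|) _ _.
apply: H.
- move=> l _; apply: integrable_bounded_mul => //.
  exact: measurable_scale_comp.
- apply: aeT => y _ l _; apply: cvgMl_tmp; exact: continuous_scale_comp.
- exact: integrable_norm iu.
- move=> l _; apply: aeT => y _; rewrite normrM -[leRHS]mulr1 ler_wpM2l //.
- by rewrite inE /= in_itv /=; apply/andP; split; lra.
Qed.

Lemma continuous_fcos : continuous (fcos u).
Proof. by apply: continuous_osc; [exact: continuous_cos|move=> x; exact: cos_max]. Qed.

Lemma continuous_fsin : continuous (fsin u).
Proof. by apply: continuous_osc; [exact: continuous_sin|move=> x; exact: sin_max]. Qed.

(** The integral of |u x u (x - t)| over the plane is the square of the L^1 norm of u. *)
Lemma autocorr_lty (f : R -> R -> R) : (forall x y, `|f x y| <= 1) ->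
  measurable_fun setT (fun z : R * R => f z.1 z.2) ->
  measurable_fun setT (fun z : R * R => u z.1 * u (z.1 - z.2) * f z.1 z.2) /\
  (\int[mu]_x \int[mu]_t `|(u x * u (x - t) * f x t)|%:E < +oo)%E.
Proof.
move=> f1 mf.
have m1 : measurable_fun setT (fun z : R * R => u z.1 * u (z.1 - z.2) * f z.1 z.2).
  apply: measurable_funM => //; apply: measurable_funM.
  - exact: measurable_fst_comp.
  - exact: measurable_diff_comp.
split => //.
have mau : measurable_fun setT (fun x => `|u x|%:E).
  by apply/measurable_EFinP; apply: measurableT_comp.
have /integrableP[_ K] := iu.
apply: (@le_lt_trans _ _ (\int[mu]_x (`|u x|%:E * \int[mu]_y `|u y|%:E))%E).
  have mabs : measurable_fun setT (fun z : R * R => `|(u z.1 * u (z.1 - z.2) * f z.1 z.2)|%:E).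
    by apply/measurable_EFinP; apply: measurableT_comp.
  apply: ge0_le_integral => //.
  - by move=> x _; exact: integral_ge0.
  - apply: (@measurable_fun_fubini_tonelli_F _ _ _ _ _ mu
      (fun z : R * R => `|(u z.1 * u (z.1 - z.2) * f z.1 z.2)|%:E)) => //.
  - by apply: emeasurable_funM => //; exact: measurable_cst.
  move=> x _.
  have -> : (\int[mu]_y `|u y|%:E = \int[mu]_t `|u (x - t)|%:E)%E.
    by rewrite (@integral_reflect R x (fun y => `|u y|%:E)).
  rewrite -ge0_integralZl_EFin //; last first.
    by apply: (measurableT_comp mau); exact: measurable_reflect.
  apply: ge0_le_integral => //.
  - apply/measurable_EFinP; apply: measurableT_comp => //.
    exact: (measurableT_comp m1 (pair1_measurable x)).
  - apply: measurable_funeM; apply: (measurableT_comp mau); exact: measurable_reflect.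
  - by move=> t _; rewrite -EFinM lee_fin !normrM -[leRHS]mulr1 ler_wpM2l // mulr_ge0.
rewrite ge0_integralZr //; last by exact: integral_ge0.
by apply: lte_mul_pinfty => //; [exact: integral_ge0|rewrite ge0_fin_numE ?integral_ge0].
Qed.

Lemma integrable_autocorr : mu.-integrable setT (EFin \o autocorr u).
Proof.
have [||m l] := @autocorr_lty (fun _ _ => 1).
- by move=> _ _; rewrite normr1.
- exact: measurable_cst.
have := integrable_fine (integrable_Fubini2 m l).
apply: eq_integrable => // t _ /=; congr ((fine _)%:E).
by apply: eq_integral => x _; rewrite mulr1.
Qed.

Hypothesis Lu : L2 (fun x => (u x)%:C).

Lemma integrable_autocorr_fun t : mu.-integrable setT (EFin \o (fun x => u x * u (x - t))).
Proof.
apply/Lfun1_integrable.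
have [l1 _] := Lu; have [l2 _] := L2_shift t Lu.
exact: Lfun2_mul_Lfun1 l1 l2.
Qed.

(** The Wiener-Khinchin identity: the square modulus of the transform of u is the
    transform of its autocorrelation.  Fubini, then the substitution t = x - y and the
    addition formula for the cosine. *)
Lemma fcos_fsin_autocorr w : fcos u w ^+ 2 + fsin u w ^+ 2 =
  \int[mu]_t (autocorr u t * cos (2 * pi * t * w)).
Proof.
have mcw : measurable_fun setT (fun x : R => cos (2 * pi * x * w)).
  by apply: measurable_scale_comp; exact: continuous_cos.
have [||m l] := @autocorr_lty (fun _ t => cos (2 * pi * t * w)).
- by move=> _ t; exact: cos_max.
- exact: (measurable_snd_comp mcw).
have := Rintegral_Fubini m l.
rewrite [X in _ = X](_ : _ = \int[mu]_t (autocorr u t * cos (2 * pi * t * w))); last first.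
  by apply: eq_Rintegral => t _; rewrite RintegralZr //; exact: integrable_autocorr_fun.
move=> <-.
have inner x : \int[mu]_t (u x * u (x - t) * cos (2 * pi * t * w)) =
    u x * cos (2 * pi * x * w) * fcos u w + u x * sin (2 * pi * x * w) * fsin u w.
  have e t : u x * u (x - t) * cos (2 * pi * t * w) =
      (fun y => u x * (cos (2 * pi * x * w) * (u y * cos (2 * pi * y * w)) +
                       sin (2 * pi * x * w) * (u y * sin (2 * pi * y * w)))) (x - t).
    rewrite -mulrA; congr (_ * _) => /=.
    have -> : 2 * pi * t * w = 2 * pi * x * w - 2 * pi * (x - t) * w by ring.
    by rewrite cosB; ring.
  under eq_Rintegral do rewrite e.
  rewrite (Rintegral_reflect x (f := fun y => u x * (cos (2 * pi * x * w) * (u y * cos (2 * pi * y * w)) +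
                       sin (2 * pi * x * w) * (u y * sin (2 * pi * y * w))))); last first.
    apply: measurable_funM; first exact: measurable_cst.
    apply: measurable_funD; apply: measurable_funM; try exact: measurable_cst;
      apply: measurable_funM => //.
    by apply: measurable_scale_comp; exact: continuous_sin.
  have i1 := integrable_mul_cos w; have i2 := integrable_mul_sin w.
  have j1 : mu.-integrable setT (EFin \o (fun y => cos (2 * pi * x * w) * (u y * cos (2 * pi * y * w)))).
    by have := integrableZl measurableT (cos (2 * pi * x * w)) i1; apply: eq_integrable.
  have j2 : mu.-integrable setT (EFin \o (fun y => sin (2 * pi * x * w) * (u y * sin (2 * pi * y * w)))).
    by have := integrableZl measurableT (sin (2 * pi * x * w)) i2; apply: eq_integrable.
  rewrite RintegralZl //; last by have := integrableD measurableT j1 j2; apply: eq_integrable.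
  rewrite RintegralD // (RintegralZl _ measurableT i1) (RintegralZl _ measurableT i2).
  by rewrite /fcos /fsin; ring.
under eq_Rintegral do rewrite inner.
have i1 := integrable_mul_cos w; have i2 := integrable_mul_sin w.
have j1 : mu.-integrable setT (EFin \o (fun x => u x * cos (2 * pi * x * w) * fcos u w)).
  by have := integrableZr measurableT (fcos u w) i1; apply: eq_integrable.
have j2 : mu.-integrable setT (EFin \o (fun x => u x * sin (2 * pi * x * w) * fsin u w)).
  by have := integrableZr measurableT (fsin u w) i2; apply: eq_integrable.
rewrite RintegralD // (RintegralZr _ measurableT i1) (RintegralZr _ measurableT i2).
by rewrite !expr2.
Qed.

(** Integrate [fcos_fsin_autocorr] against e^(- e |w|) and exchange the integrals; the
    inner one is the Poisson kernel. *)
Lemma weighted_plancherel e : 0 < e ->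
  (\int[mu]_w (expR (- (e * `|w|)) * (fcos u w ^+ 2 + fsin u w ^+ 2))%:E =
   (\int[mu]_t (autocorr u t * poisson e t))%:E)%E.
Proof.
move=> e0.
have ie := integrable_expabs e0.
have iA := integrable_autocorr.
have /integrableP[/measurable_EFinP mA lA] := iA.
have /integrableP[/measurable_EFinP mE lE] := ie.
pose F (w t : R) := expR (- (e * `|w|)) * (autocorr u t * cos (2 * pi * t * w)).
have mF : measurable_fun setT (fun z : R * R => F z.1 z.2).
  apply: measurable_funM; first exact: (measurable_fst_comp mE).
  apply: measurable_funM; first exact: (measurable_snd_comp mA).
  have mc := @measurable_cos_prod R 1.
  rewrite (_ : (fun z : R * R => _) = (fun z : R * R => cos (2 * pi * z.1 * z.2 * 1))) //.
  by apply/funext => z; rewrite mulr1 mulrAC.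
have mabs : measurable_fun setT (fun z : R * R => `|F z.1 z.2|%:E).
  by apply/measurable_EFinP; apply: measurableT_comp.
have FF : (\int[mu]_w \int[mu]_t `|F w t|%:E < +oo)%E.
  apply: (@le_lt_trans _ _ (\int[mu]_w ((expR (- (e * `|w|)))%:E * \int[mu]_t `|autocorr u t|%:E))%E).
    apply: ge0_le_integral => //.
    - by move=> x _; exact: integral_ge0.
    - exact: (@measurable_fun_fubini_tonelli_F _ _ _ _ _ mu (fun z : R * R => `|F z.1 z.2|%:E)).
    - apply: emeasurable_funM; last exact: measurable_cst.
      exact/measurable_EFinP.
    move=> w _; rewrite -ge0_integralZl_EFin ?expR_ge0 //; last first.
      by apply/measurable_EFinP; apply: measurableT_comp.
    apply: ge0_le_integral => //.
    - apply/measurable_EFinP; apply: measurableT_comp => //.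
      exact: (measurableT_comp mF (pair1_measurable w)).
    - by apply: measurable_funeM; apply/measurable_EFinP; apply: measurableT_comp.
    - move=> t _; rewrite -EFinM lee_fin /F !normrM ger0_norm ?expR_ge0 //.
      by rewrite ler_wpM2l ?expR_ge0 // -[leRHS]mulr1 ler_wpM2l // cos_max.
  rewrite ge0_integralZr //; [|exact/measurable_EFinP|exact: integral_ge0].
  apply: lte_mul_pinfty; [by apply: integral_ge0 => x _; rewrite lee_fin expR_ge0| |exact: lA].
  exact: (integrable_fin_num measurableT ie).
have inner w : \int[mu]_t F w t = expR (- (e * `|w|)) * (fcos u w ^+ 2 + fsin u w ^+ 2).
  rewrite /F RintegralZl // -?fcos_fsin_autocorr //.
  apply: integrable_bounded_mul => //; last by move=> x; exact: cos_max.
  by apply: measurable_scale_comp; exact: continuous_cos.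
have := Rintegral_Fubini mF FF.
have -> : \int[mu]_y \int[mu]_x F x y = \int[mu]_t (autocorr u t * poisson e t).
  apply: eq_Rintegral => t _; rewrite -Rintegral_expcos // -RintegralZl //.
    by apply: eq_Rintegral => w _; rewrite /F mulrCA.
  exact: integrable_expcos.
move=> <-; rewrite /Rintegral.
have iF := integrable_Fubini1 mF FF.
rewrite (integral_fine iF) fineK; last exact: (integrable_fin_num measurableT iF).
rewrite -(integral_fine iF).
by apply: eq_integral => w _; congr EFin; rewrite -inner.
Qed.

Lemma autocorr_ip t : autocorr u t = complex.Re (L2inner (fun x => (u x)%:C) (shift t (fun x => (u x)%:C))).
Proof.
rewrite /L2inner /cintegral /=; apply: eq_Rintegral => x _.
by rewrite mul0r subr0.
Qed.

Lemma autocorr_le t : `|autocorr u t| <= nrm (fun x => (u x)%:C) ^+ 2.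
Proof.
rewrite autocorr_ip (le_trans (Re_le_modulus _)) // (le_trans (cauchy_schwarz Lu (L2_shift t Lu))) //.
by rewrite nrm_shift ?expr2 //; exact: L2_cmeas.
Qed.

Lemma autocorr0 : autocorr u 0 = nrm (fun x => (u x)%:C) ^+ 2.
Proof.
rewrite autocorr_ip (_ : shift 0 _ = (fun x => (u x)%:C)) ?ip_self //.
by apply/funext => x; rewrite /shift subr0.
Qed.

(** By Cauchy-Schwarz this is the L^2 continuity of translation. *)
Lemma continuous_autocorr0 : {for 0, continuous (autocorr u)}.
Proof.
apply: continuous0_seq => t t0.
have c := shift_continuous_real Lu t0.
have c' : (fun n => nrm (fun x => (u x)%:C) * nrm (fun x => shift (t n) (fun x => (u x)%:C) x - (u x)%:C))
    @ \oo --> (0 : R).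
  by rewrite -[X in _ --> X](mulr0 (nrm (fun x => (u x)%:C))); apply: cvgMl_tmp.
apply/subr_cvg0.
have c'' : (fun n => - (nrm (fun x => (u x)%:C) * nrm (fun x => shift (t n) (fun x => (u x)%:C) x - (u x)%:C)))
    @ \oo --> (0 : R) by rewrite -[X in _ --> X]oppr0; exact: cvgN.
apply: (@squeeze_cvgr _ _ _ _ _ _ _ _ _ c'' c'); apply: nearW => n.
rewrite -ler_norml autocorr0.
have -> : nrm (fun x => (u x)%:C) ^+ 2 = complex.Re (L2inner (fun x => (u x)%:C) (fun x => (u x)%:C)).
  by rewrite ip_self.
have Ls := L2_shift (t n) Lu.
rewrite autocorr_ip -ReN -ReD -ipBr //.
by apply: (le_trans (Re_le_modulus _)); apply: cauchy_schwarz => //; exact: L2B.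
Qed.

(** Let e tend to 0 in [weighted_plancherel]: the left-hand side converges by monotone
    convergence, the right-hand side to autocorr u 0, which is the square norm of u. *)
Theorem real_plancherel :
  (\int[mu]_w (fcos u w ^+ 2 + fsin u w ^+ 2)%:E = (nrm (fun x => (u x)%:C) ^+ 2)%:E)%E.
Proof.
pose e n : R := n.+1%:R^-1.
have e0 n : 0 < e n by rewrite invr_gt0.
have mfc : measurable_fun setT (fcos u) by apply: continuous_measurable_fun; exact: continuous_fcos.
have mfs : measurable_fun setT (fsin u) by apply: continuous_measurable_fun; exact: continuous_fsin.
have mq : measurable_fun setT (fun w => fcos u w ^+ 2 + fsin u w ^+ 2).
  by apply: measurable_funD; apply: measurable_funX.
have q0 w : 0 <= fcos u w ^+ 2 + fsin u w ^+ 2 by rewrite addr_ge0 ?sqr_ge0.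
pose g n w := (expR (- (e n * `|w|)) * (fcos u w ^+ 2 + fsin u w ^+ 2))%:E.
have ecv : e @ \oo --> (0 : R) by exact: cvg_harmonic.
have gcv w : (fun n => g n w) @ \oo --> (fcos u w ^+ 2 + fsin u w ^+ 2)%:E.
  apply/fine_cvgP; split; first exact: nearW.
  have h : (fun n => expR (- (e n * `|w|))) @ \oo --> expR (- (0 * `|w|)).
    apply: (cvg_comp (fun n => - (e n * `|w|)) (@expR R)); last exact: continuous_expR.
    by apply: cvgN; apply: cvgMr_tmp.
  rewrite mul0r oppr0 expR0 in h.
  by rewrite -[X in _ --> X]mul1r; apply: cvgMr_tmp.
have := @cvg_monotone_convergence _ _ _ mu setT measurableT g _ _ _.
have mg n : measurable_fun setT (g n).
  by apply/measurable_EFinP; apply: measurable_funM => //; exact: measurable_expabs.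
move=> /(_ mg) H.
have {}H : (fun n => \int[mu]_w g n w)%E @ \oo -->
    (\int[mu]_w (fcos u w ^+ 2 + fsin u w ^+ 2)%:E)%E.
  rewrite [X in _ --> X](_ : _ = (\int[mu]_w limn (g ^~ w))%E); last first.
    by apply: eq_integral => w _; apply/esym/cvg_lim => //; exact: gcv.
  apply: H.
  - by move=> n x _; rewrite lee_fin mulr_ge0 ?expR_ge0.
  - move=> x _ m n mn; rewrite lee_fin ler_wpM2r // ler_expR lerN2 ler_wpM2r //.
    by rewrite lef_pV2 ?posrE // ler_nat.
have P : (fun n => \int[mu]_t (autocorr u t * poisson (e n) t)) @ \oo --> autocorr u 0.
  have /integrableP[/measurable_EFinP mA _] := integrable_autocorr.
  apply/cvgrPdist_le => eta eta0.
  have [d d0 hd] := poisson_approx mA autocorr_le continuous_autocorr0 eta0.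
  have /cvgrPdist_lt/(_ _ d0) := ecv; apply: filterS => n.
  rewrite sub0r normrN gtr0_norm // => en.
  by rewrite distrC; exact: hd.
have {}P : (fun n => \int[mu]_w g n w)%E @ \oo --> (autocorr u 0)%:E.
  rewrite (_ : (fun n => _) = (fun n => (\int[mu]_t (autocorr u t * poisson (e n) t))%:E)).
    by apply/fine_cvgP; split; [exact: nearW|exact: P].
  by apply/funext => n; rewrite -weighted_plancherel.
by rewrite -autocorr0 -(cvg_lim _ H) // -(cvg_lim _ P).
Qed.

End Transform.
End RealPlancherel.

Section ComplexPlancherel.
Context {R : realType}.
Local Notation mu := (@lebesgue_measure R).
Implicit Types f g h : R -> R[i].

Section L1L2.
Variable f : R -> R[i].
Hypotheses (f1 : L1 f) (f2 : L2 f).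

Let u x := Re (f x).
Let v x := Im (f x).
Let iu : mu.-integrable setT (EFin \o u). Proof. by have [] := (L1P f).1 f1. Qed.
Let iv : mu.-integrable setT (EFin \o v). Proof. by have [] := (L1P f).1 f1. Qed.
Let mfu : measurable_fun setT u. Proof. by have [] := L2_cmeas f2. Qed.
Let mfv : measurable_fun setT v. Proof. by have [] := L2_cmeas f2. Qed.

Let Lu : L2 (fun x => (u x)%:C).
Proof. by apply: (L2_le (cmeas_real mfu) f2 _).1 => x; rewrite modulus_real Re_le_modulus. Qed.
Let Lv : L2 (fun x => (v x)%:C).
Proof. by apply: (L2_le (cmeas_real mfv) f2 _).1 => x; rewrite modulus_real Im_le_modulus. Qed.

Lemma Re_fourierL1 w : Re (fourierL1 f w) = fcos u w + fsin v w.
Proof.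
have i1 := integrable_mul_cos iu w; have i2 := integrable_mul_sin iv w.
rewrite /fourierL1 /cintegral /fcos /fsin /= -RintegralD //.
by apply: eq_Rintegral => x _; rewrite ReM /= cosN sinN mulrN opprK.
Qed.

Lemma Im_fourierL1 w : Im (fourierL1 f w) = fcos v w - fsin u w.
Proof.
have i1 := integrable_mul_cos iv w; have i2 := integrable_mul_sin iu w.
rewrite /fourierL1 /cintegral /fcos /fsin /= -RintegralB //.
by apply: eq_Rintegral => x _; rewrite ImM /= cosN sinN mulrN addrC.
Qed.

Let cCu := continuous_fcos iu.
Let cSu := continuous_fsin iu.
Let cCv := continuous_fcos iv.
Let cSv := continuous_fsin iv.
Let mCu := continuous_measurable_fun cCu.
Let mSu := continuous_measurable_fun cSu.
Let mCv := continuous_measurable_fun cCv.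
Let mSv := continuous_measurable_fun cSv.

Lemma cmeas_fourierL1 : cmeas (fourierL1 f).
Proof.
split.
- under eq_fun do rewrite Re_fourierL1; exact: measurable_funD.
- under eq_fun do rewrite Im_fourierL1; exact: measurable_funB.
Qed.

Let integrable_sq (a : R -> R) : mu.-integrable setT (EFin \o a) -> L2 (fun x => (a x)%:C) ->
  mu.-integrable setT (EFin \o (fun w => fcos a w ^+ 2 + fsin a w ^+ 2)).
Proof.
move=> ia La; apply/integrableP; split.
  apply/measurable_EFinP; apply: measurable_funD; apply: measurable_funX;
    apply: continuous_measurable_fun; [exact: continuous_fcos|exact: continuous_fsin].
apply: le_lt_trans (ltry (nrm (fun x => (a x)%:C) ^+ 2)); rewrite -(real_plancherel ia La).
rewrite le_eqVlt; apply/orP; left; apply/eqP; apply: eq_integral => w _ /=.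
by rewrite ger0_norm // addr_ge0 ?sqr_ge0.
Qed.

Let cross w := fcos u w * fsin v w - fcos v w * fsin u w.

Let mcross : measurable_fun setT cross.
Proof. by apply: measurable_funB; apply: measurable_funM. Qed.

Let integrable_cross : mu.-integrable setT (EFin \o cross).
Proof.
have iS : mu.-integrable setT (fun w => ((fcos u w ^+ 2 + fsin u w ^+ 2) + (fcos v w ^+ 2 + fsin v w ^+ 2))%:E).
  by have := integrableD measurableT (integrable_sq iu Lu) (integrable_sq iv Lv); apply: eq_integrable.
apply: le_integrable iS => //; first exact/measurable_EFinP.
move=> w _; rewrite /= lee_fin /cross [leRHS]ger0_norm ?addr_ge0 ?sqr_ge0 //.
move: (fcos u w) (fsin u w) (fcos v w) (fsin v w) => a b c d.
have h1 := sqr_ge0 (a - d); have h2 := sqr_ge0 (a + d).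
have h3 := sqr_ge0 (c - b); have h4 := sqr_ge0 (c + b).
have [a2 b2] := (sqr_ge0 a, sqr_ge0 b); have [c2 d2] := (sqr_ge0 c, sqr_ge0 d).
by rewrite ler_norml; apply/andP; split; nra.
Qed.

Lemma fcosN (a : R -> R) w : fcos a (- w) = fcos a w.
Proof. by apply: eq_Rintegral => x _; rewrite mulrN cosN. Qed.

Lemma fsinN (a : R -> R) w : mu.-integrable setT (EFin \o a) -> fsin a (- w) = - fsin a w.
Proof.
move=> ia; have h := integrable_mul_sin ia w.
rewrite /fsin -[RHS]mulN1r -RintegralZl //.
by apply: eq_Rintegral => x _; rewrite mulrN sinN mulrN mulN1r.
Qed.

(** Besides the square moduli of the transforms of the real and imaginary parts u and v,
    the square modulus of the transform of f contains 2 (fcos u fsin v - fcos v fsin u).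
    This is an odd function, so its integral vanishes, and the complex identity follows
    from the real one. *)
Let Rintegral_cross : \int[mu]_w cross w = 0.
Proof.
have h : \int[mu]_w cross (0 - w) = - \int[mu]_w cross w.
  rewrite -[RHS]mulN1r -RintegralZl //; apply: eq_Rintegral => w _.
  by rewrite sub0r /cross !fcosN !fsinN // ; ring.
have := h; rewrite Rintegral_reflect // => e.
by lra.
Qed.

Lemma plancherelL1L2 : L2 (fourierL1 f) /\ nrm (fourierL1 f) = nrm f.
Proof.
have iqu := integrable_sq iu Lu; have iqv := integrable_sq iv Lv.
have E : energy (fourierL1 f) = (nrm f ^+ 2)%:E.
  have -> : energy (fourierL1 f) = (\int[mu]_w ((fcos u w ^+ 2 + fsin u w ^+ 2) +
      (fcos v w ^+ 2 + fsin v w ^+ 2) + 2 * cross w)%:E)%E.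
    apply: eq_integral => w _; congr EFin.
    by rewrite sqr_modulus Re_fourierL1 Im_fourierL1 /cross; ring.
  rewrite integralD_EFin //; last 2 first.
  - by have := integrableD measurableT iqu iqv; apply: eq_integrable.
  - by have := integrableZl measurableT 2 integrable_cross; apply: eq_integrable.
  rewrite integralD_EFin // !real_plancherel //.
  have -> : (\int[mu]_w (2 * cross w)%:E = 0)%E.
    rewrite -[LHS]fineK; last first.
      apply: integrable_fin_num => //.
      by have := integrableZl measurableT 2 integrable_cross; apply: eq_integrable.
    by rewrite -[fine _]/(\int[mu]_w (2 * cross w)) RintegralZl // Rintegral_cross mulr0.
  rewrite adde0 -!energy_nrm // /energy -ge0_integralD //.
  - apply: eq_integral => x _; rewrite -EFinD !sqr_modulus /= expr0n /= !addr0 //.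
  - by move=> x _; rewrite lee_fin sqr_ge0.
  - by apply: measurable_energy; exact: cmeas_real.
  - by move=> x _; rewrite lee_fin sqr_ge0.
  - by apply: measurable_energy; exact: cmeas_real.
have L : L2 (fourierL1 f).
  by apply/L2P; split; [exact: cmeas_fourierL1|rewrite E ltry].
split => //; apply/eqP; rewrite -(@eqrXn2 _ 2) ?nrm_ge0 //; apply/eqP.
by move: E; rewrite energy_nrm // => -[].
Qed.

End L1L2.

Lemma L1_mul_expi f w : L1 f -> L1 (fun x => f x * expi (- (2 * pi * x * w))).
Proof.
move=> /L1P[f1 f2]; apply/L1P.
split.
- have := integrableD measurableT (integrable_mul_cos f1 w) (integrable_mul_sin f2 w).
  by apply: eq_integrable => // x _ /=; rewrite ReM /= cosN sinN mulrN opprK EFinD.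
- have := integrableB measurableT (integrable_mul_cos f2 w) (integrable_mul_sin f1 w).
  by apply: eq_integrable => // x _ /=; rewrite ImM /= cosN sinN mulrN [in RHS]addrC EFinB.
Qed.

Lemma fourierL1D f g : L1 f -> L1 g ->
  fourierL1 (fun x => f x + g x) = fun w => fourierL1 f w + fourierL1 g w.
Proof.
move=> f1 g1; apply/funext => w; rewrite /fourierL1 -cintegralD; [|exact: L1_mul_expi..].
by congr cintegral; apply/funext => x; rewrite mulrDl.
Qed.

Lemma fourierL1Z c f : L1 f -> fourierL1 (fun x => c * f x) = fun w => c * fourierL1 f w.
Proof.
move=> f1; apply/funext => w; rewrite /fourierL1 -cintegralZ; last exact: L1_mul_expi.
by congr cintegral; apply/funext => x; rewrite mulrA.
Qed.

Lemma L1_cmeas f : L1 f -> cmeas f.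
Proof.
by move=> /L1P[/integrableP[/measurable_EFinP ? _] /integrableP[/measurable_EFinP ? _]].
Qed.

Lemma cmeas_expi (a : R) : cmeas (fun x => expi (a * x)).
Proof.
split => /=; apply: continuous_measurable_fun; apply: continuous_scale_comp.
- exact: continuous_cos.
- exact: continuous_sin.
Qed.

Lemma fourierL1_shift t f : L1 f ->
  fourierL1 (shift t f) = fun w => expi (- (2 * pi * t * w)) * fourierL1 f w.
Proof.
move=> f1; apply/funext => w; rewrite /fourierL1.
rewrite -cintegralZ; last exact: L1_mul_expi.
rewrite -[RHS](@cintegral_shift R t); last first.
  apply: cmeasM; first exact: cmeas_cst.
  by apply: L1_cmeas; exact: L1_mul_expi.
congr cintegral; apply/funext => x; rewrite /shift mulrCA -expiD; congr (_ * expi _).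
ring.
Qed.

End ComplexPlancherel.

(** * The Fourier transform on L^2 *)

Section L2Convergence.
Context {R : realType}.
Local Notation mu := (@lebesgue_measure R).
Implicit Types f g h : R -> R[i].

Lemma cvgL2_squeeze (u : nat -> R -> R[i]) f (a : nat -> R) :
  (forall n, nrm (fun x => u n x - f x) <= a n) -> a @ \oo --> (0 : R) -> cvgL2 u f.
Proof.
move=> h c; apply: (@squeeze_cvgr _ _ _ _ (fun=> 0) _ _ _ _ (cvg_cst _) c); apply: nearW => n.
by rewrite nrm_ge0 h.
Qed.

Lemma eq_cvgL2 (u v : nat -> R -> R[i]) f g :
  (forall n, nrm (fun x => u n x - f x) = nrm (fun x => v n x - g x)) ->
  cvgL2 u f -> cvgL2 v g.
Proof. by move=> /funext ->. Qed.

Lemma cvgL2D (u v : nat -> R -> R[i]) f g : (forall n, L2 (u n)) -> (forall n, L2 (v n)) ->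
  L2 f -> L2 g -> cvgL2 u f -> cvgL2 v g ->
  cvgL2 (fun n x => u n x + v n x) (fun x => f x + g x).
Proof.
move=> Lu Lv Lf Lg cu cv.
have c : (fun n => nrm (fun x => u n x - f x) + nrm (fun x => v n x - g x)) @ \oo --> (0 : R).
  by rewrite -[X in _ --> X](addr0 (0 : R)); exact: cvgD.
apply: (cvgL2_squeeze _ c) => n /=.
apply: le_trans (nrmD (L2B (Lu n) Lf) (L2B (Lv n) Lg)).
by rewrite le_eqVlt; apply/orP; left; apply/eqP/eq_nrm => x; congr modulus; ring.
Qed.

Lemma cvgL2_mulb (m : R -> R[i]) K (u : nat -> R -> R[i]) f : cmeas m ->
  (forall x, modulus (m x) <= K) -> (forall n, L2 (u n)) -> L2 f -> cvgL2 u f ->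
  cvgL2 (fun n x => m x * u n x) (fun x => m x * f x).
Proof.
move=> mm mK Lu Lf cu.
have c : (fun n => K * nrm (fun x => u n x - f x)) @ \oo --> (0 : R).
  by rewrite -[X in _ --> X](mulr0 K); apply: cvgMl_tmp.
apply: (cvgL2_squeeze _ c) => n.
apply: le_trans (L2_mulb mm mK (L2B (Lu n) Lf)).2.
by rewrite le_eqVlt; apply/orP; left; apply/eqP/eq_nrm => x; rewrite mulrBr.
Qed.

Lemma cvgL2Z c (u : nat -> R -> R[i]) f : (forall n, L2 (u n)) -> L2 f -> cvgL2 u f ->
  cvgL2 (fun n x => c * u n x) (fun x => c * f x).
Proof. by apply: (@cvgL2_mulb (fun=> c) (modulus c)) => //; exact: cmeas_cst. Qed.

Lemma cvgL2_shift t (u : nat -> R -> R[i]) f : (forall n, L2 (u n)) -> L2 f -> cvgL2 u f ->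
  cvgL2 (fun n => shift t (u n)) (shift t f).
Proof.
move=> Lu Lf cu; apply: (cvgL2_squeeze _ cu) => n.
rewrite (nrm_shift t (f := fun x => u n x - f x)) //.
exact: L2_cmeas (L2B (Lu n) Lf).
Qed.

Lemma ler_nrm_dist f g : L2 f -> L2 g -> `|nrm f - nrm g| <= nrm (fun x => f x - g x).
Proof.
move=> Lf Lg.
have h1 : nrm f <= nrm (fun x => f x - g x) + nrm g.
  have -> : nrm f = nrm (fun x => (f x - g x) + g x) by apply: eq_nrm => x; rewrite subrK.
  by apply: nrmD => //; exact: L2B.
have h2 : nrm g <= nrm (fun x => f x - g x) + nrm f.
  have -> : nrm g = nrm (fun x => (g x - f x) + f x) by apply: eq_nrm => x; rewrite subrK.
  by rewrite (nrm_distC f); apply: nrmD => //; exact: L2B.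
by rewrite ler_norml; apply/andP; split; lra.
Qed.

Lemma cvgL2_nrm (u : nat -> R -> R[i]) f : (forall n, L2 (u n)) -> L2 f -> cvgL2 u f ->
  (fun n => nrm (u n)) @ \oo --> nrm f.
Proof.
move=> Lu Lf /cvgL2P cu; apply/cvgrPdist_lt => e /cu; apply: filterS => n; apply: le_lt_trans.
by rewrite distrC; exact: ler_nrm_dist.
Qed.

Lemma cvgL2_cauchy (u : nat -> R -> R[i]) f : (forall n, L2 (u n)) -> L2 f -> cvgL2 u f ->
  L2cauchy u.
Proof.
move=> Lu Lf /cvgL2P cu e e0.
have [|N _ hN] := cu (e / 2); first by rewrite divr_gt0.
exists N => m n Nm Nn; apply: (le_lt_trans (nrm_dist_triangle (Lu m) Lf (Lu n))).
have := hN m Nm; have := hN n Nn; rewrite /= (nrm_distC f); lra.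
Qed.

Lemma cvgL2_triangle (u v : nat -> R -> R[i]) f : (forall n, L2 (u n)) ->
  (forall n, L2 (v n)) -> L2 f -> (fun n => nrm (fun x => u n x - v n x)) @ \oo --> (0 : R) ->
  cvgL2 v f -> cvgL2 u f.
Proof.
move=> Lu Lv Lf uv vf; have c : (fun n => nrm (fun x => u n x - v n x) + nrm (fun x => v n x - f x)) @ \oo --> (0 : R).
  by rewrite -[X in _ --> X](addr0 (0 : R)); exact: cvgD.
by apply: (cvgL2_squeeze _ c) => n; exact: nrm_dist_triangle.
Qed.

End L2Convergence.

Section FourierL2.
Context {R : realType}.
Local Notation mu := (@lebesgue_measure R).
Implicit Types f g h : R -> R[i].

(** The graph of the Fourier transform on L^2, for Borel representatives.  [fourierL2P]
    relates it to [fourierL2], which allows Lebesgue measurable ones. *)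
Definition FT f g : Prop := [/\ L2 f, L2 g &
  exists u : nat -> R -> R[i], [/\ forall n, L1 (u n) /\ L2 (u n), cvgL2 u f &
    cvgL2 (fun n => fourierL1 (u n)) g]].

Lemma FT_L2l f g : FT f g -> L2 f. Proof. by case. Qed.
Lemma FT_L2r f g : FT f g -> L2 g. Proof. by case. Qed.

Lemma fourierL2P f g :
  fourierL2 f g <-> exists2 g0, FT f g0 & {ae mu, forall w, g w = g0 w}.
Proof.
split.
  move=> [Lf [g0 [Lg0 gg0 [u [Lu uf ug]]]]]; exists g0 => //; split => //; exists u; split => //.
  - by apply/cvgL2_L2dist => // n; have [] := Lu n.
  - apply/cvgL2_L2dist => // n; have [u1 u2] := Lu n.
    exact: (plancherelL1L2 u1 u2).1.
move=> [g0 [Lf Lg0 [u [Lu uf ug]]] gg0]; split => //; exists g0; split => //; exists u; split => //.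
- by apply/cvgL2_L2dist => // n; have [] := Lu n.
- apply/cvgL2_L2dist => // n; have [u1 u2] := Lu n.
  exact: (plancherelL1L2 u1 u2).1.
Qed.

Lemma FT_isometry f g : FT f g -> nrm f = nrm g.
Proof.
move=> [Lf Lg [u [Lu uf ug]]].
have L n := (plancherelL1L2 (Lu n).1 (Lu n).2).1.
have c1 := cvgL2_nrm (fun n => (Lu n).2) Lf uf.
have c2 := cvgL2_nrm L Lg ug.
rewrite -(cvg_lim _ c1) // -(cvg_lim _ c2) //; congr (limn _); apply/funext => n.
by rewrite (plancherelL1L2 (Lu n).1 (Lu n).2).2.
Qed.

Lemma FT_L1L2 f : L1 f -> L2 f -> FT f (fourierL1 f).
Proof.
move=> f1 f2; have [Lg _] := plancherelL1L2 f1 f2; split => //.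
exists (fun=> f); split => //.
- by rewrite ae_eq_dist //; [exact: cvg_cst|exact: aeT].
- by rewrite ae_eq_dist //; [exact: cvg_cst|exact: aeT].
Qed.

Lemma FTD f g f' g' : FT f g -> FT f' g' -> FT (fun x => f x + f' x) (fun w => g w + g' w).
Proof.
move=> [Lf Lg [u [Lu uf ug]]] [Lf' Lg' [v [Lv vf vg]]]; split; [exact: L2D..|].
have Lu' n := (plancherelL1L2 (Lu n).1 (Lu n).2).1.
have Lv' n := (plancherelL1L2 (Lv n).1 (Lv n).2).1.
exists (fun n x => u n x + v n x); split.
- by move=> n; split; [exact: L1D (Lu n).1 (Lv n).1|exact: L2D (Lu n).2 (Lv n).2].
- exact: (cvgL2D (fun n => (Lu n).2) (fun n => (Lv n).2) Lf Lf' uf vf).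
- apply: eq_cvgL2 (cvgL2D Lu' Lv' Lg Lg' ug vg) => n.
  by rewrite (fourierL1D (Lu n).1 (Lv n).1).
Qed.

Lemma FTZ c f g : FT f g -> FT (fun x => c * f x) (fun w => c * g w).
Proof.
move=> [Lf Lg [u [Lu uf ug]]]; split; [exact: L2Z..|].
have Lu' n := (plancherelL1L2 (Lu n).1 (Lu n).2).1.
exists (fun n x => c * u n x); split.
- by move=> n; split; [exact: L1Z (Lu n).1|exact: L2Z (Lu n).2].
- exact: (cvgL2Z c (fun n => (Lu n).2) Lf uf).
- by apply: eq_cvgL2 (cvgL2Z c Lu' Lg ug) => n; rewrite (fourierL1Z c (Lu n).1).
Qed.

Lemma FTB f g f' g' : FT f g -> FT f' g' -> FT (fun x => f x - f' x) (fun w => g w - g' w).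
Proof.
move=> F F'; have := FTD F (FTZ (-1) F').
by congr FT; apply/funext => x; rewrite mulN1r.
Qed.

Lemma FT_uniq f g g' : FT f g -> FT f g' -> {ae mu, forall w, g w = g' w}.
Proof.
move=> F F'; apply: dist_eq0_ae; [exact: FT_L2r F|exact: FT_L2r F'|].
rewrite -(FT_isometry (FTB F F')) -[RHS](nrm0 (R := R)); apply: eq_nrm => x.
by rewrite subrr.
Qed.

Lemma FT_ip f g f' g' : FT f g -> FT f' g' -> L2inner f f' = L2inner g g'.
Proof.
move=> F F'; apply: polarization;
  [exact: FT_L2l F|exact: FT_L2l F'|exact: FT_L2r F|exact: FT_L2r F'|..].
- exact: FT_isometry.
- exact: FT_isometry.
- by move=> c; apply: FT_isometry; apply: FTD => //; exact: FTZ.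
Qed.

(** A diagonal sequence. *)
Lemma FT_closed (f_ g_ : nat -> R -> R[i]) f g : (forall n, FT (f_ n) (g_ n)) ->
  L2 f -> L2 g -> cvgL2 f_ f -> cvgL2 g_ g -> FT f g.
Proof.
move=> F Lf Lg cf cg; split => //.
have /choice[u hu] : forall n : nat, exists u, [/\ L1 u, L2 u,
    nrm (fun x => u x - f_ n x) < n.+1%:R^-1 & nrm (fun x => fourierL1 u x - g_ n x) < n.+1%:R^-1].
  move=> n; have [_ _ [v [Lv vf vg]]] := F n.
  have n0 : 0 < n.+1%:R^-1 :> R by rewrite invr_gt0.
  have /cvgL2P/(_ _ n0)[N _ hN] := vf; have /cvgL2P/(_ _ n0)[M _ hM] := vg.
  exists (v (maxn N M)); have [v1 v2] := Lv (maxn N M); split => //.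
  - by apply: hN; rewrite /= leq_maxl.
  - by apply: hM; rewrite /= leq_maxr.
have h0 : (fun n => n.+1%:R^-1) @ \oo --> (0 : R) by exact: cvg_harmonic.
exists u; split.
- by move=> n; have [] := hu n.
- apply: (@cvgL2_triangle _ u f_) => //.
  + by move=> n; have [] := hu n.
  + by move=> n; exact: FT_L2l (F n).
  + apply: (@squeeze_cvgr _ _ _ _ (fun=> 0) _ _ _ _ (cvg_cst _) h0); apply: nearW => n.
    by rewrite nrm_ge0 /= ltW //; have [] := hu n.
- apply: (@cvgL2_triangle _ _ g_) => //.
  + by move=> n; have [u1 u2 _ _] := hu n; exact: (plancherelL1L2 u1 u2).1.
  + by move=> n; exact: FT_L2r (F n).
  + apply: (@squeeze_cvgr _ _ _ _ (fun=> 0) _ _ _ _ (cvg_cst _) h0); apply: nearW => n.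
    by rewrite nrm_ge0 /= ltW //; have [] := hu n.
Qed.

(** By isometry the transforms form a Cauchy sequence, and its limit is the transform of f
    because the graph is closed.  [FT_liml] is the same argument for the inverse. *)
Lemma FT_limr (f_ g_ : nat -> R -> R[i]) f : (forall n, FT (f_ n) (g_ n)) ->
  L2 f -> cvgL2 f_ f -> exists2 g, FT f g & cvgL2 g_ g.
Proof.
move=> F Lf cf.
have Lf_ n := FT_L2l (F n); have Lg_ n := FT_L2r (F n).
have [|g Lg cg] := @L2_complete _ g_ Lg_.
  move=> e e0; have [N hN] := cvgL2_cauchy Lf_ Lf cf e0; exists N => m n Nm Nn.
  by rewrite -(FT_isometry (FTB (F m) (F n))); exact: hN.
by exists g => //; exact: FT_closed F Lf Lg cf cg.
Qed.

Lemma FT_liml (f_ g_ : nat -> R -> R[i]) g : (forall n, FT (f_ n) (g_ n)) ->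
  L2 g -> cvgL2 g_ g -> exists2 f, FT f g & cvgL2 f_ f.
Proof.
move=> F Lg cg.
have Lf_ n := FT_L2l (F n); have Lg_ n := FT_L2r (F n).
have [|f Lf cf] := @L2_complete _ f_ Lf_.
  move=> e e0; have [N hN] := cvgL2_cauchy Lg_ Lg cg e0; exists N => m n Nm Nn.
  by rewrite (FT_isometry (FTB (F m) (F n))); exact: hN.
by exists f => //; exact: FT_closed F Lf Lg cf cg.
Qed.

(** The truncations of f to [-n, n] lie in L^1 and in L^2. *)
Lemma FT_total f : L2 f -> exists g, FT f g.
Proof.
move=> Lf.
pose I (n : nat) := `[- n%:R, n%:R]%classic : set R.
pose u n x := (\1_(I n) x)%:C * f x.
have mI n : cmeas (fun x => (\1_(I n) x)%:C : R[i]).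
  by apply: cmeas_real; apply: measurable_indic; exact: measurable_itv.
have I1 n x : modulus ((\1_(I n) x)%:C : R[i]) <= 1.
  by rewrite modulus_real indicE; case: (_ \in _); rewrite ?normr1 ?normr0.
have Lu n : L2 (u n) by exact: (L2_mulb (mI n) (I1 n) Lf).1.
have u1 n : L1 (u n).
  have := L2_mul_L1 Lf (L2_indic_itv (- n%:R) n%:R); congr L1; apply/funext => x.
  by rewrite conjc_real mulrC.
have cu : cvgL2 u f.
  have c : cvgL2 u (fun x => 1 * f x).
    apply: (@L2_multiplier_cvg R _ (fun=> 1) 1) => //.
    move=> x; apply: (@cvg_modulus_real _ (fun n => \1_(I n) x) 1).
    have [N hN] : exists N : nat, `|x| <= N%:R.
      by exists (Num.truncn `|x|).+1; apply/ltW; rewrite truncnS_gt.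
    apply: cvg_near_cst; exists N => // m /= Nm; rewrite indicE mem_set // /I /=.
    by rewrite in_itv /= -ler_norml (le_trans hN) // ler_nat.
  by rewrite (_ : f = fun x => 1 * f x) //; apply/funext => x; rewrite mul1r.
by have [g Fg _] := FT_limr (fun n => FT_L1L2 (u1 n) (Lu n)) Lf cu; exists g.
Qed.

Lemma FT0 : FT (fun=> 0) (fun=> 0 : R[i]).
Proof.
have [g Fg] := FT_total (@L2_cst0 R).
by have := FTZ 0 Fg; congr FT; apply/funext => x; rewrite mul0r.
Qed.

Lemma cmeas_modulation (t : R) : cmeas (fun w => expi (- (2 * pi * t * w))).
Proof.
rewrite (_ : (fun w => _) = (fun w => expi (- (2 * pi * t) * w))); first exact: cmeas_expi.
by apply/funext => w; rewrite mulNr.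
Qed.

Lemma FT_shift t f g : FT f g -> FT (shift t f) (fun w => expi (- (2 * pi * t * w)) * g w).
Proof.
move=> [Lf Lg [u [Lu uf ug]]].
have Lu' n := (plancherelL1L2 (Lu n).1 (Lu n).2).1.
have m1 w : modulus (expi (- (2 * pi * t * w)) : R[i]) <= 1 by rewrite modulus_expi.
have mm := cmeas_modulation t.
split; [exact: L2_shift|exact: (L2_mulb mm m1 Lg).1|].
exists (fun n => shift t (u n)); split.
- by move=> n; split; [exact: L1_shift (Lu n).1|exact: L2_shift (Lu n).2].
- exact: (cvgL2_shift t (fun n => (Lu n).2) Lf uf).
- by apply: eq_cvgL2 (cvgL2_mulb mm m1 Lu' Lg ug) => n; rewrite (fourierL1_shift t (Lu n).1).
Qed.

Lemma FT_ae f g g' : FT f g -> cmeas g' -> {ae mu, forall w, g w = g' w} -> FT f g'.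
Proof.
move=> [Lf Lg [u [Lu uf ug]]] mg' gg'.
have Lg' := ae_eq_L2 Lg mg' gg'; split => //; exists u; split => //.
have Lu' n := (plancherelL1L2 (Lu n).1 (Lu n).2).1.
apply: eq_cvgL2 ug => n; apply: ae_eq_nrm; [exact: L2_cmeas (L2B _ _)|exact: L2_cmeas (L2B _ _)|].
by move: gg'; apply: aeS => x ->.
Qed.

End FourierL2.

(** * Shift-invariant spaces *)

Section ShiftSpaces.
Context {R : realType}.
Implicit Types f g h : R -> R[i].

Lemma big_count_mem (V : nmodType) (I : eqType) (r r1 : seq I) (F : I -> V) :
  uniq r -> {subset r1 <= r} ->
  \sum_(k <- r) F k *+ count_mem k r1 = \sum_(k <- r1) F k.
Proof.
move=> ur; elim: r1 => [|x r1 ih] sub.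
  by rewrite big_nil; apply: big1 => k _; rewrite mulr0n.
rewrite big_cons -ih; last by move=> y yr; apply: sub; rewrite inE yr orbT.
under eq_bigr do rewrite /= mulrnDr.
rewrite big_split /=; congr (_ + _).
rewrite (bigD1_seq x) //=; last by apply: sub; rewrite inE eqxx.
rewrite eqxx mulr1n big1 ?addr0 // => k /negbTE kx.
by rewrite eq_sym kx mulr0n.
Qed.

Lemma translateE f (k : int) : translate f k = shift k%:~R f.
Proof. by []. Qed.

Lemma span_translate f k : translate_span f (translate f k).
Proof.
by exists [:: k], (fun=> 1); apply/funext => x; rewrite big_seq1 mul1r.
Qed.

Lemma span0 f : translate_span f (fun=> 0).
Proof. by exists [::], (fun=> 0); apply/funext => x; rewrite big_nil. Qed.

(** Index lists may have repetitions, which count with multiplicity in a sum; the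
    coefficients over the merged list make up for this. *)
Lemma spanD f g h : translate_span f g -> translate_span f h ->
  translate_span f (fun x => g x + h x).
Proof.
move=> [r1 [c1 ->]] [r2 [c2 ->]].
pose r := undup (r1 ++ r2).
exists r, (fun k => c1 k *+ count_mem k r1 + c2 k *+ count_mem k r2).
apply/funext => x; under [RHS]eq_bigr do rewrite mulrDl !mulrnAl.
rewrite big_split /= !big_count_mem ?undup_uniq // => k kr; rewrite /r mem_undup mem_cat kr ?orbT //.
Qed.

Lemma spanZ f g c : translate_span f g -> translate_span f (fun x => c * g x).
Proof.
move=> [r [c1 ->]]; exists r, (fun k => c * c1 k).
by apply/funext => x; rewrite mulr_sumr; apply: eq_bigr => k _; rewrite mulrA.
Qed.

Lemma span_shift f g (k : int) : translate_span f g -> translate_span f (translate g k).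
Proof.
move=> [r [c ->]]; exists [seq j + k | j <- r], (fun j => c (j - k)).
apply/funext => x; rewrite big_map; apply: eq_bigr => j _.
rewrite addrK /translate; congr (_ * f _).
by rewrite intrD opprD addrA addrAC.
Qed.

Lemma L2_translate f k : L2 f -> L2 (translate f k).
Proof. exact: L2_shift. Qed.

Lemma nrm_translate f k : L2 f -> nrm (translate f k) = nrm f.
Proof. by move=> Lf; rewrite translateE nrm_shift //; exact: L2_cmeas. Qed.

Lemma span_L2 f g : L2 f -> translate_span f g -> L2 g.
Proof.
move=> Lf [r [c ->]]; apply: L2_sum => k; apply: L2Z; exact: L2_translate.
Qed.

Lemma shift_spaceP f g : L2 f -> shift_space f g <->
  L2 g /\ forall e, 0 < e -> exists2 h, translate_span f h & nrm (fun x => g x - h x) < e.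
Proof.
move=> Lf; split=> -[Lg H]; split => // e e0; have [h hh hd] := H e e0; exists h => //.
- by move: hd; rewrite L2dist_nrm // ?lte_fin //; exact: span_L2 hh.
- by rewrite L2dist_nrm // ?lte_fin //; exact: span_L2 hh.
Qed.

Lemma shift_space_L2 f g : shift_space f g -> L2 g. Proof. by case. Qed.

Lemma span_shift_space f g : L2 f -> translate_span f g -> shift_space f g.
Proof.
move=> Lf sg; have Lg := span_L2 Lf sg; apply/shift_spaceP => //; split => // e e0.
by exists g => //; rewrite ae_eq_dist //; exact: aeT.
Qed.

Lemma shift_space_translate f k : L2 f -> shift_space f (translate f k).
Proof. by move=> Lf; apply: span_shift_space => //; exact: span_translate. Qed.

Lemma shift_space_id f : L2 f -> shift_space f f.
Proof.
move=> Lf; have := shift_space_translate 0 Lf; congr shift_space.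
by apply/funext => x; rewrite /translate subr0.
Qed.

Lemma shift_space0 f : L2 f -> shift_space f (fun=> 0).
Proof. by move=> Lf; apply: span_shift_space => //; exact: span0. Qed.

Lemma shift_spaceD f g h : L2 f -> shift_space f g -> shift_space f h ->
  shift_space f (fun x => g x + h x).
Proof.
move=> Lf /(shift_spaceP _ Lf)[Lg Hg] /(shift_spaceP _ Lf)[Lh Hh].
apply/shift_spaceP => //; split; first exact: L2D.
move=> e e0; have e2 : 0 < e / 2 by rewrite divr_gt0.
have [g' sg dg] := Hg _ e2; have [h' sh dh] := Hh _ e2.
exists (fun x => g' x + h' x); first exact: spanD.
have Lg' := span_L2 Lf sg; have Lh' := span_L2 Lf sh.
have := nrmD (L2B Lg Lg') (L2B Lh Lh').
rewrite (_ : nrm _ = nrm (fun x => g x + h x - (g' x + h' x))); first lra.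
by apply: eq_nrm => x; congr modulus; ring.
Qed.

Lemma shift_spaceZ f g c : L2 f -> shift_space f g -> shift_space f (fun x => c * g x).
Proof.
move=> Lf /(shift_spaceP _ Lf)[Lg Hg]; apply/shift_spaceP => //; split; first exact: L2Z.
move=> e e0; have c1 : 0 < modulus c + 1 by rewrite ltr_pwDr ?modulus_ge0.
have [g' sg dg] := Hg (e / (modulus c + 1)) (divr_gt0 e0 c1).
exists (fun x => c * g' x); first exact: spanZ.
have -> : nrm (fun x => c * g x - c * g' x) = nrm (fun x => c * (g x - g' x)).
  by apply: eq_nrm => x; rewrite mulrBr.
rewrite nrmZ; last by apply: L2B => //; exact: span_L2 sg.
move: dg; rewrite ltr_pdivlMr //; apply: le_lt_trans.
by rewrite mulrC ler_wpM2l ?nrm_ge0 // lerDl.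
Qed.

Lemma shift_spaceB f g h : L2 f -> shift_space f g -> shift_space f h ->
  shift_space f (fun x => g x - h x).
Proof.
move=> Lf Sg Sh; have := shift_spaceD Lf Sg (shift_spaceZ (-1) Lf Sh).
by congr shift_space; apply/funext => x; rewrite mulN1r.
Qed.

Lemma shift_space_shift f g k : L2 f -> shift_space f g -> shift_space f (translate g k).
Proof.
move=> Lf /(shift_spaceP _ Lf)[Lg Hg]; apply/shift_spaceP => //; split; first exact: L2_translate.
move=> e e0; have [g' sg dg] := Hg e e0.
exists (translate g' k); first exact: span_shift.
have := nrm_translate k (L2B Lg (span_L2 Lf sg)); rewrite /translate => ->.
exact: dg.
Qed.

Lemma shift_space_closed f g : L2 f -> L2 g ->
  (forall e, 0 < e -> exists2 h, shift_space f h & nrm (fun x => g x - h x) < e) ->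
  shift_space f g.
Proof.
move=> Lf Lg H; apply/shift_spaceP => //; split => // e e0.
have e2 : 0 < e / 2 by rewrite divr_gt0.
have [h /(shift_spaceP _ Lf)[Lh Hh] dh] := H _ e2.
have [h' sh dh'] := Hh _ e2; exists h' => //.
have := nrm_dist_triangle Lg Lh (span_L2 Lf sh); lra.
Qed.

Lemma shift_space_lim f (u : nat -> R -> R[i]) g : L2 f -> L2 g ->
  (forall n, shift_space f (u n)) -> cvgL2 u g -> shift_space f g.
Proof.
move=> Lf Lg Su /cvgL2P cu; apply: shift_space_closed => // e e0.
have [N _ hN] := cu e e0; exists (u N) => //.
by rewrite nrm_distC; apply: hN => /=.
Qed.

Lemma shift_space_ae f g h : L2 f -> shift_space f g -> L2 h ->
  {ae lebesgue_measure, forall x, g x = h x} -> shift_space f h.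
Proof.
move=> Lf Sg Lh gh; have Lg := shift_space_L2 Sg.
apply: shift_space_closed => // e e0; exists g => //.
by rewrite nrm_distC ae_eq_dist.
Qed.

Lemma shift_space_sum f I (r : seq I) (c : I -> R[i]) (F : I -> R -> R[i]) : L2 f ->
  (forall i, shift_space f (F i)) -> shift_space f (fun x => \sum_(i <- r) c i * F i x).
Proof.
move=> Lf SF; elim: r => [|i r ih].
  by under eq_fun do rewrite big_nil; exact: shift_space0.
by under eq_fun do rewrite big_cons; apply: shift_spaceD => //; exact: shift_spaceZ.
Qed.

Lemma shift_space_sub f g : L2 f -> shift_space f g -> shift_space g `<=` shift_space f.
Proof.
move=> Lf Sg h; have Lg := shift_space_L2 Sg.
move=> /(shift_spaceP _ Lg)[Lh Hh]; apply: shift_space_closed => // e e0.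
have [h' [r [c ->]] dh] := Hh e e0; eexists; last exact: dh.
by apply: shift_space_sum => // k; exact: shift_space_shift.
Qed.

End ShiftSpaces.

(** * Periodic multipliers *)

Section Multipliers.
Context {R : realType}.
Implicit Types (f g h m : R -> R[i]).

(** Bounded functions m such that multiplication by m on the Fourier side maps every S(f)
    into itself. *)
Definition multiplier m : Prop := [/\ cmeas m, exists K, forall w, modulus (m w) <= K &
  forall f fhat, FT f fhat -> exists2 g, shift_space f g & FT g (fun w => m w * fhat w)].

Lemma multiplier_expi (k : int) : multiplier (fun w => expi (- (2 * pi * k%:~R * w))).
Proof.
split; first exact: cmeas_modulation.
  by exists 1 => w; rewrite modulus_expi.
move=> f fhat F; exists (translate f k); last exact: FT_shift.
by apply: shift_space_translate; exact: FT_L2l F.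
Qed.

Lemma multiplier_cst (c : R[i]) : multiplier (fun=> c).
Proof.
split; first exact: cmeas_cst.
  by exists (modulus c).
move=> f fhat F; exists (fun x => c * f x); last exact: FTZ.
have Lf := FT_L2l F; apply: shift_spaceZ => //; exact: shift_space_id.
Qed.

Lemma multiplierD m n : multiplier m -> multiplier n -> multiplier (fun w => m w + n w).
Proof.
move=> [mm [K mK] Hm] [mn [K' nK] Hn]; split; first exact: cmeasD.
  by exists (K + K') => w; rewrite (le_trans (modulusD _ _)) // lerD.
move=> f fhat F; have [g Sg Fg] := Hm _ _ F; have [g' Sg' Fg'] := Hn _ _ F.
have Lf := FT_L2l F; exists (fun x => g x + g' x); first exact: shift_spaceD.
by have := FTD Fg Fg'; congr FT; apply/funext => w; rewrite mulrDl.
Qed.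

(** If g in S(f) has transform n f^ and g' in S(g) has transform m n f^, then g' lies in
    S(f). *)
Lemma multiplierM m n : multiplier m -> multiplier n -> multiplier (fun w => m w * n w).
Proof.
move=> [mm [K mK] Hm] [mn [K' nK] Hn]; split; first exact: cmeasM.
  by exists (K * K') => w; rewrite modulusM ler_pM ?modulus_ge0.
move=> f fhat F; have [g Sg Fg] := Hn _ _ F; have [g' Sg' Fg'] := Hm _ _ Fg.
exists g'; first by apply: shift_space_sub Sg' => //; exact: FT_L2l F.
by move: Fg'; congr FT; apply/funext => w; rewrite mulrA.
Qed.

Lemma multiplierZ c m : multiplier m -> multiplier (fun w => c * m w).
Proof. by move=> Hm; apply: multiplierM => //; exact: multiplier_cst. Qed.

Lemma multiplierX m n : multiplier m -> multiplier (fun w => m w ^+ n).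
Proof.
move=> Hm; elim: n => [|n ih].
  by under eq_fun do rewrite expr0; exact: multiplier_cst.
by under eq_fun do rewrite exprS; exact: multiplierM.
Qed.

(** Bounded pointwise limits give L^2 limits on the Fourier side, and S(f) is closed. *)
Lemma multiplier_lim (m_ : nat -> R -> R[i]) m K : (forall n, multiplier (m_ n)) ->
  (forall n w, modulus (m_ n w) <= K) ->
  (forall w, (fun n => modulus (m_ n w - m w)) @ \oo --> (0 : R)) -> cmeas m ->
  multiplier m.
Proof.
move=> Hm mK cm mm.
have mmn n : cmeas (m_ n) by have [] := Hm n.
have bm w : modulus (m w) <= K + 1.
  have /cvgrPdist_le/(_ 1 ltr01)[N _ /(_ N (leqnn N))] := cm w.
  rewrite sub0r normrN ger0_norm ?modulus_ge0 // => h.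
  have := modulusB (m_ N w) (m_ N w - m w); rewrite opprB addrC subrK => h2.
  by rewrite (le_trans h2) // lerD.
split => //; first by exists (K + 1).
move=> f fhat F; have Lf := FT_L2l F; have Lfh := FT_L2r F.
have /choice[g hg] : forall n, exists g, shift_space f g /\ FT g (fun w => m_ n w * fhat w).
  by move=> n; have [_ _ H] := Hm n; have [g Sg Fg] := H _ _ F; exists g.
have cv := L2_multiplier_cvg mmn mm Lfh mK cm.
have Lm : L2 (fun w => m w * fhat w) by exact: (L2_mulb mm bm Lfh).1.
have [g0 Fg0 cg0] := FT_liml (fun n => (hg n).2) Lm cv.
exists g0 => //; apply: (shift_space_lim Lf _ _ cg0); first exact: FT_L2l Fg0.
by move=> n; have [] := hg n.
Qed.

Lemma multiplier_cos (b : R) : multiplier (fun w => (cos (2 * pi * w - b))%:C).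
Proof.
have h1 := multiplierZ (expi b / 2) (multiplier_expi 1).
have h2 := multiplierZ (expi (- b) / 2) (multiplier_expi (-1)).
have := multiplierD h1 h2; congr multiplier; apply/funext => w.
have n2 : (2 : R[i]) != 0 by rewrite pnatr_eq0.
rewrite mulrAC -expiD [X in _ + X]mulrAC -expiD -mulrDl.
apply: (mulIf n2); rewrite mulfVK // !mulr1 mulrN1 mulNr opprK.
rewrite (_ : b - 2 * pi * w = - (2 * pi * w - b)); last by ring.
rewrite (_ : - b + 2 * pi * w = 2 * pi * w - b); last by ring.
apply: complex_eq; rewrite ?ReD ?ImD ?ReM ?ImM /= ?cosN ?sinN; ring.
Qed.

Lemma bernoulli_lower (y : R) k : 0 <= y <= 1 -> 1 - k%:R * y <= (1 - y) ^+ k.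
Proof.
move=> /andP[y0 y1]; elim: k => [|k ih]; first by rewrite mul0r subr0 expr0.
have y1' : 0 <= 1 - y by lra.
rewrite exprS; apply: le_trans (ler_wpM2l y1' ih); rewrite -natr1.
have : 0 <= k%:R * y * y by rewrite !mulr_ge0.
lra.
Qed.

(** Both sides of Bernoulli's inequality decide the limit in [threshold_cvg]: (1 - y)^k lies
    between 1 - k y and 1 / (1 + k y). *)
Lemma bernoulli_upper (y : R) k : 0 <= y <= 1 -> (1 - y) ^+ k * (1 + k%:R * y) <= 1.
Proof.
move=> /andP[y0 y1]; elim: k => [|k ih]; first by rewrite mul0r addr0 expr0 mul1r.
have y1' : 0 <= (1 - y) ^+ k by rewrite exprn_ge0 //; lra.
apply: le_trans ih; rewrite exprSr -mulrA ler_wpM2l // -natr1.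
have : 0 <= k%:R * y * y by rewrite !mulr_ge0.
have : 0 <= y * y by rewrite mulr_ge0.
lra.
Qed.

Lemma cvg_natmul_expr (r : R) : 0 <= r < 1 -> (fun n => n%:R * r ^+ n) @ \oo --> (0 : R).
Proof.
move=> /andP[r0 r1]; pose s := Num.sqrt r.
have s0 : 0 <= s by exact: sqrtr_ge0.
have s1 : s < 1 by rewrite -sqrtr1 ltr_sqrt.
have rE : r = s ^+ 2 by rewrite sqr_sqrtr.
have b n : 0 <= n%:R * r ^+ n <= (1 - s)^-1 * s ^+ n.
  apply/andP; split; first by rewrite mulr_ge0 ?exprn_ge0.
  rewrite rE -exprM mul2n -addnn exprD mulrA ler_wpM2r ?exprn_ge0 //.
  have := @bernoulli_upper (1 - s) n.
  rewrite (_ : 1 - (1 - s) = s); last by ring.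
  have h : 0 <= 1 - s <= 1 by apply/andP; split; lra.
  move=> /(_ h) h2; rewrite -[leRHS]mul1r ler_pdivlMr ?subr_gt0 //.
  have : 0 <= s ^+ n by exact: exprn_ge0.
  nra.
have g : (fun n => (1 - s)^-1 * s ^+ n) @ \oo --> (0 : R).
  by apply: (@cvg_geometric R (1 - s)^-1 s); rewrite ger0_norm.
apply: (@squeeze_cvgr _ _ _ _ (fun=> 0) _ _ _ _ (cvg_cst _) g); exact: nearW.
Qed.

(** The polynomials (1 - x^n)^(n 2^n) tend to the indicator of x < 1/2, since the product
    n 2^n x^n tends to 0 for x < 1/2 and to infinity otherwise. *)
Lemma threshold_cvg (x : R) : 0 <= x <= 1 ->
  (fun n => (1 - x ^+ n) ^+ (n * 2 ^ n)) @ \oo --> ((x < 2^-1)%R%:R : R).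
Proof.
move=> /andP[x0 x1].
have xn n : 0 <= x ^+ n <= 1 by rewrite exprn_ge0 //= exprn_ile1.
have E n : (n * 2 ^ n)%:R * x ^+ n = n%:R * (2 * x) ^+ n :> R.
  by rewrite natrM natrX exprMn mulrA.
case: ltP => xh.
  have g : (fun n => 1 - n%:R * (2 * x) ^+ n) @ \oo --> (1 - 0 : R).
    apply: cvgB; first exact: cvg_cst.
    by apply: cvg_natmul_expr; apply/andP; split; lra.
  rewrite subr0 in g.
  apply: (squeeze_cvgr _ g (cvg_cst _)); apply: nearW => n.
  rewrite -E bernoulli_lower //= exprn_ile1 //; have /andP[a b] := xn n; lra.
have g : (fun n => n.+1%:R^-1) @ \oo --> (0 : R) by exact: cvg_harmonic.
apply: (squeeze_cvgr _ (cvg_cst _) g); apply: nearW => n.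
have /andP[a b] := xn n.
rewrite exprn_ge0 ?subr_ge0 //= -[leRHS]mul1r ler_pdivlMr //.
apply: le_trans (bernoulli_upper (n * 2 ^ n) (xn n)).
rewrite ler_wpM2l ?exprn_ge0 ?subr_ge0 // E -natr1 addrC lerD2l.
rewrite -[leLHS]mulr1 ler_wpM2l // exprn_ege1 //; lra.
Qed.

Definition indic (B : set R) : R -> R[i] := fun w => (\1_B w)%:C.
Arguments indic : simpl never.

Lemma indicT B w : B w -> indic B w = 1.
Proof. by move=> Bw; rewrite /indic indicE mem_set. Qed.

Lemma indicF B w : ~ B w -> indic B w = 0.
Proof. by move=> Bw; rewrite /indic indicE memNset. Qed.

Lemma indic_le1 B w : modulus (indic B w) <= 1.
Proof.
have [h|h] := pselect (B w); first by rewrite indicT // -[1]/((1 : R)%:C) modulus_real normr1.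
by rewrite indicF // modulus0.
Qed.

Lemma cmeas_indic B : measurable B -> cmeas (indic B).
Proof. by move=> mB; apply: cmeas_real; exact: measurable_indic. Qed.

Lemma cmeas_indic_measurable B : cmeas (indic B) -> measurable B.
Proof.
move=> [m _]; have := m measurableT [set` `[2^-1, +oo[] (measurable_itv _).
rewrite setTI; congr measurable; apply/seteqP; split => w /=; rewrite in_itv /= andbT.
- have [//|h] := pselect (B w); rewrite indicE memNset // mulr0n => ?; lra.
- by move=> Bw; rewrite indicE mem_set // mulr1n; lra.
Qed.

Lemma multiplier_lt_half (x : R -> R) : (forall w, 0 <= x w <= 1) ->
  multiplier (fun w => (x w)%:C) -> multiplier (indic [set w | x w < 2^-1]).
Proof.
move=> x01 Hx; have [[mx _] _ _] := Hx.
have mB : measurable [set w | x w < 2^-1].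
  have := mx measurableT [set` `]-oo, 2^-1[] (measurable_itv _).
  by rewrite setTI; congr measurable; apply/seteqP; split => w /=; rewrite in_itv.
pose m_ n w : R[i] := ((1 - x w ^+ n) ^+ (n * 2 ^ n))%:C.
apply: (@multiplier_lim m_ _ 1); last exact: cmeas_indic.
- move=> n; have := multiplierX (n * 2 ^ n) (multiplierD (multiplier_cst 1) (multiplierZ (-1) (multiplierX n Hx))).
  by congr multiplier; apply/funext => w; rewrite /m_ !(rmorphXn, rmorphB, rmorph1) mulN1r.
- move=> n w; rewrite modulus_real; have /andP[a b] := x01 w.
  have a1 : 0 <= x w ^+ n by exact: exprn_ge0.
  have b1 : x w ^+ n <= 1 by exact: exprn_ile1.
  by rewrite ger0_norm ?exprn_ge0 ?exprn_ile1 //; lra.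
- move=> w; have := threshold_cvg (x01 w); rewrite /m_ /indic.
  rewrite (_ : (x w < 2^-1)%R%:R = \1_[set w | x w < 2^-1] w :> R).
    exact: cvg_modulus_real.
  rewrite indicE; congr ((nat_of_bool _)%:R); apply/idP/idP => h; first exact: mem_set.
  by move/set_mem: h.
Qed.

Lemma multiplier_indicC B : multiplier (indic B) -> multiplier (indic (~` B)).
Proof.
move=> HB; have := multiplierD (multiplier_cst 1) (multiplierZ (-1) HB).
congr multiplier; apply/funext => w; rewrite mulN1r.
have [h|h] := pselect (B w).
- by rewrite indicT // indicF ?subrr // => /(_ h).
- by rewrite indicF // indicT // subr0.
Qed.

Lemma multiplier_indicI B C : multiplier (indic B) -> multiplier (indic C) ->
  multiplier (indic (B `&` C)).
Proof.
move=> HB HC; have := multiplierM HB HC; congr multiplier; apply/funext => w.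
have [b|b] := pselect (B w); last by rewrite indicF // mul0r indicF // => -[].
have [c|c] := pselect (C w); last by rewrite (indicF c) // mulr0 indicF // => -[].
by rewrite !indicT // mulr1.
Qed.

Lemma multiplier_bigcup (B : (set R)^nat) : nondecreasing_seq B ->
  (forall n, multiplier (indic (B n))) -> multiplier (indic (\bigcup_n B n)).
Proof.
move=> ndB HB.
have mB n : measurable (B n) by apply: cmeas_indic_measurable; have [] := HB n.
apply: (@multiplier_lim (fun n => indic (B n)) _ 1) => //.
- by move=> n w; exact: indic_le1.
- move=> w; apply: cvg_near_cst.
  have [[n _ Bw]|nB] := pselect ((\bigcup_n B n) w).
    exists n => // m /= nm; rewrite !indicT ?subrr ?modulus0 //; first by exists n.
    by have /subsetPset := ndB _ _ nm; apply.
  apply: nearW => n; rewrite !indicF ?subrr ?modulus0 // => Bw; apply: nB; exists n => //.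
- by apply: cmeas_indic; exact: bigcup_measurable.
Qed.

Definition frac (w : R) : R := w - (Num.floor w)%:~R.

Lemma frac_itv w : 0 <= frac w < 1.
Proof.
rewrite /frac subr_ge0 floor_le /= ltrBlDl.
by have := floorD1_gt w; rewrite intrD.
Qed.

Lemma cos_frac (w b : R) : cos (2 * pi * w - b) = cos (2 * pi * frac w - b).
Proof.
have key (n : nat) (y : R) : cos (y + 2 * pi * n%:R) = cos y.
  elim: n => [|n ih]; first by rewrite mulr0 addr0.
  have -> : y + 2 * pi * n.+1%:R = y + 2 * pi * n%:R + pi *+ 2.
    by rewrite -natr1 -mulr_natl; ring.
  by rewrite cosD2pi.
rewrite /frac; case: (Num.floor w) => n.
  rewrite -(key n (2 * pi * (w - _) - b)); congr cos; rewrite -pmulrn; ring.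
rewrite -(key n.+1 (2 * pi * w - b)); congr cos; rewrite NegzE intrN -pmulrn; ring.
Qed.

(** For 0 <= b < 1 the condition frac w <= b says that w is within b/2 of b/2 modulo 1, that
    is, cos (2 pi w - pi b) >= cos (pi b).  The function x rescales this threshold to 1/2. *)
Lemma multiplier_ray (b : R) : multiplier (indic [set w | frac w <= b]).
Proof.
have [b0|b0] := ltP b 0.
  have := multiplier_cst 0; congr multiplier; apply/funext => w; rewrite indicF //=.
  by have /andP[h _] := frac_itv w => h2; lra.
have [b1|b1] := leP 1 b.
  have := multiplier_cst 1; congr multiplier; apply/funext => w; rewrite indicT //=.
  by have /andP[_ h] := frac_itv w; lra.
pose x w := 2^-1 + (cos (2 * pi * w - pi * b) - cos (pi * b)) / 4 : R.
have x01 w : 0 <= x w <= 1.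
  rewrite /x; have h1 := cos_geN1 (2 * pi * w - pi * b); have h2 := cos_le1 (2 * pi * w - pi * b).
  have h3 := cos_geN1 (pi * b); have h4 := cos_le1 (pi * b).
  by apply/andP; split; lra.
have Hx : multiplier (fun w => (x w)%:C).
  have := multiplierD (multiplier_cst (2^-1 - cos (pi * b) / 4)%:C)
     (multiplierZ (4^-1)%:C (multiplier_cos (pi * b))).
  congr multiplier; apply/funext => w; rewrite -rmorphM -rmorphD; congr (_%:C).
  by rewrite /x; ring.
have := multiplier_indicC (multiplier_lt_half x01 Hx); congr (multiplier (indic _)).
have p0 : 0 < pi :> R := pi_gt0 R.
have pb0 : 0 <= pi * b by rewrite mulr_ge0 // ltW.
have pb1 : pi * b < pi by rewrite -[ltRHS]mulr1 ltr_pM2l.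
apply/seteqP; split => w /=; rewrite /x cos_frac; have /andP[f0 f1] := frac_itv w;
  move: (frac w) f0 f1 => t t0 t1.
- move=> h; rewrite leNgt; apply/negP => bt; apply: h.
  suff : cos (2 * pi * t - pi * b) < cos (pi * b) by move=> ?; lra.
  have pbt : pi * b < pi * t by rewrite ltr_pM2l.
  have pt1 : pi * t < pi by rewrite -[ltRHS]mulr1 ltr_pM2l.
  have [th|th] := leP (2 * pi * t - pi * b) pi.
    by rewrite ltr_cos ?in_itv /=; [lra|apply/andP; split; lra|apply/andP; split; lra].
  have -> : cos (2 * pi * t - pi * b) = cos (2 * pi * (1 - t) + pi * b).
    rewrite -cosN -(cosD2pi (- _)); congr cos; rewrite -mulr_natl; ring.
  by rewrite ltr_cos ?in_itv /=; [lra|apply/andP; split; lra|apply/andP; split; lra].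
- move=> tb; apply/negP; rewrite -leNgt.
  suff : cos (pi * b) <= cos (2 * pi * t - pi * b) by move=> ?; lra.
  rewrite -(cos_norm (2 * pi * t - pi * b)).
  have ptb : pi * t <= pi * b by rewrite ler_pM2l.
  have pt0 : 0 <= pi * t by rewrite mulr_ge0 // ltW.
  have nb : `|2 * pi * t - pi * b| <= pi * b by rewrite ler_norml; apply/andP; split; lra.
  rewrite leNgt ltr_cos ?in_itv /= -?leNgt //; apply/andP; split => //; lra.
Qed.

Definition periodic (B : set R) := forall w (k : int), B w -> B (w + k%:~R).

(** The sets A for which the indicator of the periodic extension of A `&` [0, 1[ is a
    multiplier form a sigma-algebra, and it contains the rays. *)
Theorem multiplier_periodic (B : set R) : measurable B -> periodic B ->
  multiplier (indic B).
Proof.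
move=> mB perB.
pose D : set (set R) := [set A | multiplier (indic [set w | A (frac w)])].
suff DB : D B.
  have := DB; congr (multiplier (indic _)); apply/seteqP; split => w /=.
  - by move=> /(perB _ (Num.floor w)); rewrite /frac subrK.
  - by move=> /(perB _ (- Num.floor w)); rewrite intrN.
have DC A : D A -> D (~` A) by exact: multiplier_indicC.
have DI A C : D A -> D C -> D (A `&` C) by exact: multiplier_indicI.
have sD : sigma_algebra setT D.
  apply/sigma_algebraP => //; split.
  - by have := multiplier_cst 1; congr multiplier; apply/funext => w; rewrite indicT.
  - by move=> A C AC DA DC'; rewrite setDE; apply: DI => //; exact: DC.
  - move=> F ndF DF; have := @multiplier_bigcup (fun n => [set w | F n (frac w)]).
    move=> H; rewrite /D /=.
    have -> : [set w | (\bigcup_k F k) (frac w)] = \bigcup_k [set w | F k (frac w)] by [].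
    apply: H => // n m nm; apply/subsetPset => w /=; by have /subsetPset := ndF _ _ nm; apply.
  - exact: DI.
move: B mB {perB}; apply: smallest_sub => //.
move=> X [[a b] _ <-] /=.
have -> : [set` `]a, b]] = [set w | w <= b] `&` ~` [set w | w <= a] :> set R.
  apply/seteqP; split => w /=; rewrite in_itv /=.
  - by move=> /andP[h1 h2]; split => //; apply/negP; rewrite -ltNge.
  - by move=> [h1 /negP]; rewrite -ltNge h1 => ->.
by apply: DI; [exact: multiplier_ray|apply: DC; exact: multiplier_ray].
Qed.

End Multipliers.

(** * Continuous representatives *)

Section Representatives.
Context {R : realType}.
Local Notation mu := (@lebesgue_measure R).
Implicit Types (f g h : R -> R[i]).

(** A neighbourhood has positive measure.  This is what makes almost everywhere equal
    continuous functions equal ([ccont_ae_eq]). *)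
Lemma ae_near (P : R -> Prop) (x : R) (Q : R -> Prop) : {ae mu, forall y, P y} ->
  (\forall y \near x, Q y) -> exists2 y, P y & Q y.
Proof.
move=> [N [mN N0 PN]] /nbhs_ballP[r /= r0 hr]; apply: contrapT => H.
pose I := `]x - r, x + r[%classic : set R.
have sub : I `<=` N.
  move=> y; rewrite /I /= in_itv /= => /andP[h1 h2]; apply: PN => /= Py; apply: H; exists y => //.
  by apply: hr; rewrite /ball /= ltr_norml; apply/andP; split; lra.
have : (mu I <= mu N)%E.
  by apply: le_measure => //; rewrite inE //; exact: measurable_itv.
rewrite N0 /I lebesgue_measure_itv /= lte_fin ifT; last by lra.
by rewrite -EFinB lee_fin; lra.
Qed.

Lemma ccont_cmeas f : ccontinuous f -> cmeas f.
Proof. by move=> [c1 c2]; split; exact: continuous_measurable_fun. Qed.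

Lemma ccontD f g : ccontinuous f -> ccontinuous g -> ccontinuous (fun x => f x + g x).
Proof.
move=> [f1 f2] [g1 g2]; split.
- by under eq_fun do rewrite ReD; move=> x; apply: cvgD; [exact: f1|exact: g1].
- by under eq_fun do rewrite ImD; move=> x; apply: cvgD; [exact: f2|exact: g2].
Qed.

Lemma ccontZ c f : ccontinuous f -> ccontinuous (fun x => c * f x).
Proof.
move=> [f1 f2]; split.
- under eq_fun do rewrite ReM; move=> x; apply: cvgB; apply: cvgMl_tmp; [exact: f1|exact: f2].
- under eq_fun do rewrite ImM; move=> x; apply: cvgD; apply: cvgMl_tmp; [exact: f2|exact: f1].
Qed.

Lemma ccontB f g : ccontinuous f -> ccontinuous g -> ccontinuous (fun x => f x - g x).
Proof.
move=> cf cg; have := ccontD cf (ccontZ (-1) cg); congr ccontinuous.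
by apply/funext => x; rewrite mulN1r.
Qed.

Lemma ccont0 : ccontinuous (fun=> 0 : R[i]).
Proof. by split => x; exact: cvg_cst. Qed.

Lemma ccont_sum I (r : seq I) (c : I -> R[i]) (F : I -> R -> R[i]) :
  (forall i, ccontinuous (F i)) -> ccontinuous (fun x => \sum_(i <- r) c i * F i x).
Proof.
move=> cF; elim: r => [|i r ih]; first by under eq_fun do rewrite big_nil; exact: ccont0.
by under eq_fun do rewrite big_cons; apply: ccontD => //; exact: ccontZ.
Qed.

Lemma ccont_shift t f : ccontinuous f -> ccontinuous (shift t f).
Proof.
have key (u : R -> R) : continuous u -> continuous (fun x : R => u (x - t)).
  move=> cu x; apply: (@continuous_comp R^o R^o R^o (fun x => x - t) u x); last exact: cu.
  have c : y - t @[y --> x] --> x - t.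
    by apply: (@cvgB _ _ _ _ _ id (fun=> t)); [exact: cvg_id|exact: cvg_cst].
  exact: c.
by move=> [c1 c2]; split; [exact: (key _ c1)|exact: (key _ c2)].
Qed.

Lemma ccont_modulus f : ccontinuous f -> continuous (fun x => modulus (f x)).
Proof.
move=> [c1 c2] x.
have -> : (fun x => modulus (f x)) = (fun x => Num.sqrt (Re (f x) ^+ 2 + Im (f x) ^+ 2)).
  by apply/funext => y; case: (f y).
apply: (@continuous_comp R^o R^o R^o (fun x => Re (f x) ^+ 2 + Im (f x) ^+ 2) (@Num.sqrt R) x);
  last exact: sqrt_continuous.
have sq (u : R -> R) : continuous u -> {for x, continuous (fun y => u y ^+ 2)}.
  move=> cu; rewrite (_ : (fun y => u y ^+ 2) = (fun y => u y * u y)).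
    by apply: cvgM; exact: cu.
  by apply/funext => y; rewrite expr2.
by apply: cvgD; exact: sq.
Qed.

Lemma ccont_ae_eq f g : ccontinuous f -> ccontinuous g -> {ae mu, forall x, f x = g x} -> f = g.
Proof.
move=> cf cg fg; apply/funext => x; apply/eqP; rewrite -subr_eq0; apply/eqP/modulus_eq0/eqP.
rewrite eq_le modulus_ge0 andbT leNgt; apply/negP => h.
have cm : continuous (fun x => modulus (f x - g x)) by apply: ccont_modulus; exact: ccontB.
have /cvgrPdist_lt/(_ _ h) := cm x.
move=> /(ae_near fg)[y -> ]; rewrite subrr modulus0 subr0.
by rewrite gtr0_norm // ltxx.
Qed.

Lemma nrm_ball_lower h (x r d : R) : L2 h -> 0 < r -> 0 <= d ->
  (forall y, `|y - x| < r -> d <= modulus (h y)) -> d ^+ 2 * (2 * r) <= nrm h ^+ 2.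
Proof.
move=> Lh r0 d0 hd; rewrite -lee_fin -energy_nrm //.
pose I := `]x - r, x + r[%classic : set R.
have mI : measurable I by exact: measurable_itv.
have -> : (d ^+ 2 * (2 * r))%:E = (\int[mu]_y (d ^+ 2 * \1_I y)%:E)%E.
  under eq_integral do rewrite EFinM.
  rewrite ge0_integralZl_EFin ?sqr_ge0 //; last by apply/measurable_EFinP; exact: measurable_indic.
  rewrite integral_indic // setIT /= lebesgue_measure_itv /= lte_fin ifT; last by lra.
  by rewrite -EFinB -EFinM; congr EFin; ring.
apply: ge0_le_integral => //.
- by move=> y _; rewrite lee_fin mulr_ge0 ?sqr_ge0 // indicE.
- by apply/measurable_EFinP; apply: measurable_funM; [exact: measurable_cst|exact: measurable_indic].
- by apply: measurable_energy; exact: L2_cmeas.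
move=> y _; rewrite lee_fin; have [Iy|nIy] := pselect (I y); last first.
  by rewrite indicE memNset // mulr0 sqr_ge0.
rewrite indicE mem_set // mulr1 ler_sqr ?nnegrE ?modulus_ge0 //; apply: hd.
by move: Iy; rewrite /I /= in_itv /= => /andP[a b]; rewrite ltr_norml; apply/andP; split; lra.
Qed.

End Representatives.

(** * Boundedness of point evaluations *)

Section Baire.
Context {R : realType}.
Local Notation mu := (@lebesgue_measure R).
Implicit Types (f g h : R -> R[i]) (W : set (R -> R[i])).

Definition L2ball W f r : set (R -> R[i]) := [set g | W g /\ nrm (fun x => g x - f x) <= r].

(** Baire's theorem in a closed subset W of L^2: if no A n contained a ball, nested balls of
    radii at most 2^-n, the ball of index n + 1 missing A n, would shrink to a point of W outside
    every A n. *)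
Theorem L2_baire W (A : nat -> set (R -> R[i])) : W `<=` L2 -> W !=set0 ->
  (forall u g, (forall n, W (u n)) -> L2 g -> cvgL2 u g -> W g) ->
  (forall n f, W f -> ~ A n f -> exists2 r, 0 < r & forall g, L2ball W f r g -> ~ A n g) ->
  (forall f, W f -> exists n, A n f) ->
  exists n f r, [/\ W f, 0 < r & L2ball W f r `<=` A n].
Proof.
move=> WL2 [f0 Wf0] Wcl Acl cov; apply: contrapT => H.
pose valid (s : (R -> R[i]) * R) := W s.1 /\ 0 < s.2.
pose next n (s s' : (R -> R[i]) * R) := [/\ valid s', s'.2 <= s.2 / 2,
  nrm (fun x => s'.1 x - s.1 x) <= s.2 / 2 & forall g, L2ball W s'.1 s'.2 g -> ~ A n g].
have step (p : nat * ((R -> R[i]) * R)) : exists s', valid p.2 -> next p.1 p.2 s'.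
  case: p => n [f r]; have [[/= Wf r0]|nv] := pselect (valid (f, r)); last by exists (f, r) => /nv.
  have r2 : 0 < r / 2 by rewrite divr_gt0.
  have : ~ (L2ball W f (r / 2) `<=` A n) by move=> h; apply: H; exists n, f, (r / 2).
  move=> /existsNP[g /not_implyP[[Wg gf] nAg]].
  have [d d0 hd] := Acl n g Wg nAg.
  exists (g, Num.min d (r / 2)) => _; split => //=.
  - by split => //=; rewrite lt_min d0.
  - by rewrite ge_min lexx orbT.
  - move=> k [Wk kg]; apply: hd; split => //; apply: le_trans kg _.
    by rewrite ge_min lexx.
have /choice[F hF] := step.
pose s := fix s n := match n with O => (f0, 1) | S m => F (m, s m) end.
have vs n : valid (s n).
  by elim: n => [|n ih] /=; [split => //=|have [] := hF (n, s n) ih].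
have ns n : next n (s n) (s n.+1) by exact: (hF (n, s n) (vs n)).
have Ls n : L2 (s n).1 by apply: WL2; have [] := vs n.
have rs n : 0 < (s n).2 by have [] := vs n.
have dec n k : nrm (fun x => (s (n + k)%N).1 x - (s n).1 x) + (s (n + k)%N).2 <= (s n).2.
  elim: k => [|k ih].
    by rewrite addn0 ae_eq_dist ?add0r //; exact: aeT.
  rewrite addnS; have [_ h1 h2 _] := ns (n + k)%N.
  have h3 := nrm_dist_triangle (Ls (n + k).+1) (Ls (n + k)%N) (Ls n).
  lra.
have r2 n : (s n).2 <= 2^-1 ^+ n.
  elim: n => [|n ih]; first by rewrite expr0.
  have [_ h1 _ _] := ns n; rewrite exprS; lra.
have cau : L2cauchy (fun n => (s n).1).
  move=> e e0.
  have /cvgrPdist_lt/(_ (e / 2))[|N _ /(_ N (leqnn N))] : (fun n => 2^-1 ^+ n) @ \oo --> (0 : R).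
    have := @cvg_geometric R 1 2^-1; rewrite /geometric /=.
    under eq_fun do rewrite mul1r; apply.
    by rewrite ger0_norm // invf_lt1 // ltr1n.
  - by rewrite divr_gt0.
  rewrite sub0r normrN ger0_norm ?exprn_ge0 // => hN.
  exists N => m n Nm Nn.
  have h1 := dec N (m - N)%N; have h2 := dec N (n - N)%N.
  rewrite !subnKC // in h1 h2.
  have h3 := nrm_dist_triangle (Ls m) (Ls N) (Ls n).
  rewrite (nrm_distC (s N).1) in h3.
  have := r2 N; have := rs m; have := rs n; lra.
have [g Lg cg] := L2_complete Ls cau.
have Wg : W g by apply: Wcl cg => // n; have [] := vs n.
have [n An] := cov g Wg.
have [_ _ _ nA] := ns n; apply: (nA g) An; split => //.
apply/ler_addgt0Pl => e e0.
have /cvgL2P/(_ _ e0)[N _ hN] := cg.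
have := hN (n.+1 + N)%N; rewrite /= leq_addl => /(_ isT) h1.
have h2 := dec n.+1 N; have := rs (n.+1 + N)%N.
have := nrm_dist_triangle Lg (Ls (n.+1 + N)%N) (Ls n.+1).
rewrite (nrm_distC g (s (n.+1 + N)%N).1); lra.
Qed.

End Baire.

Section Evaluation.
Context {R : realType}.
Local Notation mu := (@lebesgue_measure R).
Implicit Types (f g h : R -> R[i]) (W : set (R -> R[i])).

(** f0 is a continuous representative of the class of f. *)
Definition crep f0 f := ccontinuous f0 /\ {ae mu, forall x, f0 x = f x}.

Lemma crep_uniq f f0 f1 : crep f0 f -> crep f1 f -> f0 = f1.
Proof.
move=> [c0 e0] [c1 e1]; apply: ccont_ae_eq => //.
by move: e0 e1; apply: aeS2 => x -> ->.
Qed.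

Lemma crep_self f : ccontinuous f -> crep f f.
Proof. by move=> cf; split => //; exact: aeT. Qed.

Lemma crepD f f0 g g0 : crep f0 f -> crep g0 g -> crep (fun x => f0 x + g0 x) (fun x => f x + g x).
Proof.
move=> [c e] [c' e']; split; first exact: ccontD.
by move: e e'; apply: aeS2 => x -> ->.
Qed.

Lemma crepB f f0 g g0 : crep f0 f -> crep g0 g -> crep (fun x => f0 x - g0 x) (fun x => f x - g x).
Proof.
move=> [c e] [c' e']; split; first exact: ccontB.
by move: e e'; apply: aeS2 => x -> ->.
Qed.

Lemma crepZ c f f0 : crep f0 f -> crep (fun x => c * f0 x) (fun x => c * f x).
Proof.
move=> [cf e]; split; first exact: ccontZ.
by move: e; apply: aeS => x ->.
Qed.

Lemma ae_shift (P : R -> Prop) (t : R) : {ae mu, forall x, P x} -> {ae mu, forall x, P (x - t)}.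
Proof.
move=> [N [mN N0 PN]]; exists ((fun x => x - t) @^-1` N); split.
- by rewrite -[X in measurable X]setTI; apply: measurable_shift.
- have e : (fun x => x - t) @^-1` N = (fun x => 0 - x) @^-1` ((fun x => (- t) - x) @^-1` N).
    by apply/seteqP; split => x /=; rewrite sub0r opprK addrC.
  rewrite e lebesgue_measure_reflect ?lebesgue_measure_reflect //.
  rewrite -[X in measurable X]setTI; exact: measurable_reflect.
- by move=> x /= h; apply: PN.
Qed.

Lemma crep_shift t f f0 : crep f0 f -> crep (shift t f0) (shift t f).
Proof. by move=> [c e]; split; [exact: ccont_shift|exact: (ae_shift t e)]. Qed.

Lemma crep_L2 f f0 : L2 f -> crep f0 f -> L2 f0.
Proof.
move=> Lf [c e]; apply: ae_eq_L2 Lf (ccont_cmeas c) _.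
by move: e; apply: aeS => x ->.
Qed.

Lemma crep_nrm f f0 : L2 f -> crep f0 f -> nrm f0 = nrm f.
Proof.
by move=> Lf [c e]; apply: ae_eq_nrm => //; [exact: ccont_cmeas|exact: L2_cmeas].
Qed.

Section Bound.
Variable W : set (R -> R[i]).
Hypothesis WL2 : W `<=` L2.
Hypothesis W0 : W (fun=> 0).
Hypothesis WD : forall f g, W f -> W g -> W (fun x => f x + g x).
Hypothesis WZ : forall c f, W f -> W (fun x => c * f x).
Hypothesis Wcl : forall u g, (forall n, W (u n)) -> L2 g -> cvgL2 u g -> W g.
Hypothesis Wshift : forall f (k : int), W f -> W (translate f k).
Hypothesis Wcrep : forall f, W f -> exists f0, crep f0 f.

Let A (n : nat) : set (R -> R[i]) := [set f | forall f0, crep f0 f ->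
  forall x, `|x| < 1 -> modulus (f0 x) <= n%:R].

Let A_cov f : W f -> exists n, A n f.
Proof.
move=> Wf; have [f0 rf] := Wcrep Wf; have [cf _] := rf.
have cm : continuous (fun x => modulus (f0 x)) by exact: ccont_modulus.
have m11 : (-1 : R) <= 1 by lra.
have [c _ hc] := EVT_max m11 (@continuous_subspaceT _ _ (`[-1, 1]%classic : set R) _ cm).
exists (Num.truncn (modulus (f0 c))).+1 => f1 r1 x x1.
rewrite (crep_uniq r1 rf); apply: le_trans (hc x _) _.
  by move: x1; rewrite ltr_norml in_itv /= => /andP[a b]; apply/andP; split; lra.
by apply/ltW; rewrite truncnS_gt.
Qed.

(** If |f0 x| > n, then functions g whose representatives are at most n on ]-1, 1[ differ
    from f by at least d on a neighbourhood of x, which bounds the distance from f from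
    below. *)
Let A_closed n f : W f -> ~ A n f ->
  exists2 r, 0 < r & forall g, L2ball W f r g -> ~ A n g.
Proof.
move=> Wf; move=> /existsNP[f0 /not_implyP[rf /existsNP[x /not_implyP[x1 /negP]]]].
rewrite -ltNge => nf.
have Lf := WL2 Wf; have [cf _] := rf.
pose d := (modulus (f0 x) - n%:R) / 2; have d0 : 0 < d by rewrite divr_gt0 // subr_gt0.
have n1 : \forall y \near x, `|y| < 1.
  have /cvgrPdist_lt := @norm_continuous R R^o x.
  have e0 : 0 < 1 - `|x| by rewrite subr_gt0.
  move=> /(_ _ e0); apply: filterS => y; rewrite ltr_norml => /andP[h _]; lra.
have cm : continuous (fun x => modulus (f0 x)) by exact: ccont_modulus.
have /cvgrPdist_lt/(_ _ d0) n2 := cm x.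
have n12 : \forall y \near x, `|y| < 1 /\ `|modulus (f0 x) - modulus (f0 y)| < d.
  by near=> y; split; near: y.
have /nbhs_ballP[r /= r0 hr] := n12.
exists (Num.sqrt (d ^+ 2 * r)); first by rewrite sqrtr_gt0 mulr_gt0 // exprn_gt0.
move=> g [Wg dg] Ag; have [g0 rg] := Wcrep Wg; have Lg := WL2 Wg.
have rgf := crepB rg rf; have Lgf := crep_L2 (L2B Lg Lf) rgf.
have := @nrm_ball_lower R _ x r d Lgf r0 (ltW d0).
rewrite (crep_nrm (L2B Lg Lf) rgf) => H.
have {}H : d ^+ 2 * (2 * r) <= nrm (fun x => g x - f x) ^+ 2.
  apply: H => y yx; have [|y1 yd] := hr y; first by rewrite /ball /= distrC.
  have h1 := Ag _ rg y y1.
  have h2 := modulusD (g0 y - f0 y) (- g0 y); rewrite modulusN in h2.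
  have e : g0 y - f0 y - g0 y = - f0 y by ring.
  rewrite e modulusN in h2.
  move: yd; rewrite ltr_norml => /andP[_]; rewrite /d; lra.
have s0 : 0 <= d ^+ 2 * r by rewrite mulr_ge0 ?sqr_ge0 // ltW.
have : nrm (fun x => g x - f x) ^+ 2 <= d ^+ 2 * r.
  by rewrite -(sqr_sqrtr s0) ler_sqr ?nnegrE ?nrm_ge0 ?sqrtr_ge0.
have : 0 < d ^+ 2 * r by rewrite mulr_gt0 // exprn_gt0.
lra.
Unshelve. all: by end_near. Qed.

(** By Baire some A n contains a ball of W.  Differences of elements of that ball give a
    bound on ]-1, 1[ for all elements of small norm, scaling gives it for all elements, and
    invariance under integer translations carries it to the whole line. *)
Theorem evaluation_bounded : exists2 K, 0 < K &
  forall f f0, W f -> crep f0 f -> forall x, modulus (f0 x) <= K * nrm f.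
Proof.
have W_ne : W !=set0 by exists (fun=> 0).
have [n [f [r [Wf r0 ball]]]] := L2_baire WL2 W_ne Wcl A_closed A_cov.
have Lf := WL2 Wf; have [f0 rf] := Wcrep Wf.
have small g g0 : W g -> crep g0 g -> nrm g <= r -> forall x, `|x| < 1 -> modulus (g0 x) <= 2 * n%:R.
  move=> Wg rg gr x x1; have Lg := WL2 Wg.
  have Af : A n f.
    by apply: ball; split => //; rewrite ae_eq_dist ?(ltW r0) //; exact: aeT.
  have Afg : A n (fun x => f x + g x).
    apply: ball; split; first exact: WD.
    by rewrite (_ : nrm _ = nrm g) //; apply: eq_nrm => y; rewrite addrC addKr.
  have h1 := Af _ rf x x1; have h2 := Afg _ (crepD rf rg) x x1.
  have h3 := modulusB (f0 x + g0 x) (f0 x); rewrite /= in h2.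
  have e : f0 x + g0 x - f0 x = g0 x by ring.
  rewrite e in h3; lra.
have key g g0 : W g -> crep g0 g -> forall e, 0 < e -> forall x, `|x| < 1 ->
    modulus (g0 x) <= 2 * n%:R / r * (nrm g + e).
  move=> Wg rg e e0 x x1; have Lg := WL2 Wg.
  (* The term e covers the case where g has norm 0; it is removed in the next step. *)
  have ge0 : 0 < nrm g + e by rewrite ltr_wpDl ?nrm_ge0.
  pose a := r / (nrm g + e); have a0 : 0 < a by rewrite divr_gt0.
  have := small _ _ (WZ (a%:C) Wg) (crepZ (a%:C) rg).
  rewrite nrmZ // modulus_real gtr0_norm // => H.
  have h : a * nrm g <= r.
    by rewrite /a mulrAC ler_pdivrMr // ler_wpM2l ?(ltW r0) // lerDl ltW.
  have := H h x x1; rewrite modulusM modulus_real gtr0_norm //.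
  rewrite -ler_pdivlMl // => /le_trans; apply.
  by rewrite /a invf_div mulrC [leRHS]mulrAC mulrA.
have bound g g0 : W g -> crep g0 g -> forall x, `|x| < 1 ->
    modulus (g0 x) <= (2 * n%:R / r + 1) * nrm g.
  move=> Wg rg x x1; apply/ler_addgt0Pl => e e0.
  have K0 : 0 < 2 * n%:R / r + 1 :> R.
    by rewrite ltr_pwDr // divr_ge0 ?mulr_ge0 // ltW.
  have e1 : 0 < e / (2 * n%:R / r + 1) by rewrite divr_gt0.
  apply: (le_trans (key _ _ Wg rg _ e1 x x1)).
  have h1 : 2 * n%:R / r * (e / (2 * n%:R / r + 1)) <= e.
    by rewrite mulrA ler_pdivrMr // mulrC ler_wpM2l ?(ltW e0) // lerDl.
  move: (2 * n%:R / r) h1 => c h1.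
  rewrite mulrDr mulrDl mul1r [leRHS]addrC -[leRHS]addrA; apply: lerD => //.
  by rewrite (le_trans h1) // lerDr nrm_ge0.
exists (2 * n%:R / r + 1); first by rewrite ltr_pwDr // divr_ge0 ?mulr_ge0 // ltW.
move=> g g0 Wg rg x; have Lg := WL2 Wg.
pose k := Num.floor x.
have := bound _ _ (Wshift (- k) Wg) (crep_shift (- k)%:~R rg) (x - k%:~R).
rewrite nrm_translate // /shift intrN opprK subrK; apply.
have /andP[a b] := frac_itv x; rewrite -/(frac x) ger0_norm //.
Qed.

End Bound.
End Evaluation.

(** * Bilateral series and sampling functions *)

Section Bilateral.
Context {R : realType}.
Local Notation mu := (@lebesgue_measure R).
Implicit Types (f g h s : R -> R[i]) (V : set (R -> R[i])).

Lemma near_pairP (P : nat * nat -> Prop) :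
  (\forall p \near (\oo, \oo), P p) <->
  exists N, forall p q, (N <= p)%N -> (N <= q)%N -> P (p, q).
Proof.
split.
  move=> [[Q1 Q2] [/= [N1 _ h1] [N2 _ h2]] sub]; exists (maxn N1 N2) => p q.
  rewrite !geq_max => /andP[p1 _] /andP[_ q2].
  by apply: sub; split => /=; [exact: h1|exact: h2].
move=> [N hN]; exists ([set n | (N <= n)%N], [set n | (N <= n)%N]).
  by split => /=; exists N.
by move=> [p q] [/= Np Nq]; exact: hN.
Qed.

Lemma cvg_pair0P (u : nat * nat -> R) : (forall p, 0 <= u p) ->
  u @ (\oo, \oo) --> (0 : R) <->
  forall e, 0 < e -> exists N, forall p q, (N <= p)%N -> (N <= q)%N -> u (p, q) < e.
Proof.
move=> u0; split.
  move=> /cvgrPdist_lt H e e0; have /near_pairP[N hN] := H e e0.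
  exists N => p q Np Nq; have := hN p q Np Nq.
  by rewrite sub0r normrN ger0_norm.
move=> H; apply/cvgrPdist_lt => e e0; apply/near_pairP; have [N hN] := H e e0.
exists N => p q Np Nq; rewrite sub0r normrN ger0_norm //; exact: hN.
Qed.

Lemma cvg_pair_L2dist (u : nat * nat -> R -> R[i]) f : (forall p, L2 (u p)) -> L2 f ->
  (fun p => L2dist (u p) f) @ (\oo, \oo) --> 0%E <->
  forall e, 0 < e -> exists N, forall p q, (N <= p)%N -> (N <= q)%N ->
    nrm (fun x => u (p, q) x - f x) < e.
Proof.
move=> Lu Lf.
have -> : (fun p => L2dist (u p) f) = (fun p => (nrm (fun x => u p x - f x))%:E).
  by apply/funext => p; rewrite L2dist_nrm.
apply: (iff_trans _ (@cvg_pair0P (fun p => nrm (fun x => u p x - f x)) _)); last first.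
  by move=> p; exact: nrm_ge0.
split=> [/fine_cvg //|h]; apply/fine_cvgP; split; [exact: nearW|exact: h].
Qed.

(** The integers k with N <= k < p or - q <= k < - N. *)
Definition int_range N p q : seq int :=
  map Posz (iota N (p - N)) ++ map Negz (iota N (q - N)).

Lemma uniq_int_range N p q : uniq (int_range N p q).
Proof.
rewrite cat_uniq !map_inj_uniq ?iota_uniq /= ?andbT; try by move=> ? ? [].
by apply/hasPn => k /mapP[n _ ->]; apply/mapP => -[].
Qed.

Lemma bilateral_sumE (u : int -> R[i]) p q :
  bilateral_sum u (p, q) = \sum_(k <- int_range 0 p q) u k.
Proof.
rewrite /bilateral_sum /int_range big_cat !big_map /= !subn0.
rewrite -(big_mkord xpredT (fun k => u (Posz k))) -(big_mkord xpredT (fun k => u (Negz k))).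
by rewrite /index_iota !subn0.
Qed.

Lemma int_range_split (V : nmodType) (F : int -> V) N p q : (N <= p)%N -> (N <= q)%N ->
  \sum_(k <- int_range 0 p q) F k =
  \sum_(k <- int_range 0 N N) F k + \sum_(k <- int_range N p q) F k.
Proof.
move=> Np Nq; rewrite /int_range !big_cat !big_map /= !subn0.
have e (m : nat) : (N <= m)%N -> iota 0 m = iota 0 N ++ iota N (m - N).
  by move=> Nm; rewrite -{1}(subnKC Nm) iotaD add0n.
by rewrite (e p) // (e q) // !big_cat /= addrACA.
Qed.

Lemma esum_int_range (a : int -> R) N p q : (forall k, 0 <= a k) ->
  ((\sum_(k <- int_range N p q) a k)%:E <= \esum_(k in [set: int]) (a k)%:E)%E.
Proof.
move=> a0; apply: esum_ge; exists [set` int_range N p q].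
  by split => //; exact: finite_seq.
by rewrite -(fsbig_seq _ (fun i => (a i)%:E) (uniq_int_range N p q)) sumEFin.
Qed.

Lemma ell2_tail (c : int -> R[i]) : ell2 c -> forall e, 0 < e -> exists N, forall M p q,
  (N <= M)%N -> (M <= p)%N -> (M <= q)%N -> \sum_(k <- int_range M p q) modulus (c k) ^+ 2 < e.
Proof.
move=> c2 e e0; pose a k := modulus (c k) ^+ 2.
have a0 k : 0 <= a k by exact: sqr_ge0.
pose A n := \sum_(k <- int_range 0 n n) a k.
have ndA : nondecreasing_seq A.
  move=> m n mn; rewrite /A (int_range_split a mn mn) lerDl.
  by apply: sumr_ge0 => k _; exact: a0.
have bA : has_ubound (range A).
  exists (fine (\esum_(k in [set: int]) (a k)%:E)%E) => _ [n _ <-].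
  rewrite -lee_fin fineK; first exact: esum_int_range.
  by rewrite ge0_fin_numE //; apply: esum_ge0 => k _; rewrite lee_fin.
have cA := nondecreasing_cvgn ndA bA.
have /cvgrPdist_lt/(_ e e0)[N _ hN] := cA.
exists N => M p q NM Mp Mq.
have h1 : \sum_(k <- int_range M p q) a k <= A (maxn p q) - A M.
  rewrite lerBrDl /A -(int_range_split a Mp Mq).
  rewrite /int_range !big_cat !big_map /= !subn0; apply: lerD.
  - by rewrite -{1}(subnKC (leq_maxl p q)) iotaD big_cat /= lerDl sumr_ge0.
  - by rewrite -{1}(subnKC (leq_maxr p q)) iotaD big_cat /= lerDl sumr_ge0.
apply: (le_lt_trans h1).
have hs : A (maxn p q) <= sup (range A).
  apply: ub_le_sup => //; by exists (maxn p q).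
have := hN M NM; rewrite /= ltr_norml => /andP[_]; lra.
Qed.

(** The synthesis operator is the adjoint of the analysis operator, so the upper frame
    bound also bounds it: ||g||^2 = <g, sum c_k e_k> <= sum |c_k| |<g, e_k>|, to which the
    frame inequality for g is applied. *)
Lemma bessel_synthesis V (e_ : int -> R -> R[i]) (B : R) : V `<=` L2 -> 0 < B ->
  (forall k, V (e_ k)) ->
  (forall f, V f ->
    (\esum_(k in [set: int]) (modulus (L2inner f (e_ k)) ^+ 2)%:E <= B%:E * L2norm f ^+ 2)%E) ->
  forall (c : int -> R[i]) N p q, V (fun x => \sum_(k <- int_range N p q) c k * e_ k x) ->
  nrm (fun x => \sum_(k <- int_range N p q) c k * e_ k x) ^+ 2 <=
    B * \sum_(k <- int_range N p q) modulus (c k) ^+ 2.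
Proof.
move=> VL2 B0 Ve HB c N p q Vg; set g := (fun x => _) in Vg *.
have Lg := VL2 _ Vg; have Le k := VL2 _ (Ve k).
have ipg : nrm g ^+ 2 <= \sum_(k <- int_range N p q) modulus (c k) * modulus (L2inner g (e_ k)).
  have := ip_self Lg; rewrite {1}/g ip_suml // => /(congr1 modulus).
  rewrite modulus_real ger0_norm ?sqr_ge0 // => <-.
  apply: (le_trans (modulus_sum _ _ _)); apply: ler_sum => k _.
  by rewrite modulusM (ip_conj Lg (Le k)) modulusJ.
have hb : \sum_(k <- int_range N p q) modulus (L2inner g (e_ k)) ^+ 2 <= B * nrm g ^+ 2.
  rewrite -lee_fin; apply: le_trans (esum_int_range _ _ _ _) _; first by move=> k; exact: sqr_ge0.
  apply: (le_trans (HB _ Vg)); by rewrite L2norm_nrm //= -!EFinM expr2.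
(* a b <= (B a^2 + b^2 / B) / 2; weights B and 1/B make the term in b at most ||g||^2 / 2 *)
have amgm : \sum_(k <- int_range N p q) modulus (c k) * modulus (L2inner g (e_ k)) <=
    2^-1 * (B * \sum_(k <- int_range N p q) modulus (c k) ^+ 2) +
    2^-1 * (B^-1 * \sum_(k <- int_range N p q) modulus (L2inner g (e_ k)) ^+ 2).
  rewrite !mulr_sumr -big_split /=; apply: ler_sum => k _.
  set a := modulus _; set b := modulus _.
  have h : 0 <= (B * a - b) ^+ 2 / B by rewrite divr_ge0 ?sqr_ge0 // ltW.
  have e : (B * a - b) ^+ 2 / B = B * a ^+ 2 - 2 * (a * b) + B^-1 * b ^+ 2.
    by field; rewrite gt_eqF.
  rewrite e in h; lra.
have hb' : B^-1 * \sum_(k <- int_range N p q) modulus (L2inner g (e_ k)) ^+ 2 <= nrm g ^+ 2.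
  by rewrite ler_pdivrMl.
lra.
Qed.

(** The window - q <= k < p as a single sum. *)
Lemma bilateral_int (u : int -> R[i]) p q :
  bilateral_sum u (p, q) = \sum_(i < p + q) u (i%:Z - q%:Z).
Proof.
elim: q => [|q ih].
  rewrite addn0 /bilateral_sum /= big_ord0 addr0; apply: eq_bigr => i _.
  by rewrite subr0.
rewrite addnS big_ord_recl /= sub0r -NegzE.
rewrite (_ : \sum_(i < p + q) _ = \sum_(i < p + q) u (i%:Z - q%:Z)); last first.
  by apply: eq_bigr => i _; congr u; rewrite /bump /= ; lia.
by rewrite -ih /bilateral_sum /= big_ord_recr /= addrA addrC.
Qed.

(** The substitution k |-> n - k maps the window - q <= k < p onto n - p < k <= n + q. *)
Lemma bilateral_reflect (u : int -> R[i]) (n : int) p q : (absz n < p)%N -> (absz n < q)%N ->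
  bilateral_sum (fun k => u (n - k)) (p, q) =
  bilateral_sum u (absz (q%:Z + n + 1)%R, absz (p%:Z - n - 1)%R).
Proof.
move=> np nq; rewrite !bilateral_int.
have e : (absz (q%:Z + n + 1)%R + absz (p%:Z - n - 1)%R)%N = (p + q)%N by lia.
rewrite e (reindex_inj rev_ord_inj) /=; apply: eq_bigr => i _; congr u.
by have := ltn_ord i; lia.
Qed.

Lemma bilateral_delta (u : int -> R[i]) p q :
  bilateral_sum (fun k => (k == 0)%:R * u k) (p.+1, q) = u 0.
Proof.
rewrite /bilateral_sum /= big_ord_recl mul1r big1 ?addr0; last first.
  by move=> k _; rewrite mul0r.
by rewrite big1 ?addr0 // => k _; rewrite mul0r.
Qed.

(** The second condition applied to the sequence that is 1 at 0 and 0 elsewhere. *)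
Lemma sampling_continuous V s : sampling_function V s -> ccontinuous s.
Proof.
move=> [_ h2 _]; pose c (k : int) : R[i] := (k == 0)%:R.
have c2 : ell2 c.
  rewrite /ell2; apply: le_lt_trans (ltry 1).
  rewrite (_ : \esum_(k in [set: int]) _ = \esum_(k in [set (0 : int)]) (1 : R)%:E)%E.
    by rewrite esum_set1 // lee_fin.
  rewrite esum_mkcond [RHS]esum_mkcond; apply: eq_esum => k _.
  rewrite mem_set //; have [->|k0] := eqVneq k 0.
    by rewrite mem_set //= /c eqxx (_ : true%:R = (1 : R)%:C) // modulus_real normr1 expr1n.
  rewrite memNset; last by move=> /= k0'; rewrite k0' eqxx in k0.
  by rewrite /c (negbTE k0) modulus0 expr0n.
have [g cg hg] := h2 c c2.
suff -> : s = g by [].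
apply/funext => x; apply/eqP; rewrite -subr_eq0; apply/eqP/modulus_eq0/eqP.
rewrite eq_le modulus_ge0 andbT; apply/ler_addgt0Pl => e e0; rewrite addr0.
have /cvg_pair0P/(_ e e0)[|N hN] := hg x; first by move=> p; exact: modulus_ge0.
have := hN N.+1 N.+1 (leqnSn N) (leqnSn N); rewrite bilateral_delta /translate subr0.
exact: ltW.
Qed.

End Bilateral.

Section Uniqueness.
Context {R : realType}.
Local Notation mu := (@lebesgue_measure R).
Implicit Types (f g h s t : R -> R[i]) (V : set (R -> R[i])).

Lemma translate0 f : translate f 0 = f.
Proof. by apply/funext => x; rewrite /translate subr0. Qed.

Lemma sampling_mem V s : sampling_function V s -> V s.
Proof. by case=> -[Vs _] _ _; have := Vs 0; rewrite translate0. Qed.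

Lemma sampling_expand V s t : sampling_function V s -> V t -> ccontinuous t ->
  forall x e, 0 < e -> exists N, forall p q, (N <= p)%N -> (N <= q)%N ->
  modulus (bilateral_sum (fun k => t k%:~R * translate s k x) (p, q) - t x) < e.
Proof.
move=> [_ _ h3] Vt ct x e e0; have [f0 [cf0 f0t _ unif]] := h3 t Vt.
have e0t : f0 = t by exact: ccont_ae_eq.
rewrite e0t in unif; have /near_pairP[N hN] := unif e e0.
by exists N => p q Np Nq; exact: hN.
Qed.

Lemma modulus_lt_eq (z w : R[i]) : (forall e, 0 < e -> modulus (z - w) < e) -> z = w.
Proof.
move=> H; apply/eqP; rewrite -subr_eq0; apply/eqP/modulus_eq0/eqP.
rewrite eq_le modulus_ge0 andbT; apply/ler_addgt0Pl => e e0; rewrite addr0.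
exact/ltW/H.
Qed.

(** At an integer n the expansion of s in the translates of t is sum_k s(k) t(n - k), and that
    of t in the translates of s is sum_k t(k) s(n - k).  The substitution k |-> n - k
    exchanges them, so s and t agree on the integers.  Then s and t have the same expansion
    in the translates of t, hence agree everywhere. *)
Lemma sampling_unique V s t : sampling_function V s -> sampling_function V t -> s = t.
Proof.
move=> Hs Ht.
have cs := sampling_continuous Hs; have ct := sampling_continuous Ht.
have Vs := sampling_mem Hs; have Vt := sampling_mem Ht.
have onZ (n : int) : s n%:~R = t n%:~R.
  apply: modulus_lt_eq => e e0; have e20 : 0 < e / 2 by rewrite divr_gt0.
  have [N1 h1] := sampling_expand Ht Vs cs n%:~R e20.
  have [N2 h2] := sampling_expand Hs Vt ct n%:~R e20.
  pose M := (N1 + N2 + absz n + 1)%N.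
  have {h1} := h1 M M _ _; have {h2} := h2 (absz (M%:Z + n + 1)%R) (absz (M%:Z - n - 1)%R) _ _.
  rewrite -bilateral_reflect; [|by rewrite /M; lia|by rewrite /M; lia].
  set A := bilateral_sum _ _; set B := bilateral_sum _ _.
  have -> : A = B.
    congr bilateral_sum; apply/funext => k; rewrite mulrC /translate -!rmorphB /=.
    by rewrite opprB addrC subrK.
  move=> h2 h1; have {}h2 := h2 _ _; have {}h1 := h1 _ _.
  rewrite (_ : s _ - t _ = (B - t n%:~R) - (B - s n%:~R)); last by ring.
  apply: le_lt_trans (modulusB _ _) _; rewrite (splitr e).
  by apply: ltrD; [apply: h2|apply: h1]; rewrite /M; lia.
apply/funext => x; apply: modulus_lt_eq => e e0; have e20 : 0 < e / 2 by rewrite divr_gt0.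
have [N1 h1] := sampling_expand Ht Vs cs x e20.
have [N2 h2] := sampling_expand Ht Vt ct x e20.
have {h1} := h1 (maxn N1 N2) (maxn N1 N2) (leq_maxl _ _) (leq_maxl _ _).
have {h2} := h2 (maxn N1 N2) (maxn N1 N2) (leq_maxr _ _) (leq_maxr _ _).
set A := bilateral_sum _ _; set B := bilateral_sum _ _.
have -> : A = B by congr bilateral_sum; apply/funext => k; rewrite onZ.
move=> h2 h1; rewrite (_ : s _ - t _ = (B - t x) - (B - s x)); last by ring.
by apply: le_lt_trans (modulusB _ _) _; rewrite (splitr e) ltrD.
Qed.

End Uniqueness.

(** * Band projections *)

Section Filtering.
Context {R : realType}.
Local Notation mu := (@lebesgue_measure R).
Implicit Types (f g h s t : R -> R[i]) (V : set (R -> R[i])).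

Lemma FT_inj f f' g : FT f g -> FT f' g -> {ae mu, forall x, f x = f' x}.
Proof.
move=> F F'; apply: dist_eq0_ae; [exact: FT_L2l F|exact: FT_L2l F'|].
rewrite (FT_isometry (FTB F F')) -[RHS](nrm0 (R := R)); apply: eq_nrm => x.
by rewrite subrr.
Qed.

Lemma FT_ael f f' g : FT f g -> cmeas f' -> {ae mu, forall x, f x = f' x} -> FT f' g.
Proof.
move=> F mf' ff'; have Lf := FT_L2l F; have Lf' := ae_eq_L2 Lf mf' ff'.
have [g' F'] := FT_total Lf'; apply: (FT_ae F'); first exact: L2_cmeas (FT_L2r F).
apply: dist_eq0_ae; [exact: FT_L2r F'|exact: FT_L2r F|].
by rewrite nrm_distC -(FT_isometry (FTB F F')); exact: ae_eq_dist.
Qed.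

Variable B : set R.
Hypothesis mB : measurable B.

(** g = P_B f.  A relation rather than a function, because transforms and their inverses
    are only determined almost everywhere. *)
Definition filter_of f g := exists2 fh, FT f fh & FT g (fun w => indic B w * fh w).

Lemma filter_FT f g fh : filter_of f g -> FT f fh -> FT g (fun w => indic B w * fh w).
Proof.
move=> [fh' F' G] F; apply: (FT_ae G).
  by apply: cmeasM; [exact: cmeas_indic|exact: L2_cmeas (FT_L2r F)].
by move: (FT_uniq F' F); apply: aeS => w ->.
Qed.

Lemma filter_L2l f g : filter_of f g -> L2 f. Proof. by case=> ? /FT_L2l. Qed.
Lemma filter_L2r f g : filter_of f g -> L2 g. Proof. by case=> ? _ /FT_L2l. Qed.

Lemma filter_uniq f g g' : filter_of f g -> filter_of f g' -> {ae mu, forall x, g x = g' x}.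
Proof.
by move=> [fh F G] /filter_FT/(_ F) G'; exact: FT_inj G G'.
Qed.

Lemma filter_ae f f' g g' : filter_of f g -> cmeas f' -> cmeas g' ->
  {ae mu, forall x, f x = f' x} -> {ae mu, forall x, g x = g' x} -> filter_of f' g'.
Proof.
by move=> [fh F G] mf mg ff' gg'; exists fh; [exact: FT_ael ff'|exact: FT_ael gg'].
Qed.

Lemma filterD f g f' g' : filter_of f g -> filter_of f' g' ->
  filter_of (fun x => f x + f' x) (fun x => g x + g' x).
Proof.
move=> [fh F G] [fh' F' G']; exists (fun w => fh w + fh' w); first exact: FTD.
by have := FTD G G'; congr FT; apply/funext => w; rewrite mulrDr.
Qed.

Lemma filterZ c f g : filter_of f g -> filter_of (fun x => c * f x) (fun x => c * g x).
Proof.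
move=> [fh F G]; exists (fun w => c * fh w); first exact: FTZ.
by have := FTZ c G; congr FT; apply/funext => w; rewrite mulrCA.
Qed.

Lemma filterB f g f' g' : filter_of f g -> filter_of f' g' ->
  filter_of (fun x => f x - f' x) (fun x => g x - g' x).
Proof.
move=> F /(filterZ (-1)) /(filterD F).
by congr filter_of; apply/funext => x; rewrite mulN1r.
Qed.

Lemma filter0 : filter_of (fun=> 0) (fun=> 0).
Proof.
exists (fun=> 0); first exact: FT0.
by have := @FT0 R; congr FT; apply/funext => w; rewrite mulr0.
Qed.

Lemma filter_translate f g k : filter_of f g -> filter_of (translate f k) (translate g k).
Proof.
move=> [fh F G]; eexists; first exact: (FT_shift k%:~R F).
by have := FT_shift k%:~R G; congr FT; apply/funext => w; rewrite mulrCA.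
Qed.

Lemma filter_sum I (r : seq I) (c : I -> R[i]) (F G : I -> R -> R[i]) :
  (forall i, filter_of (F i) (G i)) ->
  filter_of (fun x => \sum_(i <- r) c i * F i x) (fun x => \sum_(i <- r) c i * G i x).
Proof.
move=> H; elim: r => [|i r ih].
  have := filter0; congr filter_of; apply/funext => x; by rewrite big_nil.
have := filterD (filterZ (c i) (H i)) ih.
by congr filter_of; apply/funext => x; rewrite big_cons.
Qed.

Lemma filter_contract f g : filter_of f g -> nrm g <= nrm f.
Proof.
move=> [fh F G]; rewrite (FT_isometry F) (FT_isometry G).
have [_] := L2_mulb (cmeas_indic mB) (indic_le1 B) (FT_L2r F).
by rewrite mul1r.
Qed.

Lemma filter_idem f g : filter_of f g -> filter_of g g.
Proof.
move=> [fh F G]; eexists; first exact: G.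
move: G; congr FT; apply/funext => w; rewrite mulrA; congr (_ * _).
by have [h|h] := pselect (B w); rewrite ?(indicT h) ?(indicF h) ?mulr1 ?mulr0.
Qed.

(** P_B is self-adjoint, since indicators are real. *)
Lemma filter_adjoint f g f' g' : filter_of f g -> filter_of f' g' ->
  L2inner f g' = L2inner g f'.
Proof.
move=> [fh F G] [fh' F' G']; rewrite (FT_ip F G') (FT_ip G F') /L2inner.
congr cintegral; apply/funext => w.
by have [h|h] := pselect (B w); rewrite ?(indicT h) ?(indicF h) ?mul1r ?mul0r ?conjc0 ?mulr0.
Qed.

Hypothesis perB : periodic B.
Arguments perB : clear implicits.

Lemma filter_total f : L2 f -> exists2 g, shift_space f g & filter_of f g.
Proof.
move=> Lf; have [fh F] := FT_total Lf.
have [_ _ H] := multiplier_periodic mB perB; have [g Sg G] := H f fh F.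
by exists g => //; exists fh.
Qed.

(** P_B is a contraction commuting with integer translations, so it maps approximations
    of g by translates of f to approximations of P_B g by translates of P_B f. *)
Lemma filter_shift_space f f' g g' : filter_of f f' -> filter_of g g' ->
  shift_space f g -> shift_space f' g'.
Proof.
move=> Ff Fg /(shift_spaceP _ (filter_L2l Ff))[_ H].
apply/shift_spaceP; first exact: filter_L2r Ff.
split=> [|e e0]; first exact: filter_L2r Fg.
have [_ [r [c ->]] hd] := H e e0; eexists; first by exists r, c.
apply: le_lt_trans hd; apply: filter_contract.
by apply: filterB => //; apply: filter_sum => k; exact: filter_translate.
Qed.

(** P_B f = f implies P_B h = h for all h in the span of the translates of f, and the fixed
    points of a contraction form a closed set. *)
Lemma shift_space_fixed f g : filter_of f f -> shift_space f g -> filter_of g g.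
Proof.
move=> Ff Sg; have Lf := filter_L2l Ff; have Lg := shift_space_L2 Sg.
have [g' _ G] := filter_total Lg; have Lg' := filter_L2r G.
suff gg' : {ae mu, forall x, g x = g' x}.
  by apply: (filter_ae G) => //; [exact: L2_cmeas|exact: L2_cmeas|exact: aeT|];
    move: gg'; apply: aeS => x ->.
apply: dist_eq0_ae => //; apply/eqP; rewrite eq_le nrm_ge0 andbT.
apply/ler_addgt0Pl => e e0; rewrite addr0; have e2 : 0 < e / 2 by rewrite divr_gt0.
have [_ /(_ _ e2)[h [r [c eh]] hd]] := (shift_spaceP g Lf).1 Sg.
have Fh : filter_of h h by rewrite eh; apply: filter_sum => k; exact: filter_translate.
have Lh := filter_L2l Fh; apply: le_trans (nrm_dist_triangle Lg Lh Lg') _.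
have := filter_contract (filterB G Fh); rewrite (nrm_distC h); lra.
Qed.

Lemma filter_mem f g : filter_of f g -> shift_space f g.
Proof.
move=> F; have [h Sh H] := filter_total (filter_L2l F).
apply: shift_space_ae Sh (filter_L2r F) (filter_uniq H F); exact: filter_L2l F.
Qed.

(** For h in the smaller space P_B h = h, so h has the same inner products with the
    translates of g and with those of P_B g = g'. *)
Lemma filter_frame f f' g g' : filter_of f f' -> filter_of g g' ->
  frame (shift_space f) (translate g) -> frame (shift_space f') (translate g').
Proof.
move=> Ff Fg [Vg [a [b [a0 b0 H]]]]; split.
  by move=> k; apply: filter_shift_space (Vg k) => //; exact: filter_translate.
exists a, b; split => // h Sh.
have Fh : filter_of h h := shift_space_fixed (filter_idem Ff) Sh.
have Sh' : shift_space f h := shift_space_sub (filter_L2l Ff) (filter_mem Ff) Sh.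
have e k : L2inner h (translate g' k) = L2inner h (translate g k).
  by rewrite (filter_adjoint Fh (filter_translate _ Fg)).
by have := H h Sh'; under eq_esum do rewrite -e.
Qed.

End Filtering.

(** * Sampling in the range of a band projection *)

Section SamplingTransfer.
Context {R : realType}.
Local Notation mu := (@lebesgue_measure R).
Implicit Types (f g h s t : R -> R[i]) (V : set (R -> R[i])).

Lemma sampling_evaluation phi s : L2 phi -> sampling_function (shift_space phi) s ->
  exists2 K, 0 < K & forall f f0, shift_space phi f -> crep f0 f ->
    forall x, modulus (f0 x) <= K * nrm f.
Proof.
move=> Lp [_ _ h3]; apply: evaluation_bounded.
- by move=> f /shift_space_L2.
- exact: shift_space0.
- by move=> f g; exact: shift_spaceD.
- by move=> c f; exact: shift_spaceZ.
- by move=> u g Su Lg cu; exact: shift_space_lim Su cu.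
- by move=> k f; exact: shift_space_shift.
- by move=> f /h3[f0 [cf0 e _ _]]; exists f0.
Qed.

Lemma shift_space_synthesis phi s (c : int -> R[i]) (r : seq int) : L2 phi -> shift_space phi s ->
  shift_space phi (fun x => \sum_(k <- r) c k * translate s k x).
Proof. by move=> Lp Ss; apply: shift_space_sum => // k; exact: shift_space_shift. Qed.

Lemma ccont_synthesis s (c : int -> R[i]) (r : seq int) : ccontinuous s ->
  ccontinuous (fun x => \sum_(k <- r) c k * translate s k x).
Proof.
move=> cs; apply: ccont_sum => k; exact: ccont_shift.
Qed.

(** The partial sums are Cauchy in L^2 by [bessel_synthesis], and the evaluation bound
    turns L^2 convergence into uniform convergence. *)
Lemma synthesis_converges phi s K : L2 phi -> shift_space phi s -> ccontinuous s ->
  frame (shift_space phi) (translate s) ->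
  (forall f, shift_space phi f -> exists f0, crep f0 f) ->
  (forall f f0, shift_space phi f -> crep f0 f -> forall x, modulus (f0 x) <= K * nrm f) ->
  0 < K -> forall c, ell2 c -> exists2 g, ccontinuous g &
    forall x, (fun p => modulus (bilateral_sum (fun k => c k * translate s k x) p - g x))
      @ (\oo, \oo) --> (0 : R).
Proof.
move=> Lp Ss cs [_ [a [b [_ b0 Hb]]]] rep ev K0 c c2.
pose S N p q x := \sum_(k <- int_range N p q) c k * translate s k x.
have SS N p q : shift_space phi (S N p q) by exact: shift_space_synthesis.
have LS N p q : L2 (S N p q) := shift_space_L2 (SS N p q).
have cS N p q : ccontinuous (S N p q) by exact: ccont_synthesis.
have small e : 0 < e -> exists N, forall M p q, (N <= M)%N -> (M <= p)%N -> (M <= q)%N -> nrm (S M p q) < e.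
  move=> e0; have e2 : 0 < e ^+ 2 / b by rewrite divr_gt0 // exprn_gt0.
  have [N hN] := ell2_tail c2 e2; exists N => M p q NM Mp Mq.
  rewrite -(ltr_pXn2r (ltn0Sn 1)) ?nnegrE ?nrm_ge0 ?(ltW e0) //.
  apply: le_lt_trans (bessel_synthesis _ b0 _ _ (SS M p q)) _.
  - by move=> f /shift_space_L2.
  - by move=> k; exact: shift_space_shift.
  - by move=> f /Hb[].
  - by rewrite mulrC -ltr_pdivlMr //; exact: hN.
have split N p q : (N <= p)%N -> (N <= q)%N -> forall x, S 0%N p q x = S 0%N N N x + S N p q x.
  by move=> Np Nq x; rewrite /S (int_range_split _ Np Nq).
pose u n := S 0%N n n.
have cu : L2cauchy u.
  move=> e e0; have e2 : 0 < e / 2 by rewrite divr_gt0.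
  have [N hN] := small _ e2; exists N => m n Nm Nn.
  rewrite (_ : (fun x => u m x - u n x) = (fun x => S N m m x - S N n n x)); last first.
    by apply/funext => x; rewrite /u (split N m m) // (split N n n) //; ring.
  apply: le_lt_trans (nrmB (LS _ _ _) (LS _ _ _)) _; rewrite (splitr e).
  by apply: ltrD; apply: hN.
have [g Lg ug] := L2_complete (fun n => LS 0%N n n) cu.
have Sg : shift_space phi g := shift_space_lim Lp Lg (fun n => SS 0%N n n) ug.
have [g0 rg] := rep g Sg; exists g0; first by have [] := rg.
move=> x; apply/cvg_pair0P; first by move=> p; exact: modulus_ge0.
move=> e e0; have e2 : 0 < e / (2 * K) by rewrite divr_gt0 // mulr_gt0.
have [N1 hN1] := small _ e2; have /cvgL2P/(_ _ e2)[N2 _ hN2] := ug.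
pose N := maxn N1 N2; exists N => p q Np Nq; rewrite bilateral_sumE.
have r := crepB (crep_self (cS 0%N p q)) rg.
apply: le_lt_trans (ev _ _ (shift_spaceB Lp (SS 0%N p q) Sg) r x) _.
rewrite mulrC -ltr_pdivlMr //.
apply: le_lt_trans (nrm_dist_triangle (LS 0%N p q) (LS 0%N N N) Lg) _.
have -> : e / K = e / (2 * K) + e / (2 * K) by field; rewrite gt_eqF.
apply: ltrD; last by apply: hN2; exact: leq_maxr.
rewrite (_ : (fun x => _) = S N p q); first by apply: hN1; rewrite // leq_maxl.
by apply/funext => y; rewrite (split N p q) //; ring.
Qed.



(** The sampling function of S(psi), where psi = P_B phi, is the continuous representative
    s' of P_B s. *)
Theorem filter_sampling (B : set R) phi psi s : measurable B -> periodic B ->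
  filter_of B phi psi ->
  sampling_function (shift_space phi) s ->
  exists2 s', sampling_function (shift_space psi) s' & filter_of B s s'.
Proof.
move=> mB perB Fphi Hs; have Lphi := filter_L2l Fphi; have Lpsi := filter_L2r Fphi.
have Ss := sampling_mem Hs; have Ls := shift_space_L2 Ss.
have [K K0 ev] := sampling_evaluation Lphi Hs.
have [framing _ h3] := Hs.
have sub : shift_space psi `<=` shift_space phi.
  exact: shift_space_sub (filter_mem mB perB Fphi).
have rep f : shift_space psi f -> exists f0, crep f0 f.
  by move=> /sub/h3[f0 [cf0 e _ _]]; exists f0.
have [g Sg Fg] := filter_total mB perB Ls.
have Sg' : shift_space psi g by apply: filter_shift_space Fphi Fg Ss.
have [s' [cs' es']] := rep g Sg'; have Ls' := crep_L2 (filter_L2r Fg) (conj cs' es').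
have Fs : filter_of B s s'.
  apply: (filter_ae Fg (L2_cmeas Ls) (L2_cmeas Ls')); first exact: aeT.
  by move: es'; apply: aeS => x ->.
have Ss' : shift_space psi s' by apply: filter_shift_space Fphi Fs Ss.
have framing' := filter_frame mB perB Fphi Fs framing.
exists s' => //; split => //.
  apply: (synthesis_converges (phi := psi) (K := K)) => // f f0 /sub; exact: ev.
move=> f Sf; have [f0 [cf0 e0f cvf _]] := h3 f (sub _ Sf).
have r0 : crep f0 f by [].
have Lf := shift_space_L2 Sf; have Lf0 := crep_L2 Lf r0.
have Sf0 : shift_space psi f0.
  by apply: shift_space_ae Sf Lf0 _ => //; move: e0f; apply: aeS => x ->.
have Ff0 : filter_of B f0 f0 := shift_space_fixed mB perB (filter_idem Fphi) Sf0.
pose X (t : R -> R[i]) p x := bilateral_sum (fun k => f0 k%:~R * translate t k x) p.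
have XE t p : X t p = fun x => \sum_(k <- int_range 0 p.1 p.2) f0 k%:~R * translate t k x.
  by apply/funext => x; case: p => p q; rewrite /X bilateral_sumE.
have LX t p : L2 t -> L2 (X t p).
  by move=> Lt; rewrite XE; apply: L2_sum => k; apply: L2Z; exact: L2_translate.
(* P_B maps the expansion of f0 in translates of s to the one in translates of s' and
     fixes f0 *)
have close p : nrm (fun x => X s' p x - f0 x) <= nrm (fun x => X s p x - f0 x).
  apply: (filter_contract mB); apply: filterB => //; rewrite !XE.
  by apply: filter_sum => k; exact: filter_translate.
have cvf' e : 0 < e -> exists N, forall p q, (N <= p)%N -> (N <= q)%N ->
    nrm (fun x => X s' (p, q) x - f0 x) < e.
  move=> e0; have /cvg_pair_L2dist := cvf.
  move=> /(_ (fun p => LX s p Ls) Lf0 e e0)[N hN]; exists N => p q Np Nq.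
  exact: le_lt_trans (close _) (hN p q Np Nq).
exists f0; split => //.
  by apply/cvg_pair_L2dist => // p; exact: LX.
move=> e e0; apply/near_pairP; have [N hN] := cvf' (e / K) (divr_gt0 e0 K0).
exists N => p q Np Nq x; rewrite -/(X s' (p, q) x).
have SX : shift_space psi (X s' (p, q)) by rewrite XE; exact: shift_space_synthesis.
have rX : crep (fun x => X s' (p, q) x - f0 x) (fun x => X s' (p, q) x - f0 x).
  by apply: crep_self; apply: ccontB => //; rewrite XE; exact: ccont_synthesis.
apply: le_lt_trans (ev _ _ (sub _ (shift_spaceB Lpsi SX Sf0)) rX x) _.
by rewrite mulrC -ltr_pdivlMr //; exact: hN.
Qed.

End SamplingTransfer.

(** * Periodic Borel partitions *)

Section PeriodicPartition.
Context {R : realType}.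
Local Notation mu := (@lebesgue_measure R).
Implicit Types A B : set R.

(** A = X `|` N with X Borel and N negligible.  The union of the integer translates of X is
    Borel and periodic, and it stays inside A because A is periodic. *)
Lemma periodic_Borel_kernel A : lebesgue_measurable A -> periodic A ->
  exists B, [/\ measurable B, periodic B, B `<=` A & mu.-negligible (A `\` B)].
Proof.
rewrite /lebesgue_measurable g_sigma_completed_algebra_genE => -[X mX [N nN XN]] pA.
exists (\bigcup_(k in [set: int]) ((fun y => y + k%:~R) @^-1` X)); split.
- apply: countable_bigcupT_measurable => [|k]; first exact: countableP.
  rewrite -[X in measurable X]setTI.
  exact: measurable_shift.
- move=> w j [k _ /= Xwk]; exists (k - j) => //=.
  by rewrite -addrA -intrD (addrC j) subrK.
- move=> w [k _ /= Xwk]; have : A (w + k%:~R) by rewrite -XN; left.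
  by move/(pA _ (- k)); rewrite rmorphN addrK.
- apply: negligibleS nN => w [Aw nB]; move: Aw; rewrite -XN => -[Xw|//].
  by exfalso; apply: nB; exists 0 => //=; rewrite addr0.
Qed.

Lemma periodicC B : periodic B -> periodic (~` B).
Proof. by move=> pB w k nB /(pB _ (- k)); rewrite rmorphN addrK. Qed.

Lemma periodicI A B : periodic A -> periodic B -> periodic (A `&` B).
Proof. by move=> pA pB w k [a b]; split; [exact: pA|exact: pB]. Qed.

Lemma periodic_bigcup (I : Type) (P : set I) (F : I -> set R) :
  (forall i, periodic (F i)) -> periodic (\bigcup_(i in P) F i).
Proof. by move=> pF w k [i Pi Fi]; exists i => //; exact: pF. Qed.

(** The Borel kernels B j are made disjoint by removing the earlier ones.  What is lost from
    E j is contained in the null sets E j minus B j and E j `&` E k for k < j. *)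
Lemma periodic_partition (E : nat -> set R) :
  (forall j, lebesgue_measurable (E j)) -> (forall j, periodic (E j)) ->
  (forall j l, j <> l -> mu.-negligible (E j `&` E l)) ->
  exists D : nat -> set R, [/\ forall j, measurable (D j), forall j, periodic (D j),
    trivIset setT D & forall j, {ae mu, forall w, E j w <-> D j w}].
Proof.
move=> mE pE disj.
have /choice[B hB] : forall j, exists B, [/\ measurable B, periodic B, B `<=` E j &
  mu.-negligible (E j `\` B)] by move=> j; exact: periodic_Borel_kernel.
have mB j : measurable (B j) by have [] := hB j.
have pB j : periodic (B j) by have [] := hB j.
exists (seqDU B); split.
- by move=> j; apply: measurableD => //; apply: bigsetU_measurable.
- move=> j; rewrite /seqDU setDE; apply: periodicI => //; apply: periodicC.
  by rewrite -bigcup_mkord; exact: periodic_bigcup.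
- exact: trivIset_seqDU.
- move=> j; have [_ _ BE nE] := hB j.
  have nU : mu.-negligible (\bigcup_k (if k == j then set0 else E j `&` E k)).
    apply: negligible_bigcup => k; case: eqVneq => [_|kj]; first exact: negligible_set0.
    by apply: disj => e; rewrite e eqxx in kj.
  apply: negligibleS (negligibleU nE nU) => w /= nw.
  apply: contrapT => /not_orP[nEB nEE]; apply: nw; split => [Ew|[/BE //]].
  have Bw : B j w by apply: contrapT => nBw; exact: nEB.
  split => //; rewrite -bigcup_mkord => -[k /= kj Bk]; apply: nEE; exists k => //.
  by rewrite ltn_eqF //; split => //; have [_ _ + _] := hB k; exact.
Qed.

End PeriodicPartition.

(** * The direct sum decomposition *)

Section Decomposition.
Context {R : realType}.
Local Notation mu := (@lebesgue_measure R).
Implicit Types (f g h s t : R -> R[i]) (A B : set R).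

Lemma filter_disjoint A B f : A `&` B = set0 -> filter_of A f f -> filter_of B f (fun=> 0).
Proof.
move=> AB [fh F F']; eexists; first exact: F'.
have := @FT0 R; congr FT; apply/funext => w.
have [a|a] := pselect (A w); last by rewrite (indicF a) mul0r mulr0.
by rewrite (@indicF _ B) ?mul0r // => b; have : set0 w by rewrite -AB.
Qed.

Lemma indicU A B w : A `&` B = set0 -> indic (A `|` B) w = indic A w + indic B w.
Proof.
move=> AB; have [a|a] := pselect (A w).
  rewrite (indicT a) indicT; last by left.
  by rewrite indicF ?addr0 // => b; have : set0 w by rewrite -AB.
rewrite (indicF a) add0r; have [b|b] := pselect (B w).
  by rewrite !indicT //; right.
by rewrite !indicF // => -[].
Qed.

Variable D : nat -> set R.
Hypothesis mD : forall j, measurable (D j).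
Hypothesis pD : forall j, periodic (D j).
Hypothesis tD : trivIset setT D.
Arguments pD : clear implicits.

Let U := \bigcup_j D j.

(** The n-th partial sum has transform 1_{D_0 `|` .. `|` D_(n-1)} f^, which tends to f^ by
    dominated convergence because P_U f = f; the Fourier transform is isometric. *)
Lemma filter_partial_sums f (g : nat -> R -> R[i]) : filter_of U f f ->
  (forall j, filter_of (D j) f (g j)) -> cvgL2 (fun n x => \sum_(j < n) g j x) f.
Proof.
move=> [fh F F'] G; pose Un n := \big[setU/set0]_(j < n) D j.
have FTn n : FT (fun x => \sum_(j < n) g j x) (fun w => indic (Un n) w * fh w).
  elim: n => [|n ih].
    have := @FT0 R; congr FT; apply/funext => x; first by rewrite big_ord0.
    by rewrite /Un big_ord0 indicF ?mul0r.
  have := FTD ih (filter_FT (mD n) (G n) F); congr FT; apply/funext => x.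
    by rewrite big_ord_recr.
  rewrite -mulrDl /Un big_ord_recr /= indicU //.
  rewrite -bigcup_mkord setI_bigcupl; apply: bigcup0 => i /= ni.
  by move/trivIsetP: tD; apply => //; rewrite ltn_eqF.
have mUn n : measurable (Un n) by exact: bigsetU_measurable.
have c : cvgL2 (fun n w => indic (Un n) w * fh w) (fun w => indic U w * fh w).
  apply: (@L2_multiplier_cvg _ (fun n => indic (Un n)) (indic U) 1) => //.
  - by move=> n; exact: cmeas_indic.
  - by apply: cmeas_indic; exact: bigcupT_measurable.
  - exact: FT_L2r F.
  - by move=> n x; exact: indic_le1.
  - move=> w; apply: cvg_near_cst.
    have [[n _ Dw]|nU] := pselect (U w).
      exists n.+1 => // m /= nm; rewrite !indicT ?subrr ?modulus0 //; first by exists n.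
      by rewrite /Un -bigcup_mkord; exists n.
    exists 0%N => // m _; rewrite !indicF ?subrr ?modulus0 //.
    by rewrite /Un -bigcup_mkord => -[j _ Dj]; apply: nU; exists j.
by apply: eq_cvgL2 c => n; rewrite (FT_isometry (FTB (FTn n) F')).
Qed.

Variables (phi : R -> R[i]) (phi_ : nat -> R -> R[i]).
Hypothesis phiU : filter_of U phi phi.
Hypothesis phiD : forall j, filter_of (D j) phi (phi_ j).

(** Uniqueness: applying P_{D_j} to a partial sum of differences d_i in S(phi_i) leaves d_j
    only, so the norm of d_j is at most that of the partial sum, which tends to 0. *)
Lemma filter_direct_sum :
  hilbert_direct_sum (shift_space phi) (fun j => shift_space (phi_ j)).
Proof.
have Lphi := filter_L2l phiU.
have Lphij j : L2 (phi_ j) := filter_L2r (phiD j).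
have sub j : shift_space (phi_ j) `<=` shift_space phi.
  exact: shift_space_sub Lphi (filter_mem (mD j) (pD j) (phiD j)).
have Lsum (g : nat -> R -> R[i]) n : (forall j, L2 (g j)) -> L2 (fun x => \sum_(j < n) g j x).
  by move=> Lg; apply: L2_sum => j.
split.
- move=> f Sf; have Lf := shift_space_L2 Sf.
  have /choice[g hg] : forall j, exists g, filter_of (D j) f g.
    by move=> j; have [g _ G] := filter_total (mD j) (pD j) Lf; exists g.
  have Sg j : shift_space (phi_ j) (g j).
    by apply: (filter_shift_space (mD j) (phiD j) (hg j)).
  exists g => //; apply/cvgL2_L2dist => //.
    by move=> n; apply: Lsum => j; exact: filter_L2r (hg j).
  apply: filter_partial_sums => //; apply: shift_space_fixed phiU Sf.
  + exact: bigcupT_measurable.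
  + exact: periodic_bigcup.
- move=> f g h Sf Wg sg Wh sh j; have Lf := shift_space_L2 Sf.
  have Lg i := shift_space_L2 (Wg i); have Lh i := shift_space_L2 (Wh i).
  move: sg sh => /cvgL2_L2dist sg /cvgL2_L2dist sh.
  have {}sg := (cvgL2P _ _).1 (sg (fun n => Lsum g n Lg) Lf).
  have {}sh := (cvgL2P _ _).1 (sh (fun n => Lsum h n Lh) Lf).
  pose d i x := g i x - h i x.
  have Fd i : filter_of (D i) (d i) (d i).
    have Fi := filter_idem (phiD i); apply: filterB.
      exact: shift_space_fixed (mD i) (pD i) _ _ Fi (Wg i).
    exact: shift_space_fixed (mD i) (pD i) _ _ Fi (Wh i).
  have key n : (j < n)%N -> nrm (d j) <= nrm (fun x => \sum_(i < n) d i x).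
    move=> jn; apply: (filter_contract (mD j)).
    have H (i : 'I_n) : filter_of (D j) (d i) (if i == j :> nat then d j else fun=> 0).
      case: eqVneq => [->|ij] //; apply: filter_disjoint (Fd i).
      by move/trivIsetP : tD; apply.
    have := filter_sum (index_enum 'I_n) (fun=> 1) H.
    congr filter_of; apply/funext => x; first by apply: eq_bigr => i _; rewrite mul1r.
    rewrite (bigD1 (Ordinal jn)) //= eqxx mul1r big1 ?addr0 // => i ij.
    by rewrite mul1r ifN.
  apply: dist_eq0_ae => //; apply/eqP; rewrite eq_le nrm_ge0 andbT.
  apply/ler_addgt0Pl => e e0; rewrite addr0; have e2 : 0 < e / 2 by rewrite divr_gt0.
  have [N1 _ h1] := sg _ e2; have [N2 _ h2] := sh _ e2; pose n := (N1 + N2 + j.+1)%N.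
  have jn : (j < n)%N by rewrite /n; lia.
  apply: le_trans (key n jn) _.
  have {}h1 : nrm (fun x => \sum_(i < n) g i x - f x) < e / 2.
    by apply: h1; rewrite /= /n; lia.
  have {}h2 : nrm (fun x => \sum_(i < n) h i x - f x) < e / 2.
    by apply: h2; rewrite /= /n; lia.
  have := nrmB (L2B (Lsum g n Lg) Lf) (L2B (Lsum h n Lh) Lf).
  rewrite (_ : (fun x => _ - _ - _) = (fun x => \sum_(i < n) d i x)); first by lra.
  by apply/funext => x; rewrite /d sumrB; ring.
- move=> f g Lf Wg /cvgL2_L2dist sg.
  have Lg i := shift_space_L2 (Wg i).
  apply: (shift_space_lim Lphi Lf _ (sg (fun n => Lsum g n Lg) Lf)) => n.
  have := shift_space_sum (index_enum 'I_n) (fun=> 1) Lphi (fun i : 'I_n => sub i _ (Wg i)).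
  by congr shift_space; apply/funext => x; apply: eq_bigr => i _; rewrite mul1r.
Qed.

End Decomposition.

Section Support.
Context {R : realType}.
Local Notation mu := (@lebesgue_measure R).

(** The term k = 0 of the Grammian is already positive. *)
Lemma grammian_support_gt0 (fh : R -> R[i]) w : fh w <> 0 -> grammian_support fh w.
Proof.
move=> fw; rewrite /grammian_support /= /grammian.
have h0 : 0 < modulus (fh w) ^+ 2.
  by rewrite exprn_gt0 // lt_neqAle modulus_ge0 andbT eq_sym; apply/eqP => /modulus_eq0.
apply: (@lt_le_trans _ _ (modulus (fh w) ^+ 2)%:E); first by rewrite lte_fin.
apply: esum_ge; exists [set 0 : int]; first by split.
by rewrite fsbig_set1 addr0.
Qed.

Lemma cutoff_indic (f f0 : R -> R[i]) (A B : set R) : {ae mu, forall w, f w = f0 w} ->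
  {ae mu, forall w, A w <-> B w} -> {ae mu, forall w, cutoff f A w = indic B w * f0 w}.
Proof.
move=> e1 e2; move: e1 e2; apply: aeS2 => w fw AB; rewrite /cutoff fw mulrC; congr (_ * _).
by rewrite /indic !indicE; congr ((_ : bool)%:R)%:C; apply/idP/idP; rewrite !inE => /AB.
Qed.

(** This is where Lebesgue measurable sets and transforms are exchanged for Borel ones. *)
Lemma filter_cutoff (f f0 g fh : R -> R[i]) (A B : set R) : measurable B ->
  FT f f0 -> {ae mu, forall w, fh w = f0 w} -> {ae mu, forall w, A w <-> B w} ->
  fourierL2 g (cutoff fh A) <-> filter_of B f g.
Proof.
move=> mB F ff0 AB; have e := cutoff_indic ff0 AB; split.
  move=> /fourierL2P[g0 G gg0]; exists f0 => //; apply: (FT_ae G).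
    by apply: cmeasM; [exact: cmeas_indic|exact: L2_cmeas (FT_L2r F)].
  by move: gg0 e; apply: aeS2 => w ->.
move=> /(filter_FT mB)/(_ F) G; apply/fourierL2P; eexists; first exact: G.
exact: e.
Qed.
End Support.

Theorem proposition1 (R : realType) (phi phihat : R -> R[i])
    (E : nat -> set R) (phi_ : nat -> R -> R[i])
    (phi_sampling : sampling_space phi)
    (phi_hat : fourierL2 phi phihat)
    (E_cover : grammian_support phihat = \bigcup_j E j)
    (E_meas : forall j, lebesgue_measurable (E j))
    (E_disj : forall j l, j <> l ->
       (@lebesgue_measure R).-negligible (E j `&` E l))
    (E_periodic : forall j (k : int), [set x + k%:~R | x in E j] = E j)
    (phi_j_hat : forall j, fourierL2 (phi_ j) (cutoff phihat (E j))) :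
  [/\ hilbert_direct_sum (shift_space phi) (fun j => shift_space (phi_ j)),
      forall j, sampling_space (phi_ j) &
      forall s shat, sampling_function (shift_space phi) s ->
        fourierL2 s shat ->
        forall j sj, sampling_function (shift_space (phi_ j)) sj ->
          fourierL2 sj (cutoff shat (E j))].
Proof.
have pE j : periodic (E j) by move=> w k Ew; rewrite -(E_periodic j k); exists w.
have [D [mD pD tD ED]] := periodic_partition E_meas pE E_disj.
have [ph0 Fphi phi0] := (fourierL2P _ _).1 phi_hat.
have phiD j : filter_of (D j) phi (phi_ j) by exact: (filter_cutoff _ (mD j) Fphi phi0 (ED j)).1 (phi_j_hat j).
(* The transform of phi vanishes almost everywhere outside the union of the D j *)
have phiU : filter_of (\bigcup_j D j) phi phi.
  exists ph0 => //; apply: (FT_ae Fphi).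
    apply: cmeasM; last exact: L2_cmeas (FT_L2r Fphi).
    by apply: cmeas_indic; exact: bigcupT_measurable.
  have {}ED : {ae lebesgue_measure, forall w, forall j, E j w <-> D j w} by apply/ae_foralln.
  move: phi0 ED; apply: aeS2 => w phw EDw.
  have [p0|/eqP p0] := eqVneq (ph0 w) 0; first by rewrite p0 mulr0.
  have : (\bigcup_j E j) w by rewrite -E_cover; apply: grammian_support_gt0; rewrite phw.
  by move=> [j _ /EDw Dw]; rewrite indicT ?mul1r //; exists j.
split; first exact: filter_direct_sum phiU phiD.
  move=> j; have [[Lphi fr] [s Hs]] := phi_sampling.
  have [s' Hs' _] := filter_sampling (mD j) (pD j) (phiD j) Hs; split; last by exists s'.
  split; first exact: filter_L2r (phiD j).
  by apply: filter_frame (phiD j) (phiD j) fr; [exact: mD|exact: pD].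
move=> s shat Hs /fourierL2P[s0 Fs ss0] j sj Hsj.
have [s' Hs' Fs'] := filter_sampling (mD j) (pD j) (phiD j) Hs.
by rewrite (sampling_unique Hsj Hs'); exact: (filter_cutoff _ (mD j) Fs ss0 (ED j)).2 Fs'.
Qed.
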